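(* For $m\in\{1,2,\dots\}\cup\{\infty\}$ and $\beta\in[0,1]$, consider the $m$-excited random walk $Y=(Y_n)_{n\ge0}$ on $\mathbb Z^d$ with bias $\beta$, and let $v(m,\beta)$ be its speed. Then: (1) The asymptotic range $R(\beta)$ of the $\infty$-excited random walk with bias $\beta$ is monotonic in $\beta\in[0,1]$. (2) If $d\ge4$, then for all $0<\beta_0<\beta_1<1$ there exists an integer $m_0=m(\beta_0,\beta_1)$ such that for every integer $m\ge m_0$ the function $\beta\mapsto v(m,\beta)$ is monotonic on $[\beta_0,\beta_1]$.
   Context: $e_1,\dots,e_d$ is the canonical basis of $\mathbb Z^d$. The $m$-excited random walk ($m$-ERW) with bias $\beta\in[0,1]$ is the nearest-neighbour process $(Y_n)_{n\ge0}$ on $\mathbb Z^d$ with law $\mathbb P_{m,\beta}$ such that $Y_0=0$ and, with $\mathcal F_n=\sigma(Y_0,\dots,Y_n)$: $\mathbb P_{m,\beta}[Y_{n+1}-Y_n=\pm e_i\mid\mathcal F_n]=\frac1{2d}$ for $2\le i\le d$; and on the event $\{\#\{i\le n:Y_i=Y_n\}=k\}$ (the walk is at its current site for the $k$-th time), $\mathbb P_{m,\beta}[Y_{n+1}-Y_n=\pm e_1\mid\mathcal F_n]=\frac{1\pm\beta1_{\{k\le m\}}}{2d}$. For $m=\infty$ this is the simple random walk with drift in which every step has probabilities $\frac{1\pm\beta}{2d}$ for $\pm e_1$ and $\frac1{2d}$ for $\pm e_i$, $i\ge2$. The speed $v(m,\beta)$ is the almost sure limit $\lim_{n\to\infty}Y_n\cdot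 e_1/n$. The asymptotic range is $R(\beta)=\lim_{n\to\infty}\mathbb E_{\infty,\beta}(N_n)/n$, where $N_n$ is the number of distinct points in $\{Y_0,\dots,Y_{n-1}\}$ (this limit exists, and $N_n/n$ also converges $\mathbb P_{\infty,\beta}$-almost surely). *)

(* Defs.v *)
From HB Require Import structures.
From mathcomp Require Import all_boot all_order all_algebra.
From mathcomp Require Import all_classical all_reals all_analysis.

Set Implicit Arguments.
Unset Strict Implicit.
Unset Printing Implicit Defensive.

Import Order.TTheory GRing.Theory Num.Theory.
Import numFieldNormedType.Exports.

Local Open Scope classical_set_scope.
Local Open Scope ring_scope.

(** Points of Z^d are row vectors ['rV[int]_d]. Only [d >= 1] makes sense, so the
    dimension is written [d.+1]; the coordinate [ord0] is the excited direction
    e_1. Trajectories are indexed by time first: [Y n w] is the position at time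
    [n] for the outcome [w]. *)

Section Conditioning.
Context (disp : measure_display) (T : measurableType disp) (R : realType).

(** [g] is a version of the conditional probability P[A | F]. *)
Definition is_cond_prob (P : probability T R) (F : set (set T)) (A : set T)
    (g : T -> R) : Prop :=
  [/\ forall B : set R, measurable B -> F (g @^-1` B),
      P.-integrable setT (EFin \o g)
    & forall B : set T, F B -> P (A `&` B) = (\int[P]_(w in B) (g w)%:E)%E].

End Conditioning.

Section ExcitedRandomWalk.
Context (disp : measure_display) (T : measurableType disp) (R : realType) (d : nat).
Implicit Types (P : probability T R) (Y : nat -> T -> 'rV[int]_d.+1).

(** sigma(Y_0, ..., Y_n), where Z^d carries its discrete sigma-algebra. *)
Definition natural_filtration Y (n : nat) : set (set T) :=
  <<s [set A | exists i (B : set 'rV[int]_d.+1), (i <= n)%N /\ A = Y i @^-1` B] >>.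

(** The number of [i <= n] with Y_i = Y_n; it is at least 1. *)
Definition visits Y (n : nat) (w : T) : nat :=
  count (fun i => Y i w == Y n w) (iota 0 n.+1).

(** The number of excitations per site: [Some m] for an integer [m], [None] for
    infinity. *)
Definition excited (m : option nat) (k : nat) : bool :=
  if m is Some m' then (k <= m')%N else true.

(** The step (-1)^s e_i, and its probability at the [k]-th visit to a site. *)
Definition unit_step (i : 'I_d.+1) (s : bool) : 'rV[int]_d.+1 :=
  (-1) ^+ s *: delta_mx 0 i.

Definition step_prob (m : option nat) (beta : R) (k : nat)
    (i : 'I_d.+1) (s : bool) : R :=
  (if i == ord0 then 1 + (-1) ^+ s * (beta * (excited m k)%:R) else 1)
    / (2 * d.+1)%:R.

(** Under [P], the process [Y] is an [m]-excited random walk with bias [beta]. *)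
Definition excited_random_walk P Y (m : option nat) (beta : R) : Prop :=
  [/\ forall n (B : set 'rV[int]_d.+1), measurable (Y n @^-1` B),
      {ae P, forall w, Y 0%N w = 0}
    & forall n i s,
        is_cond_prob P (natural_filtration Y n)
          [set w | Y n.+1 w - Y n w = unit_step i s]
          (fun w => step_prob m beta (visits Y n w) i s)].

Definition is_speed P Y (v : R) : Prop :=
  {ae P, forall w, (fun n => (Y n w 0 ord0)%:~R / n%:R : R) @ \oo --> v}.

(** N_n, the number of distinct points among Y_0, ..., Y_{n-1}. *)
Definition range_size Y (n : nat) (w : T) : nat :=
  size (undup [seq Y i w | i <- iota 0 n]).

Definition asymptotic_range P Y : R :=
  limn (fun n => fine 'E_P[fun w => (range_size Y n w)%:R] / n%:R).

End ExcitedRandomWalk.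

(* Main.v *)
(** (1) Reversing time, the expected range is the sum over [i] of the probability
    that the drifted walk has not returned to its start by time [i]. This decreases
    by the probability of first returning at time [i + 1], and a loop has as many
    steps [+e_1] as [-e_1]: its weight depends on [beta] through a power of
    [1 - beta ^ 2], so escape probabilities increase with [beta].

    (2) The speed is [beta (1 - h) / d], where [h] is the asymptotic fraction of
    unexcited steps; when [h] and its Lipschitz constant in [beta] are small,
    this increases with [beta]. The first three lateral coordinates give
    [P(Y_n = x) = O(n ^ (-3/2))] whatever the excitations, so sites are rarely
    visited more than [m] times, and the drift is felt uniformly in large [m]: the
    lengths of the blocks between renewal times have tail [O(t ^ -4)]. By the
    renewal equations, [h] is the mean number of unexcited steps of a block divided
    by its mean length. Both are sums over blocks of weights whose logarithmic
    derivative in [beta] is at most the length over [1 - beta_1], and the number of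
    unexcited steps of a block, even multiplied by its length, has mean tending to
    [0] as [m] grows. *)

Require Import Defs.
From HB Require Import structures.
From mathcomp Require Import all_boot all_order all_algebra.
From mathcomp Require Import all_classical all_reals all_analysis.
From mathcomp Require Import measurable_realfun.
From mathcomp Require Import ring lra zify polyrcf.

Set Implicit Arguments.
Unset Strict Implicit.
Unset Printing Implicit Defensive.

Import Order.TTheory GRing.Theory Num.Theory.
Import numFieldNormedType.Exports.

Local Open Scope classical_set_scope.
Local Open Scope ring_scope.

(** * Expectations under history-dependent kernels *)

(** A walk is reduced to its step kernel on finite histories, and its almost sure speed is used only
    through convergence in mean, so the analysis consists of finite sums. Renewals are accordingly
    defined at a finite horizon, on trajectories that stay at nonnegative levels, and a trajectory
    is cut at its latest renewal; this gives exact convolution identities. If [r] is the renewal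
    sequence and [delta] lists the block means of an additive functional by block length, the mean
    of this functional on renewals is the convolution of [delta] with the convolution square of [r],
    whose partial sums grow like n^2. A functional that is o(n) in mean therefore has total block
    mean 0. Truncated block sums are polynomials in the bias, so that the mean value theorem bounds
    their increments uniformly in the truncation. The exponents of the tail estimate come from the
    sites visited long ago: n^9 of them, hit with probability of order i^(-3/2) at time i, spoil on
    average about n^9 n^(-3) = n^6 steps after time n^6, a small part of a window of A n^6 steps.
    There are n^3 / A windows in n^9 steps, and n / A of them in a descent of n^7 levels. *)

Section KernelExpectation.
Context (R : realType) (S : finType).
Implicit Types (k : seq S -> S -> R) (f g : seq S -> R) (h u : seq S) (n : nat).

(** Histories are listed most recent step first, so that [s :: h] extends [h] by
    the step [s]; [kexp k n f h] is the expectation of [f] after [n] more steps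
    of the history-dependent kernel [k]. *)
Definition kexp k n f h : R :=
  iter n (fun f0 h0 => \sum_s k h0 s * f0 (s :: h0)) f h.

Lemma kexp0 k f h : kexp k 0 f h = f h.
Proof. by []. Qed.

Lemma kexpS k n f h : kexp k n.+1 f h = \sum_s k h s * kexp k n f (s :: h).
Proof. by []. Qed.

Lemma kexpD k n1 n2 f h : kexp k (n1 + n2) f h = kexp k n1 (kexp k n2 f) h.
Proof. by rewrite /kexp iterD. Qed.

Lemma kexpSr k n f h :
  kexp k n.+1 f h = kexp k n (fun u => \sum_s k u s * f (s :: u)) h.
Proof. by rewrite /kexp iterSr. Qed.

Lemma eq_kexp k n f g h :
  (forall u, size u = n -> f (u ++ h) = g (u ++ h)) -> kexp k n f h = kexp k n g h.
Proof.
elim: n h => [|n IH] h fg; first exact: (fg [::]).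
rewrite !kexpS; apply: eq_bigr => s _; congr (_ * _); apply: IH => u su.
by rewrite -cat_rcons; apply: fg; rewrite size_rcons su.
Qed.

Lemma kexp_lin k n c f g h :
  kexp k n (fun u => c * f u + g u) h = c * kexp k n f h + kexp k n g h.
Proof.
elim: n h => [//|n IH] h; rewrite !kexpS mulr_sumr -big_split /=.
by apply: eq_bigr => s _; rewrite IH; ring.
Qed.

Lemma kexp_0 k n h : kexp k n (fun=> 0) h = 0.
Proof. by elim: n h => [//|n IH] h; rewrite kexpS big1// => s _; rewrite IH mulr0. Qed.

Lemma kexpZ k n c f h : kexp k n (fun u => c * f u) h = c * kexp k n f h.
Proof.
have := kexp_lin k n c f (fun=> 0) h; rewrite kexp_0 addr0 => <-.
by apply: eq_kexp => u _; rewrite addr0.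
Qed.

Lemma kexp_add k n f g h :
  kexp k n (fun u => f u + g u) h = kexp k n f h + kexp k n g h.
Proof.
have := kexp_lin k n 1 f g h; rewrite mul1r => <-.
by apply: eq_kexp => u _; rewrite mul1r.
Qed.

Lemma kexp_opp k n f h : kexp k n (fun u => - f u) h = - kexp k n f h.
Proof.
have := kexpZ k n (-1) f h; rewrite mulN1r => <-.
by apply: eq_kexp => u _; rewrite mulN1r.
Qed.

Lemma kexp_sub k n f g h :
  kexp k n (fun u => f u - g u) h = kexp k n f h - kexp k n g h.
Proof. by rewrite kexp_add kexp_opp. Qed.

Lemma kexp_sum k n (I : Type) (r : seq I) (P : pred I) (F : I -> seq S -> R) h :
  kexp k n (fun u => \sum_(i <- r | P i) F i u) h =
  \sum_(i <- r | P i) kexp k n (F i) h.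
Proof.
elim: r => [|i r IH].
  by rewrite big_nil -[RHS](kexp_0 k n h); apply: eq_kexp => u _; rewrite big_nil.
rewrite big_cons -IH; case: ifP => Pi.
  by rewrite -kexp_add; apply: eq_kexp => u _; rewrite big_cons Pi.
by apply: eq_kexp => u _; rewrite big_cons Pi.
Qed.

Definition is_kernel k :=
  (forall h s, 0 <= k h s) /\ (forall h, \sum_s k h s = 1).

Section Stochastic.
Variable (k : seq S -> S -> R).
Hypothesis kK : is_kernel k.

Lemma kexp_cst n c h : kexp k n (fun=> c) h = c.
Proof.
elim: n h => [//|n IH] h; rewrite kexpS.
by under eq_bigr => s _ do rewrite IH; rewrite -mulr_suml kK.2 mul1r.
Qed.

Lemma le_kexp n f g h :
  (forall u, size u = n -> f (u ++ h) <= g (u ++ h)) -> kexp k n f h <= kexp k n g h.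
Proof.
elim: n h => [|n IH] h fg; first exact: (fg [::]).
rewrite !kexpS; apply: ler_sum => s _; apply: ler_wpM2l; first exact: kK.1.
apply: IH => u su.
by rewrite -cat_rcons; apply: fg; rewrite size_rcons su.
Qed.

Lemma kexp_ge0 n f h : (forall u, size u = n -> 0 <= f (u ++ h)) -> 0 <= kexp k n f h.
Proof. by move=> f0; rewrite -(kexp_cst n 0 h); apply: le_kexp. Qed.

Lemma kexp_le_cst n c f h :
  (forall u, size u = n -> f (u ++ h) <= c) -> kexp k n f h <= c.
Proof. by move=> fc; rewrite -[leRHS](kexp_cst n c h); apply: le_kexp. Qed.

Lemma kexp_ge_cst n c f h :
  (forall u, size u = n -> c <= f (u ++ h)) -> c <= kexp k n f h.
Proof. by move=> fc; rewrite -[leLHS](kexp_cst n c h); apply: le_kexp. Qed.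

Lemma ler_norm_kexp n f h : `|kexp k n f h| <= kexp k n (fun u => `|f u|) h.
Proof.
rewrite ler_norml -kexp_opp; apply/andP; split; apply: le_kexp => u _.
  by rewrite lerNl -normrN ler_norm.
exact: ler_norm.
Qed.

(** [drop n2] forgets the newest [n2] steps, whose probabilities add up to one. *)
Lemma kexp_ancestor n1 n2 f h :
  kexp k (n1 + n2) (fun u => f (drop n2 u)) h = kexp k n1 f h.
Proof.
rewrite kexpD; apply: eq_kexp => u _.
rewrite -[RHS](kexp_cst n2 _ (u ++ h)); apply: eq_kexp => w sw.
by rewrite drop_size_cat.
Qed.

Lemma kexp_prob n (A : pred (seq S)) h : kexp k n (fun u => (A u)%:R) h <= 1.
Proof. by apply: kexp_le_cst => u _; case: (A _). Qed.

End Stochastic.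

End KernelExpectation.

Arguments kexp : simpl never.

(** * The excited walk as a kernel, and its restart at record levels *)

Section Suffixes.
Context (S : Type).
Implicit Types (A : pred (seq S)) (h u : seq S).

(** Since histories are reversed, the suffixes of [h] are the past histories,
    [h] included; [allpast] leaves [h] out. *)
Fixpoint allsuf A h := A h && (if h is _ :: h' then allsuf A h' else true).

Definition allpast A h := if h is _ :: h' then allsuf A h' else true.

Lemma allsufE A h : allsuf A h = A h && allpast A h.
Proof. by case: h. Qed.

Lemma allsufP A h :
  reflect (forall i, (i <= size h)%N -> A (drop i h)) (allsuf A h).
Proof.
apply: (iffP idP) => [|H].
  elim: h => [|s h IH] /=; first by rewrite andbT => ? [].
  by case/andP => Ah /IH H [|i]//; apply: H.
elim: h H => [|s h IH] H /=; first by rewrite andbT; exact: (H 0%N).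
apply/andP; split; first exact: (H 0%N).
by apply: IH => i ih; exact: (H i.+1).
Qed.

Lemma allpastP A h :
  reflect (forall i, (0 < i <= size h)%N -> A (drop i h)) (allpast A h).
Proof.
case: h => [|s h] /=; first by apply: ReflectT => -[].
apply: (iffP (allsufP _ _)) => H i; first by case: i => // i; apply: H.
by move=> ih; exact: (H i.+1).
Qed.

Lemma allsuf_impl A A' h :
  (forall i, (i <= size h)%N -> A (drop i h) -> A' (drop i h)) ->
  allsuf A h -> allsuf A' h.
Proof. by move=> AA /allsufP H; apply/allsufP => i ih; apply: AA => //; apply: H. Qed.

Lemma allsuf_drop A h i : allsuf A h -> allsuf A (drop i h).
Proof.
move=> /allsufP H; apply/allsufP => j; rewrite size_drop drop_drop => ij.
case: (leqP i (size h)) => ih; first by apply: H; lia.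
rewrite drop_oversize; last by lia.
by rewrite -(drop_size h); apply: H.
Qed.

Lemma allsuf_cat A u h :
  allsuf A (u ++ h) = allsuf (fun t => A (t ++ h)) u && allpast A h.
Proof.
elim: u => [|s u IH] /=; first by rewrite andbT allsufE.
by rewrite IH andbA.
Qed.

End Suffixes.

Section ExcitedKernel.
Context (R : realType) (d : nat).

Definition step : finType := ('I_d.+1 * bool)%type.
Local Notation history := (seq step).
Implicit Types (h u : history) (s : step) (m : option nat) (beta : R).

Definition pos h : 'rV[int]_d.+1 := \sum_(s <- h) unit_step s.1 s.2.
Definition lev h : int := pos h 0 ord0.
Definition dlev s : int := if s.1 == ord0 then (-1) ^+ s.2 else 0.

Fixpoint hits (x : 'rV[int]_d.+1) h : nat :=
  (pos h == x) + (if h is _ :: h' then hits x h' else 0).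
Definition nvis h := hits (pos h) h.

Definition erw m beta h s : R := step_prob m beta (nvis h) s.1 s.2.
Definition unexcited m h := ~~ excited m (nvis h).
(** A step is charged to the history that it leaves, so the endpoint of [h] itself is not
    counted. *)
Fixpoint nunexc m h : nat :=
  if h is _ :: h' then (unexcited m h' + nunexc m h')%N else 0%N.

Lemma pos_nil : pos [::] = 0. Proof. exact: big_nil. Qed.
Lemma pos_cons s h : pos (s :: h) = unit_step s.1 s.2 + pos h.
Proof. exact: big_cons. Qed.
Lemma pos_cat u h : pos (u ++ h) = pos u + pos h.
Proof. exact: big_cat. Qed.

Lemma unit_stepE (i j : 'I_d.+1) b : unit_step i b 0 j = if j == i then (-1) ^+ b else 0.
Proof. by rewrite /unit_step !mxE /= mulr_natr; case: (j == i); rewrite ?mulr1n ?mulr0n. Qed.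

Lemma lev_nil : lev [::] = 0. Proof. by rewrite /lev pos_nil mxE. Qed.
Lemma lev_cons s h : lev (s :: h) = dlev s + lev h.
Proof. by rewrite /lev pos_cons mxE unit_stepE /dlev eq_sym. Qed.
Lemma lev_cat u h : lev (u ++ h) = lev u + lev h.
Proof. by rewrite /lev pos_cat mxE. Qed.

Lemma dlev_norm s : `|dlev s| <= 1.
Proof. by rewrite /dlev; case: ifP; case: s.2. Qed.

Lemma lev_norm h : `|lev h| <= (size h)%:Z.
Proof.
elim: h => [|s h IH]; first by rewrite lev_nil.
rewrite lev_cons (le_trans (ler_normD _ _))//= -add1n PoszD.
by apply: lerD => //; apply: dlev_norm.
Qed.

Lemma sum_step (V : nmodType) (F : step -> V) :
  \sum_s F s = \sum_(i < d.+1) (F (i, false) + F (i, true)).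
Proof.
rewrite (eq_bigr (fun s => F (s.1, s.2))); last by case.
rewrite -(pair_bigA _ (fun i b => F (i, b))) /=.
by apply: eq_bigr => i _; rewrite big_bool addrC.
Qed.

Lemma erwE m beta h s : erw m beta h s =
  (if s.1 == ord0 then 1 + (-1) ^+ s.2 * (beta * (excited m (nvis h))%:R) else 1)
   / (2 * d.+1)%:R.
Proof. by []. Qed.

Lemma erw_kernel m beta : 0 <= beta <= 1 -> is_kernel (erw m beta).
Proof.
move=> /andP[b0 b1]; split=> h => [s|].
  rewrite erwE divr_ge0 ?ler0n//; case: ifP => // _.
  by case: s.2; case: excited; rewrite ?expr0 ?expr1 /=; lra.
rewrite sum_step (eq_bigr (fun=> d.+1%:R^-1)) => [|i _].
  by rewrite sumr_const card_ord -[LHS]mulr_natl divff// pnatr_eq0.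
rewrite !erwE /= natrM; have dn0 : d.+1%:R != 0 :> R by rewrite pnatr_eq0.
by case: ifP => _; rewrite ?expr0 ?expr1; field.
Qed.

Lemma mean_dlev m beta h : \sum_s erw m beta h s * (dlev s)%:~R =
  beta / d.+1%:R * (~~ unexcited m h)%:R.
Proof.
rewrite sum_step (bigD1 ord0)//= big1 ?addr0 => [|i /negbTE i0]; last first.
  by rewrite /dlev /= i0 !mulr0 addr0.
rewrite !erwE /dlev /= /unexcited negbK natrM.
have dn0 : d.+1%:R != 0 :> R by rewrite pnatr_eq0.
by rewrite ?expr0 ?expr1 ?mulrN1z; field.
Qed.

Definition newmax h := allpast (fun t => lev t < lev h) h.
Definition stay h := allsuf (fun t => 0 <= lev t) h.

(** All sites before a strict record lie strictly below it, so a site at or above the record level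
    has no visit in the past. *)
Lemma hits_fresh (x : 'rV[int]_d.+1) u h : newmax h -> 0 <= x 0 ord0 ->
  hits (x + pos h) (u ++ h) = hits x u.
Proof.
move=> rh x0; elim: u => [|s u IH] /=; last first.
  by rewrite -/(cat u h) IH -cat_cons pos_cat (inj_eq (addIr _)).
rewrite pos_nil addn0.
have past t : allsuf (fun t => lev t < lev h) t -> hits (x + pos h) t = 0%N.
  elim: t => [|s t IHt] /=.
    rewrite andbT addn0 => lt; apply/eqP; rewrite eqb0; apply/eqP => e.
    by move: lt; rewrite /lev e mxE gtrDr ltNge x0.
  case/andP => lt /IHt ->; rewrite addn0; apply/eqP; rewrite eqb0; apply/eqP => e.
  by move: lt; rewrite /lev e mxE gtrDr ltNge x0.
have -> : hits (x + pos h) h = (pos h == x + pos h :> 'rV_d.+1) :> nat.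
  by case: h rh past => [|s h] rh past /=; rewrite ?addn0 ?past ?addn0.
by congr nat_of_bool; rewrite -[X in X == _]add0r (inj_eq (addIr _)).
Qed.

Lemma nvis_fresh u h : newmax h -> 0 <= lev u -> nvis (u ++ h) = nvis u.
Proof. by move=> rh u0; rewrite /nvis pos_cat hits_fresh. Qed.

Lemma erw_fresh m beta u h s : newmax h -> 0 <= lev u ->
  erw m beta (u ++ h) s = erw m beta u s.
Proof. by move=> rh u0; rewrite /erw nvis_fresh. Qed.

Lemma stay_lev u : stay u -> 0 <= lev u.
Proof. by rewrite /stay allsufE => /andP[]. Qed.

Lemma nunexc_fresh m u h : newmax h -> stay u ->
  nunexc m (u ++ h) = (nunexc m u + nunexc m h)%N.
Proof.
move=> rh; elim: u => [//|s u IH] /= /andP[_ su].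
by rewrite -/(cat u h) IH// /unexcited nvis_fresh ?addnA// stay_lev.
Qed.

(** Above a strict record level the environment is unvisited, so the walk
    restarts as long as it does not go back below that level. *)
Lemma kexp_fresh m beta n (F f : history -> R) h :
  newmax h -> (forall u, size u = n -> F (u ++ h) = f u) ->
  (forall u, ~~ stay u -> f u = 0) ->
  kexp (erw m beta) n F h = kexp (erw m beta) n f [::].
Proof.
move=> rh; elim: n F f => [|n IH] F f Ff f0; first exact: (Ff [::]).
rewrite !kexpSr; apply: IH => u su.
  apply: eq_bigr => s _; rewrite -cat_cons Ff /= ?su//.
  have [/stay_lev st|nst] := boolP (stay u); first by rewrite erw_fresh.
  by rewrite f0 ?mulr0//= negb_and nst orbT.
by rewrite big1// => s _; rewrite f0 ?mulr0//= negb_and su orbT.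
Qed.

Lemma nunexc_le m h : (nunexc m h <= size h)%N.
Proof. by elim: h => //= s h; case: unexcited => /=; lia. Qed.

End ExcitedKernel.

Notation history d := (seq (step d)).

(** * Heat kernel bound from three lateral coordinates *)

Section BinomialMixtures.
Context (R : realType).
Implicit Types (F G : nat -> nat -> R) (p : R) (n k l : nat).

(** The expectation of [F B (n - B)] for [B] binomial with parameters [n] and [p]. *)
Definition binmix p F n : R :=
  \sum_(k < n.+1) 'C(n, k)%:R * p ^+ k * (1 - p) ^+ (n - k) * F k (n - k)%N.

Lemma binmix0 p F : binmix p F 0 = F 0%N 0%N.
Proof. by rewrite /binmix big_ord1 bin0 !expr0 !mul1r. Qed.

Lemma binmix_lin p a F G n :
  binmix p (fun k l => a * F k l + G k l) n = a * binmix p F n + binmix p G n.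
Proof.
by rewrite /binmix mulr_sumr -big_split /=; apply: eq_bigr => k _; ring.
Qed.

Lemma eq_binmix p F G n : (forall k l, F k l = G k l) -> binmix p F n = binmix p G n.
Proof. by move=> FG; apply: eq_bigr => k _; rewrite FG. Qed.

Lemma binmixZ p a F n : binmix p (fun k l => a * F k l) n = a * binmix p F n.
Proof. by rewrite /binmix mulr_sumr; apply: eq_bigr => k _; ring. Qed.

Lemma binmixS p F n : binmix p F n.+1 =
  p * binmix p (fun k l => F k.+1 l) n + (1 - p) * binmix p (fun k l => F k l.+1) n.
Proof.
rewrite /binmix big_ord_recl /= [X in _ + (1 - p) * X]big_ord_recl /=.
rewrite [X in _ = X + _]mulr_sumr [X in _ + _ * (_ + X)](_ : _ =
  \sum_(i < n.+1) 'C(n, i.+1)%:R * p ^+ i.+1 * (1 - p) ^+ (n - i.+1) * F i.+1 (n - i.+1).+1); last first.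
  rewrite [RHS]big_ord_recr /= bin_small// !mul0r addr0.
  by apply: eq_bigr => i _; rewrite /bump /= add1n.
rewrite mulrDr addrCA; congr (_ + _).
  by rewrite !bin0 !subn0 exprS; ring.
rewrite mulr_sumr -big_split /=; apply: eq_bigr => i _.
rewrite /bump /= add1n binS natrD subSS.
case: (ltnP i n) => [ilt|nle].
  by rewrite -(subnSK ilt) !exprS; ring.
by rewrite bin_small ?ltnS// !exprS; ring.
Qed.

Section Convex.
Variable p : R.
Hypotheses (p_ge0 : 0 <= p) (p_le1 : p <= 1).

Let q_ge0 : 0 <= 1 - p. Proof. by rewrite subr_ge0. Qed.

Lemma binmix_ge0 F n : (forall k l, 0 <= F k l) -> 0 <= binmix p F n.
Proof.
move=> F0; apply: sumr_ge0 => k _; by rewrite !mulr_ge0 ?ler0n ?exprn_ge0.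
Qed.

Lemma le_binmix F G n : (forall k l, F k l <= G k l) -> binmix p F n <= binmix p G n.
Proof.
move=> FG; apply: ler_sum => k _; apply: ler_wpM2l => //.
by rewrite !mulr_ge0 ?ler0n ?exprn_ge0.
Qed.

Lemma binmix1 n : binmix p (fun _ _ => 1) n = 1.
Proof. by elim: n => [|n IH]; rewrite ?binmix0// binmixS IH; ring. Qed.

(** Jensen's inequality, from the nonnegativity of a variance. It lets the heat kernels be bounded
    through their squares, whose bounds are rational in the number of steps. *)
Lemma binmix_sqr F n : binmix p F n ^+ 2 <= binmix p (fun k l => F k l ^+ 2) n.
Proof.
set m := binmix p F n.
have : 0 <= binmix p (fun k l => (F k l - m) ^+ 2) n.
  by apply: binmix_ge0 => *; exact: sqr_ge0.
rewrite (@eq_binmix p _ (fun k l => -(2 * m) * F k l + (m ^+ 2 * 1 + F k l ^+ 2))); last first.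
  by move=> k l; ring.
by rewrite !binmix_lin binmix1 -/m; lra.
Qed.

End Convex.

(** The next two lemmas absorb a denominator by
    ['C(n, k) / (k + 1) = 'C(n + 1, k + 1) / (n + 1)] and its mirror image. *)
Lemma binmix_divl p (g : nat -> R) n : 0 < p -> p <= 1 -> (forall l, 0 <= g l) ->
  binmix p (fun k l => g l / k.+1%:R) n <=
  (p * n.+1%:R)^-1 * binmix p (fun _ l => g l) n.+1.
Proof.
move=> p_gt0 p_le1 g0; have p0 : p != 0 by lra.
have q0 : 0 <= 1 - p by lra.
rewrite ler_pdivlMl ?mulr_gt0 ?ltr0n//.
rewrite /binmix mulr_sumr [leRHS]big_ord_recl /=.
rewrite -[leLHS]add0r lerD//.
  by rewrite !mulr_ge0 ?ler0n ?exprn_ge0 ?(ltW p_gt0) ?(ltW q0).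
rewrite le_eqVlt; apply/orP; left; apply/eqP; apply: eq_bigr => k _.
rewrite /bump /= add1n subSS exprS.
have -> : 'C(n.+1, k.+1)%:R = n.+1%:R * 'C(n, k)%:R / k.+1%:R :> R.
  by apply: (canRL (mulfK _)); rewrite ?pnatr_eq0// -!natrM (mul_bin_diag n.+1 k) mulnC.
by ring.
Qed.

Lemma binmix_divr p (g : nat -> R) n : 0 <= p -> p < 1 -> (forall l, 0 <= g l) ->
  binmix p (fun k l => g l.+1 / l.+1%:R) n <=
  ((1 - p) * n.+1%:R)^-1 * binmix p (fun _ l => g l) n.+1.
Proof.
move=> p_ge0 p_lt1 g0; have p0 : 1 - p != 0 by lra.
have q0 : 0 < 1 - p by lra.
rewrite ler_pdivlMl ?mulr_gt0 ?ltr0n//.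
rewrite /binmix mulr_sumr [leRHS]big_ord_recr /=.
rewrite -[leLHS]addr0 lerD//; last first.
  by rewrite !mulr_ge0 ?ler0n ?exprn_ge0 ?(ltW q0).
rewrite le_eqVlt; apply/orP; left; apply/eqP; apply: eq_bigr => k _.
have kn : (k <= n)%N by rewrite -ltnS.
rewrite subSn// exprS.
have -> : 'C(n.+1, k)%:R = n.+1%:R * 'C(n, k)%:R / (n - k).+1%:R :> R.
  apply: (canRL (mulfK _)); rewrite ?pnatr_eq0// -!natrM.
  by rewrite (mul_bin_down n.+1 k) subSn// mulnC.
by ring.
Qed.

Lemma binmix_inv1 p n : 0 < p -> p < 1 ->
  binmix p (fun k _ => k.+1%:R^-1) n <= p^-1 / n.+1%:R.
Proof.
move=> p0 p1.
rewrite (@eq_binmix _ _ (fun k l => 1 / k.+1%:R)) => [|k l]; last by rewrite div1r.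
apply: le_trans (@binmix_divl p (fun=> 1) n p0 (ltW p1) (fun=> ler01)) _.
by rewrite binmix1 ?(ltW p0) ?(ltW p1)// mulr1 invfM.
Qed.

Lemma binmix_invr p n : 0 < p -> p < 1 ->
  binmix p (fun _ l => l.+1%:R^-1) n <= (1 - p)^-1 / n.+1%:R.
Proof.
move=> p0 p1.
rewrite (@eq_binmix _ _ (fun k l => 1 / l.+1%:R)) => [|k l]; last by rewrite div1r.
apply: le_trans (@binmix_divr p (fun=> 1) n (ltW p0) p1 (fun=> ler01)) _.
by rewrite binmix1 ?(ltW p0) ?(ltW p1)// mulr1 invfM.
Qed.

Lemma binmix_inv2 p n : 0 < p -> p < 1 ->
  binmix p (fun k l => k.+1%:R^-1 * l.+1%:R^-1) n <= (p * (1 - p))^-1 / n.+1%:R ^+ 2.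
Proof.
move=> p0 p1; have q0 : 0 < 1 - p by lra.
rewrite (@eq_binmix _ _ (fun k l => l.+1%:R^-1 / k.+1%:R)) => [|k l]; last by rewrite mulrC.
apply: le_trans (@binmix_divl p (fun l => l.+1%:R^-1) n p0 (ltW p1) _) _ => //.
have -> : (p * (1 - p))^-1 / n.+1%:R ^+ 2 = (p * n.+1%:R)^-1 * ((1 - p)^-1 / n.+1%:R).
  by rewrite !exprS !expr0 !mulr1 !invfM; ring.
apply: ler_wpM2l; first by rewrite invr_ge0 mulr_ge0// ltW.
apply: le_trans (binmix_invr n.+1 p0 p1) _.
apply: ler_wpM2l; first by rewrite invr_ge0 ltW.
by rewrite lef_pV2 ?posrE ?ltr0n// ler_nat.
Qed.

Lemma binmix_inv3 p n : 0 < p -> p < 1 ->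
  binmix p (fun k l => k.+1%:R^-1 * (l.+1%:R ^+ 2)^-1) n <=
  (2 * (p * (1 - p) ^+ 2)^-1) / n.+1%:R ^+ 3.
Proof.
move=> p0 p1; have q0 : 0 < 1 - p by lra.
(* Since [l + 2 <= 2 (l + 1)], the square is traded for two consecutive factors, which the mirror
   lemmas can absorb one after the other. *)
apply: (@le_trans _ _ (binmix p (fun k l => 2 * ((l.+2%:R^-1 / l.+1%:R) / k.+1%:R)) n)).
  apply: le_binmix; rewrite ?(ltW p0) ?(ltW p1)// => k l.
  rewrite mulrC [leRHS]mulrA; apply: ler_wpM2r => //.
  rewrite expr2 invfM mulrA; apply: ler_wpM2r => //.
  rewrite -[X in _ <= X * _]invrK -invfM lef_pV2 ?posrE ?mulr_gt0 ?invr_gt0 ?ltr0n//.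
  by rewrite ler_pdivrMl// -natrM ler_nat; lia.
rewrite binmixZ -mulrA; apply: ler_wpM2l => //.
apply: le_trans (@binmix_divl p (fun l => l.+2%:R^-1 / l.+1%:R) n p0 (ltW p1) _) _.
  by move=> l; rewrite divr_ge0// invr_ge0.
have -> : (p * (1 - p) ^+ 2)^-1 / n.+1%:R ^+ 3 =
    (p * n.+1%:R)^-1 * (((1 - p) * n.+1%:R)^-1 * ((1 - p)^-1 / n.+1%:R)).
  by rewrite !exprS !expr0 !mulr1 !invfM; ring.
apply: ler_wpM2l; first by rewrite invr_ge0 mulr_ge0// ltW.
apply: le_trans (@binmix_divr p (fun l => l.+1%:R^-1) n.+1 (ltW p0) p1 _) _ => //.
have le_inv i j : (i <= j)%N -> j.+1%:R^-1 <= i.+1%:R^-1 :> R.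
  by move=> ij; rewrite lef_pV2 ?posrE ?ltr0n// ler_nat.
apply: ler_pM.
- by rewrite invr_ge0 mulr_ge0// ltW.
- by apply: binmix_ge0; rewrite ?(ltW p0) ?(ltW p1)// => k l; rewrite invr_ge0.
- by rewrite !invfM; apply: ler_wpM2l; rewrite ?invr_ge0 ?(ltW q0)// le_inv.
apply: le_trans (binmix_invr n.+2 p0 p1) _.
by apply: ler_wpM2l; [rewrite invr_ge0 ltW|apply: le_inv; lia].
Qed.

End BinomialMixtures.

Lemma bin_half_max n j : ('C(n, j) <= 'C(n, n./2))%N.
Proof.
have up k : (k.+1 <= n./2)%N -> ('C(n, k) <= 'C(n, k.+1))%N.
  move=> kn; rewrite -(leq_pmul2l (ltn0Sn k)) mul_bin_left leq_mul2r.
  by apply/orP; right; lia.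
have below i : (i <= n./2)%N -> ('C(n, n./2 - i) <= 'C(n, n./2))%N.
  elim: i => [|i IH] ile; first by rewrite subn0.
  apply: leq_trans (IH _); last by lia.
  by have := up (n./2 - i.+1)%N; rewrite subnSK//; apply; lia.
case: (leqP j n./2) => jn; first by rewrite -(subKn jn); apply: below; lia.
case: (leqP j n) => jn'; last by rewrite bin_small.
rewrite -bin_sub// (_ : n - j = n./2 - (n./2 - (n - j)))%N; last by lia.
by apply: below; lia.
Qed.

(** From [2 j] to [2 j + 2] the left side is multiplied by [16 (2 j + 1) (2 j + 3) / (2 j + 2) ^ 2
    <= 16], and from [2 j] to [2 j + 1] by [4 (2 j + 1) / (2 j + 2) <= 4]. *)
Lemma central_bin_sqr n : ('C(n, n./2) ^ 2 * n.+1 <= 4 ^ n)%N.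
Proof.
have odd_even j : (j.+1 * 'C(j.*2.+1, j) = j.*2.+1 * 'C(j.*2, j))%N.
  by rewrite (mul_bin_down j.*2.+1 j); congr (_ * _)%N; lia.
have even_odd j : ('C(j.*2.+2, j.+1) = 2 * 'C(j.*2.+1, j))%N.
  apply/eqP; rewrite -(eqn_pmul2l (ltn0Sn j)) -(mul_bin_diag j.*2.+2 j) /=; apply/eqP; lia.
have even j : ('C(j.*2, j) ^ 2 * j.*2.+1 <= 4 ^ j.*2)%N.
  elim: j => [//|j IH]; rewrite doubleS even_odd (expnS 4) (expnS 4).
  move: IH (odd_even j); set c := 'C(_, _); set e := 'C(_, _); set q := (4 ^ _)%N.
  rewrite -(leq_pmul2l (ltn0Sn j)) => IH oe.
  rewrite -(leq_pmul2l (ltn0Sn j)) -(leq_pmul2l (ltn0Sn j)).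
  have -> : (j.+1 * (j.+1 * ((2 * e) ^ 2 * j.*2.+3)) = (2 * (j.+1 * e)) ^ 2 * j.*2.+3)%N.
    by rewrite -!mulnn; ring.
  rewrite oe -!mulnn in IH *; nia.
rewrite -(odd_double_half n); move: n./2 => j.
case: odd => /=; rewrite ?add0n ?half_bit_double ?doubleK; last exact: even.
rewrite add1n /= uphalf_double (expnS 4).
move: (even j) (odd_even j); set c := 'C(_, _); set e := 'C(_, _); set q := (4 ^ _)%N.
rewrite -(leq_pmul2l (ltn0Sn j)) => ev oe.
rewrite -(leq_pmul2l (ltn0Sn j)) -(leq_pmul2l (ltn0Sn j)).
have -> : (j.+1 * (j.+1 * (e ^ 2 * j.*2.+2)) = (j.+1 * e) ^ 2 * j.*2.+2)%N.
  by rewrite -!mulnn; ring.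
rewrite oe -!mulnn in ev *; nia.
Qed.

Section SimpleWalkKernels.
Context (R : realType).
Implicit Types (x y z : int) (n : nat).

Definition srw n x : R := binmix (2^-1) (fun j l => (x == j%:Z - l%:Z)%:R) n.

Lemma srw0 x : srw 0 x = (x == 0)%:R.
Proof. by rewrite /srw binmix0 subrr. Qed.

Lemma srwS n x : srw n.+1 x = (srw n (x + 1) + srw n (x - 1)) / 2.
Proof.
rewrite /srw binmixS (_ : 1 - 2^-1 = 2^-1 :> R); last by field.
rewrite -mulrDr mulrC; congr (_ / _); rewrite addrC.
by congr (_ + _); apply: eq_binmix => k l; congr (_%:R); apply/eqP/eqP; lia.
Qed.

Lemma srw_ge0 n x : 0 <= srw n x.
Proof. by apply: binmix_ge0 => [||*]; rewrite ?ler0n//; lra. Qed.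

Lemma srw_sqr n x : srw n x ^+ 2 <= n.+1%:R^-1.
Proof.
suff srw_le : srw n x <= 'C(n, n./2)%:R / 2 ^+ n.
  apply: (@le_trans _ _ (('C(n, n./2)%:R / 2 ^+ n) ^+ 2)).
    by rewrite ler_pXn2r ?nnegrE ?srw_ge0 ?divr_ge0 ?ler0n ?exprn_ge0.
  rewrite expr_div_n -exprM mulnC exprM ler_pdivrMr ?exprn_gt0//.
  rewrite mulrC ler_pdivlMr ?ltr0n// -!natrX -natrM.
  by rewrite (_ : 2 ^ 2 = 4)%N// ler_nat central_bin_sqr.
have pow k : (k <= n)%N -> (2^-1) ^+ k * (1 - 2^-1) ^+ (n - k) = (2 ^+ n)^-1 :> R.
  move=> kn; rewrite (_ : 1 - 2^-1 = 2^-1 :> R); last by field.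
  by rewrite -exprD subnKC// exprVn.
rewrite /srw /binmix; have [[j xj]|nj] := pselect (exists j : 'I_n.+1, x = j%:Z - (n - j)%:Z).
  rewrite (bigD1 j)//= big1 ?addr0 => [|i ij].
    by rewrite xj eqxx mulr1 -mulrA pow -1?ltnS// ler_wpM2r ?invr_ge0 ?exprn_ge0// ler_nat bin_half_max.
  rewrite (_ : x == _ = false) ?mulr0//; apply/negbTE; apply: contra_neq ij => xi.
  by apply/val_inj => /=; have := ltn_ord i; have := ltn_ord j; lia.
rewrite big1 ?divr_ge0 ?ler0n ?exprn_ge0// => i _.
by rewrite (_ : x == _ = false) ?mulr0//; apply/negbTE/eqP => xi; apply: nj; exists i.
Qed.

Context (d : nat).
Hypothesis d3 : (3 <= d)%N.
Let D : R := d.+1%:R.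

Lemma dim_ge4 : 4 <= D. Proof. by rewrite /D ler_nat. Qed.

(** The laws of one, two and three lateral coordinates, adding one coordinate at
    a time: given the number of steps in the new coordinate, it is independent
    of the others. *)
Definition lat1 n z : R := binmix (D - 2)^-1 (fun k _ => srw k z) n.
Definition lat2 n y z : R := binmix (D - 1)^-1 (fun k l => srw k y * lat1 l z) n.
Definition lat3 n x y z : R := binmix D^-1 (fun k l => srw k x * lat2 l y z) n.

Lemma lat1S n z : lat1 n.+1 z =
  (D - 2)^-1 * ((lat1 n (z + 1) + lat1 n (z - 1)) / 2) + (1 - (D - 2)^-1) * lat1 n z.
Proof.
rewrite /lat1 binmixS; congr (_ * _ + _).
rewrite (@eq_binmix _ _ _ (fun k l => 2^-1 * srw k (z + 1) + 2^-1 * srw k (z - 1))).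
  by rewrite binmix_lin binmixZ; ring.
by move=> k l; rewrite srwS; ring.
Qed.

Lemma lat2S n y z : lat2 n.+1 y z =
  (D - 1)^-1 * ((lat2 n (y + 1) z + lat2 n (y - 1) z) / 2)
  + (D - 1)^-1 * ((lat2 n y (z + 1) + lat2 n y (z - 1)) / 2)
  + (1 - 2 / (D - 1)) * lat2 n y z.
Proof.
have D4 := dim_ge4.
rewrite /lat2 binmixS -addrA; congr (_ * _ + _).
  rewrite (@eq_binmix _ _ _ (fun k l => 2^-1 * (srw k (y + 1) * lat1 l z)
     + 2^-1 * (srw k (y - 1) * lat1 l z))) => [|k l].
    by rewrite binmix_lin binmixZ; ring.
  by rewrite srwS; ring.
rewrite (@eq_binmix _ _ _ (fun k l => ((D - 2)^-1 / 2) * (srw k y * lat1 l (z + 1))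
  + (((D - 2)^-1 / 2) * (srw k y * lat1 l (z - 1))
  + (1 - (D - 2)^-1) * (srw k y * lat1 l z)))) => [|k l].
  rewrite !binmix_lin binmixZ; field; lra.
by rewrite lat1S; ring.
Qed.

Lemma lat3S n x y z : lat3 n.+1 x y z =
  D^-1 * ((lat3 n (x + 1) y z + lat3 n (x - 1) y z) / 2)
  + D^-1 * ((lat3 n x (y + 1) z + lat3 n x (y - 1) z) / 2)
  + D^-1 * ((lat3 n x y (z + 1) + lat3 n x y (z - 1)) / 2)
  + (1 - 3 / D) * lat3 n x y z.
Proof.
have D4 := dim_ge4.
rewrite /lat3 binmixS -2!addrA; congr (_ * _ + _).
  rewrite (@eq_binmix _ _ _ (fun k l => 2^-1 * (srw k (x + 1) * lat2 l y z)
     + 2^-1 * (srw k (x - 1) * lat2 l y z))) => [|k l].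
    by rewrite binmix_lin binmixZ; ring.
  by rewrite srwS; ring.
rewrite (@eq_binmix _ _ _ (fun k l => ((D - 1)^-1 / 2) * (srw k x * lat2 l (y + 1) z)
  + (((D - 1)^-1 / 2) * (srw k x * lat2 l (y - 1) z)
  + (((D - 1)^-1 / 2) * (srw k x * lat2 l y (z + 1))
  + (((D - 1)^-1 / 2) * (srw k x * lat2 l y (z - 1))
  + (1 - 2 / (D - 1)) * (srw k x * lat2 l y z)))))) => [|k l].
  rewrite !binmix_lin binmixZ; field; lra.
by rewrite lat2S; ring.
Qed.

(** The constant of [binmix_inv3] at [D^-1] times that of [lat2_sqr]; it depends on the dimension
    only, hence neither on [m] nor on the bias. *)
Definition hkconst : R :=
  2 * (D^-1 * (1 - D^-1) ^+ 2)^-1 * (((D - 1)^-1 * (1 - (D - 1)^-1))^-1 * (D - 2)).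

Lemma lat1_sqr n z : lat1 n z ^+ 2 <= (D - 2) / n.+1%:R.
Proof.
have D4 := dim_ge4.
have p0 : 0 < (D - 2)^-1 by rewrite invr_gt0; lra.
have p1 : (D - 2)^-1 < 1 by rewrite invf_lt1; lra.
apply: le_trans (binmix_sqr (ltW p0) (ltW p1) _ _) _.
apply: le_trans (@le_binmix _ _ (ltW p0) (ltW p1) _ (fun k _ => k.+1%:R^-1) n _) _.
  by move=> k l; exact: srw_sqr.
by apply: le_trans (binmix_inv1 n p0 p1) _; rewrite invrK.
Qed.

Lemma lat2_sqr n y z : lat2 n y z ^+ 2 <=
  ((D - 1)^-1 * (1 - (D - 1)^-1))^-1 * (D - 2) / n.+1%:R ^+ 2.
Proof.
have D4 := dim_ge4.
have p0 : 0 < (D - 1)^-1 by rewrite invr_gt0; lra.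
have p1 : (D - 1)^-1 < 1 by rewrite invf_lt1; lra.
apply: le_trans (binmix_sqr (ltW p0) (ltW p1) _ _) _.
apply: le_trans (@le_binmix _ _ (ltW p0) (ltW p1) _
  (fun k l => (D - 2) * (k.+1%:R^-1 * l.+1%:R^-1)) n _) _.
  move=> k l; rewrite exprMn [leRHS]mulrCA; apply: ler_pM; rewrite ?sqr_ge0//.
    exact: srw_sqr.
  exact: lat1_sqr.
rewrite binmixZ [leRHS]mulrAC [leRHS]mulrC; apply: ler_wpM2l; first by lra.
exact: binmix_inv2.
Qed.

Lemma lat3_sqr n x y z : lat3 n x y z ^+ 2 <= hkconst / n.+1%:R ^+ 3.
Proof.
have D4 := dim_ge4.
have p0 : 0 < D^-1 by rewrite invr_gt0; lra.
have p1 : D^-1 < 1 by rewrite invf_lt1; lra.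
set c := ((D - 1)^-1 * (1 - (D - 1)^-1))^-1 * (D - 2).
have c0 : 0 <= c.
  rewrite mulr_ge0 ?invr_ge0 ?mulr_ge0 ?subr_ge0 ?invr_ge0 ?invf_le1; lra.
apply: le_trans (binmix_sqr (ltW p0) (ltW p1) _ _) _.
apply: le_trans (@le_binmix _ _ (ltW p0) (ltW p1) _
  (fun k l => c * (k.+1%:R^-1 * (l.+1%:R ^+ 2)^-1)) n _) _.
  move=> k l; rewrite exprMn [leRHS]mulrCA; apply: ler_pM; rewrite ?sqr_ge0//.
    exact: srw_sqr.
  exact: lat2_sqr.
rewrite binmixZ /hkconst -/c [leRHS]mulrAC [leRHS]mulrC; apply: ler_wpM2l => //.
exact: binmix_inv3.
Qed.

End SimpleWalkKernels.

Section LateralReturn.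
Context (R : realType) (d : nat).
Hypothesis d3 : (3 <= d)%N.
Variables (m : option nat) (beta : R).
Hypothesis beta01 : 0 <= beta <= 1.
Let i1 : 'I_d.+1 := inord 1.
Let i2 : 'I_d.+1 := inord 2.
Let i3 : 'I_d.+1 := inord 3.

Let i12 : (i1 == i2 = false) * (i1 == i3 = false) * (i2 == i1 = false) *
  (i2 == i3 = false) * (i3 == i1 = false) * (i3 == i2 = false) *
  (i1 == ord0 = false) * (i2 == ord0 = false) * (i3 == ord0 = false).
Proof. by do !split; apply/eqP => /(congr1 val) /=; rewrite !inordK //; lia. Qed.

(** The steps in direction [ord0] do not move the lateral coordinates, and their biases cancel in
    the sum: the lateral motion is Markov whatever the excitations. *)
Lemma mean_lateral (G : int -> int -> int -> R) h :
  \sum_s erw m beta h s *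
     G (unit_step s.1 s.2 0 i1) (unit_step s.1 s.2 0 i2) (unit_step s.1 s.2 0 i3) =
  d.+1%:R^-1 * ((G 1 0 0 + G (-1) 0 0) / 2)
  + d.+1%:R^-1 * ((G 0 1 0 + G 0 (-1) 0) / 2)
  + d.+1%:R^-1 * ((G 0 0 1 + G 0 0 (-1)) / 2)
  + (1 - 3 / d.+1%:R) * G 0 0 0.
Proof.
have dn0 : d.+1%:R != 0 :> R by rewrite pnatr_eq0.
rewrite sum_step; pose E i b := erw m beta h (i, b) *
  G (unit_step i b 0 i1) (unit_step i b 0 i2) (unit_step i b 0 i3).
pose F i := E i false + E i true.
rewrite (_ : \sum_i _ = \sum_i F i) //.
(* After this subtraction, only the directions [i1], [i2] and [i3] contribute to the sum. *)
have -> : \sum_i F i = G 0 0 0 + \sum_i (F i - d.+1%:R^-1 * G 0 0 0).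
  rewrite sumrB sumr_const card_ord -[X in _ - X]mulr_natl mulrA divff// mul1r.
  by rewrite addrCA subrr addr0.
have erw_lat i b : i != ord0 -> erw m beta h (i, b) = (2 * d.+1%:R)^-1.
  by move=> /negbTE i0; rewrite erwE /= i0 natrM div1r.
rewrite (bigD1 i1)//= (bigD1 i2)/= ?i12// (bigD1 i3)/= ?i12//.
rewrite big1 ?addr0 => [|i /andP[/andP[n1 n2] n3]].
  rewrite /F /E !unit_stepE /= !eqxx !i12 !erw_lat ?i12// expr0 expr1.
  by field.
rewrite /F /E !unit_stepE /= ![_ == i]eq_sym (negbTE n1) (negbTE n2) (negbTE n3).
rewrite -mulrDl -mulrBl; have [->|i0] := eqVneq i ord0; last first.
  by rewrite !erw_lat//; field.
by rewrite !erwE /= natrM expr0 expr1; field.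
Qed.

Lemma lateral_law n a b c h :
  kexp (erw m beta) n
    (fun u => [&& pos u 0 i1 == a, pos u 0 i2 == b & pos u 0 i3 == c]%:R) h =
  lat3 R d n (a - pos h 0 i1) (b - pos h 0 i2) (c - pos h 0 i3).
Proof.
elim: n h => [|n IH] h.
  rewrite /lat3 /lat2 /lat1 !binmix0 !srw0 kexp0 !subr_eq0 ![_ == pos h _ _]eq_sym.
  by rewrite -!natrM; do 3!case: (_ == _).
rewrite kexpS lat3S//.
have posE s i : pos (s :: h) 0 i = unit_step s.1 s.2 0 i + pos h 0 i.
  by rewrite pos_cons mxE.
under eq_bigr => s _ do rewrite IH !posE.
rewrite [LHS](mean_lateral (fun x y z => lat3 R d n (a - (x + pos h 0 i1))
  (b - (y + pos h 0 i2)) (c - (z + pos h 0 i3)))) !add0r.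
have shm e y : e - (1 + y) = e - y - 1 :> int by ring.
have shp e y : e - (-1 + y) = e - y + 1 :> int by ring.
by rewrite !shm !shp; ring.
Qed.

Definition hk : R := Num.sqrt (hkconst R d).

Lemma return_bound n (x : 'rV[int]_d.+1) h :
  kexp (erw m beta) n (fun u => (pos u == x)%:R) h <= hk / Num.sqrt n.+1%:R ^+ 3.
Proof.
apply: (@le_trans _ _ (lat3 R d n (x 0 i1 - pos h 0 i1) (x 0 i2 - pos h 0 i2) (x 0 i3 - pos h 0 i3))).
  rewrite -lateral_law; apply: le_kexp => [|u _]; first exact: erw_kernel.
  by have [->|_] := eqVneq (pos (u ++ h)) x; rewrite ?eqxx// ler0n.
apply: le_trans (ler_norm _) _; rewrite -sqrtr_sqr.
apply: le_trans (ler_wsqrtr (lat3_sqr R d3 n _ _ _)) _.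
have c0 : 0 <= hkconst R d.
  rewrite -[_ d]divr1 -(expr1n _ 3); apply: le_trans (lat3_sqr R d3 0 0 0 0); exact: sqr_ge0.
rewrite sqrtrM// sqrtrV ?exprn_ge0// /hk (_ : Num.sqrt (_ ^+ 3) = Num.sqrt n.+1%:R ^+ 3)//.
by rewrite !exprS !expr0 !mulr1 !sqrtrM.
Qed.

End LateralReturn.

(** * Excitation and drift *)

Section InverseSqrtSums.
Context (R : realType).

Lemma inv_sqrt3_le (j : nat) : (0 < j)%N ->
  (Num.sqrt j.+1%:R ^+ 3)^-1 <= 2 * ((Num.sqrt j%:R)^-1 - (Num.sqrt j.+1%:R)^-1) :> R.
Proof.
move=> j0; set x := Num.sqrt j%:R; set y := Num.sqrt j.+1%:R.
have x0 : 0 < x by rewrite sqrtr_gt0 ltr0n.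
have y0 : 0 < y by rewrite sqrtr_gt0 ltr0n.
have xy : y ^+ 2 = x ^+ 2 + 1 by rewrite !sqr_sqrtr ?ler0n// natr1.
have xley : x <= y by rewrite ler_wsqrtr// ler_nat.
have -> : x^-1 - y^-1 = (y * (x + y))^-1 / x.
  have h : (y - x) * (x + y) = 1 by rewrite -[RHS](addrK (x ^+ 2)) addrC [1 + _]addrC -xy; ring.
  rewrite -[X in X / x]mul1r -h; field; rewrite !gt_eqF//; lra.
rewrite mulrA ler_pdivlMr// ler_pdivrMl ?exprn_gt0// mulrA ler_pdivlMr; last first.
  by rewrite mulr_gt0// addr_gt0.
have : x * (x + y) <= 2 * y ^+ 2 by nra.
move=> /(ler_wpM2l (ltW y0)); lra.
Qed.

Lemma sum_inv_sqrt3 (a b : nat) : (0 < a)%N -> (a <= b)%N ->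
  \sum_(a <= j < b) (Num.sqrt j.+1%:R ^+ 3)^-1 <= 2 / Num.sqrt a%:R :> R.
Proof.
move=> a0 ab; apply: le_trans (_ : _ <= \sum_(a <= j < b)
  (2 * ((Num.sqrt j%:R)^-1 - (Num.sqrt j.+1%:R)^-1) : R)) _.
  by apply: ler_sum_nat => j /andP[aj _]; apply: inv_sqrt3_le; lia.
rewrite -mulr_sumr (eq_bigr (fun j : nat => - (Num.sqrt j.+1%:R)^-1 - - (Num.sqrt j%:R)^-1)); last first.
  by move=> j _; rewrite opprK addrC.
by rewrite telescope_sumr// opprK ler_pM2l// addrC gerBl invr_ge0 sqrtr_ge0.
Qed.

Lemma sum_inv_sqrt3_le3 (n : nat) :
  \sum_(0 <= j < n) (Num.sqrt j.+1%:R ^+ 3)^-1 <= 3 :> R.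
Proof.
case: n => [|n]; first by rewrite big_geq.
rewrite big_nat_recl// sqrtr1 expr1n invr1.
rewrite -(big_add1 _ _ 0 n.+1 xpredT (fun j => (Num.sqrt j.+1%:R ^+ 3)^-1)).
case: n => [|n]; first by rewrite big_geq//; lra.
have := @sum_inv_sqrt3 1 n.+2 isT isT; rewrite sqrtr1; lra.
Qed.

End InverseSqrtSums.

Section Excitation.
Context (R : realType) (d : nat).
Hypothesis d3 : (3 <= d)%N.
Variables (m : nat) (beta : R).
Hypothesis beta01 : 0 <= beta <= 1.
Implicit Types (h u : history d) (n : nat).
Local Notation k := (erw (d := d) (Some m) beta).
Local Notation unexc := (unexcited (d := d) (Some m)).
Let kK : is_kernel k := erw_kernel d (Some m) beta01.

Lemma hitsE (x : 'rV[int]_d.+1) h :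
  hits x h = (\sum_(0 <= i < (size h).+1) (pos (drop i h) == x))%N.
Proof.
elim: h => [|s h IH] /=; first by rewrite addn0 big_nat1.
by rewrite big_nat_recl//= IH.
Qed.

(** More than [m] visits include either one before the end of [h], counted by the second sum, or at
    least [m + 1] recent ones, where Markov's inequality applies. The end of [h] counts as
    recent. *)
Lemma unexc_le u h : ((unexc (u ++ h))%:R : R) <=
  m.+1%:R^-1 * \sum_(0 <= j < (size u).+1) (pos (drop j (u ++ h)) == pos (u ++ h))%:R
  + \sum_(0 <= i < size h) (pos (u ++ h) == pos (drop i.+1 h))%:R.
Proof.
rewrite -!natr_sum; set a := (\sum_(_ <= _ < (size u).+1) _)%N; set b := (\sum_(_ <= _ < size h) _)%N.
have -> : unexc (u ++ h) = (m < a + b)%N.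
  rewrite /unexcited /excited -ltnNge /nvis hitsE (@big_cat_nat _ _ _ (size u).+1)//=; last first.
    by rewrite ltnS size_cat leq_addr.
  suff -> : (\sum_((size u).+1 <= i < (size (u ++ h)).+1) (pos (drop i (u ++ h)) == pos (u ++ h)))%N
    = b by [].
  rewrite -{1}[(size u).+1]add0n big_addn size_cat.
  rewrite (_ : (size u + size h).+1 - (size u).+1 = size h)%N; last by lia.
  apply: eq_bigr => i _; rewrite eq_sym; congr (nat_of_bool (_ == pos _)).
  by rewrite addnS drop_cat ltnNge leqW ?leq_addl//= subSn ?leq_addl// addnK.
case: ltnP => //= [mab|_]; last by rewrite addr_ge0 ?mulr_ge0 ?invr_ge0 ?ler0n.
have [b0|b1] := posnP b; last first.
  rewrite -[leLHS]add0r lerD ?mulr_ge0 ?invr_ge0 ?ler0n//.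
  by rewrite ler1n.
rewrite b0 addr0 -ler_pdivrMl ?invr_gt0 ?ltr0n// invrK mulr1 ler_nat; lia.
Qed.

Lemma unexc_prob n h : kexp k n (fun u => (unexc u)%:R) h <=
  3 * hk R d / m.+1%:R + (size h)%:R * (hk R d / Num.sqrt n.+1%:R ^+ 3).
Proof.
have hk0 : 0 <= hk R d by rewrite sqrtr_ge0.
apply: (@le_trans _ _ (kexp k n (fun u =>
    m.+1%:R^-1 * \sum_(0 <= j < n.+1) (pos (drop j u) == pos u)%:R
    + \sum_(0 <= i < size h) (pos u == pos (drop i.+1 h))%:R) h)).
  by apply: le_kexp => // u su; have := unexc_le u h; rewrite su.
rewrite kexp_lin; apply: lerD; last first.
  rewrite kexp_sum -[size h in leRHS]subn0 mulr_natl -sumr_const_nat.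
  by apply: ler_sum => i _; apply: return_bound.
rewrite kexp_sum [leRHS]mulrC ler_wpM2l ?invr_ge0//.
apply: (@le_trans _ _ (\sum_(0 <= j < n.+1) hk R d / Num.sqrt j.+1%:R ^+ 3)).
  apply: ler_sum_nat => j /andP[_ jn].
  (* Conditioning on the history [j] steps before the end turns the coincidence of sites into a
     return after [j] steps. *)
  rewrite -{1}(@subnK j n)// kexpD.
  apply: kexp_le_cst => // u _.
  apply: le_trans (@return_bound R d d3 (Some m) beta beta01 j (pos (u ++ h)) (u ++ h)).
  apply: le_kexp => // w sw.
  by rewrite drop_size_cat// eq_sym.
by rewrite -mulr_sumr mulrC ler_wpM2r// sum_inv_sqrt3_le3.
Qed.

Lemma kexp_nunexc n h : kexp k n (fun u => (nunexc (Some m) u)%:R) h =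
  (nunexc (Some m) h)%:R + \sum_(0 <= i < n) kexp k i (fun u => (unexc u)%:R) h.
Proof.
elim: n => [|n IH]; first by rewrite big_geq// addr0.
rewrite big_nat_recr//= addrA -IH -kexp_add kexpSr; apply: eq_kexp => u _.
under eq_bigr => s _ do rewrite /= natrD.
by rewrite -mulr_suml kK.2 mul1r addrC.
Qed.

Lemma kexp_lev n h : kexp k n (fun u => (lev u)%:~R) h =
  (lev h)%:~R + beta / d.+1%:R * (n%:R - \sum_(0 <= i < n) kexp k i (fun u => (unexc u)%:R) h).
Proof.
elim: n => [|n IH]; first by rewrite big_geq// subr0 mulr0 addr0.
rewrite big_nat_recr//= -[n.+1%:R]natr1 kexpSr.
rewrite (@eq_kexp _ _ _ _ _ (fun u => (lev u)%:~R + beta / d.+1%:R * (1 - (unexc u)%:R))) => [|u su].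
  rewrite kexp_add kexpZ kexp_sub kexp_cst// IH; ring.
under eq_bigr => s _ do rewrite lev_cons intrD mulrDr.
rewrite big_split/= mean_dlev -mulr_suml kK.2 mul1r addrC; congr (_ + _ * _).
by case: unexc; rewrite /= ?subrr ?subr0.
Qed.

Variables (beta0 : R).
Hypotheses (beta0_gt0 : 0 < beta0) (beta0_le : beta0 <= beta).

(** The first [n ^ 6] steps are given up. Beyond them, at most [(n + 1) ^ 9 <= (2 n) ^ 9] old sites
    spoil at most [(2 n) ^ 9 * hk * 2 / n ^ 3 = 1024 hk n ^ 6] steps on average. By the choice of
    [A] both losses make up at most a quarter of the block, and [12 hk <= m + 1] limits the loss due
    to recent sites to another quarter: on average at least half of the steps are excited. *)
Lemma drift_block (A n : nat) h : (0 < n)%N -> 12 * hk R d <= m.+1%:R ->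
  4 * (1 + 1024 * hk R d) <= A%:R -> (size h <= n.+1 ^ 9)%N ->
  (lev h)%:~R + beta0 / (2 * d.+1%:R) * (A * n ^ 6)%:R <=
  kexp k (A * n ^ 6) (fun u => (lev u)%:~R) h.
Proof.
move=> n0 hm hA sh; rewrite kexp_lev lerD2l.
have hk0 : 0 <= hk R d by rewrite sqrtr_ge0.
set w := (A * n ^ 6)%N; set P := BIG_F.
have n60 : (0 < n ^ 6)%N by rewrite expn_gt0 n0.
have sqn : Num.sqrt (n ^ 6)%:R = n%:R ^+ 3 :> R.
  by rewrite natrX -[6%N]/(3 * 2)%N exprM sqrtr_sqr ger0_norm ?exprn_ge0.
have Psum : \sum_(0 <= i < w) P i <= w%:R / 2.
  have nw : (n ^ 6 <= w)%N.
    rewrite leq_pmull// -(ltr0n R); apply: lt_le_trans hA; lra.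
  apply: (@le_trans _ _ (\sum_(0 <= i < w) 3 * hk R d / m.+1%:R
    + (\sum_(0 <= i < n ^ 6) 1
      + \sum_(n ^ 6 <= i < w) (size h)%:R * (hk R d / Num.sqrt i.+1%:R ^+ 3)))).
    rewrite (@big_cat_nat _ _ _ (n ^ 6)%N 0%N w xpredT P)//= (@big_cat_nat _ _ _ (n ^ 6)%N 0%N w)//=.
    rewrite addrACA; apply: lerD.
      rewrite -big_split; apply: ler_sum => i _.
      by rewrite -[leLHS]add0r lerD ?divr_ge0 ?mulr_ge0 ?ler0n ?kexp_prob.
    by rewrite -big_split; apply: ler_sum => i _; exact: unexc_prob.
  have h1 : \sum_(0 <= i < w) 3 * hk R d / m.+1%:R <= w%:R / 4.
    rewrite sumr_const_nat subn0 -[leLHS]mulr_natl ler_wpM2l ?ler0n//.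
    by rewrite ler_pdivrMr ?ltr0n//; lra.
  have h2 : \sum_(n ^ 6 <= i < w) (size h)%:R * (hk R d / Num.sqrt i.+1%:R ^+ 3) <=
    1024 * hk R d * (n ^ 6)%:R.
    rewrite -mulr_sumr -mulr_sumr.
    apply: (@le_trans _ _ ((2 * n%:R) ^+ 9 * (hk R d * (2 / n%:R ^+ 3)))).
      apply: ler_pM; first exact: ler0n.
      - by rewrite mulr_ge0// sumr_ge0// => i _; rewrite invr_ge0 exprn_ge0 ?sqrtr_ge0.
      - apply: (@le_trans _ _ (n.+1 ^ 9)%:R); first by rewrite ler_nat.
        rewrite natrX ler_pXn2r ?nnegrE ?ler0n ?mulr_ge0// -natrM ler_nat; lia.
      by rewrite ler_wpM2l// -sqn sum_inv_sqrt3.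
    rewrite le_eqVlt; apply/orP; left; apply/eqP; rewrite natrX.
    have nn0 : n%:R != 0 :> R by rewrite pnatr_eq0; lia.
    by field.
  have h3 : \sum_(0 <= i < n ^ 6) 1 = (n ^ 6)%:R :> R by rewrite sumr_const_nat subn0.
  rewrite h3 /w natrM.
  have : 4 * (1 + 1024 * hk R d) * (n ^ 6)%:R <= A%:R * (n ^ 6)%:R by rewrite ler_wpM2r ?ler0n.
  move: h1 h2; rewrite /w natrM; lra.
have D0 : 0 < d.+1%:R :> R by rewrite ltr0n.
rewrite [leLHS](_ : _ = beta0 / d.+1%:R * (w%:R / 2)); last by field; rewrite gt_eqF.
apply: ler_pM.
- by rewrite divr_ge0// ltW.
- by rewrite divr_ge0.
- by rewrite ler_wpM2r// invr_ge0 ltW.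
- lra.
Qed.

End Excitation.

Lemma expRN_le (R : realType) (x : R) : -2^-1 <= x -> expR (- x) <= 1 - x + 2 * x ^+ 2.
Proof.
move=> x2; have x1 : 0 < 1 + x by lra.
rewrite expRN; apply: (@le_trans _ _ (1 + x)^-1).
  by rewrite lef_pV2 ?posrE ?expR_gt0// expR_ge1Dx.
by rewrite -[leLHS]mul1r ler_pdivrMr//; nra.
Qed.

Lemma expR_quadratic (R : realType) (r y : R) : 0 < r -> r <= 32^-1 -> -1 <= y -> y <= 1 ->
  expR (- (r * y)) <= 1 + 2 * r ^+ 2 - r * y.
Proof.
move=> r0 r1 y0 y1; apply: le_trans (expRN_le _) _; first by nra.
have : (r * y) ^+ 2 <= r ^+ 2.
  have : y ^+ 2 <= 1 by nra.
  by move=> /(ler_wpM2l (sqr_ge0 r)); rewrite exprMn mulr1.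
lra.
Qed.

Section ExponentialBound.
Context (R : realType) (d : nat).
Hypothesis d3 : (3 <= d)%N.
Variables (m : nat) (beta beta0 : R).
Hypothesis beta01 : 0 <= beta <= 1.
Hypotheses (beta0_gt0 : 0 < beta0) (beta0_le : beta0 <= beta).
Variable A : nat.
Hypothesis m_large : 12 * hk R d <= m.+1%:R.
Hypothesis A_large : 4 * (1 + 1024 * hk R d) <= A%:R.
Variable n : nat.
Hypothesis n_gt0 : (0 < n)%N.
Implicit Types (h u : history d).
Local Notation k := (erw (d := d) (Some m) beta).
Let kK : is_kernel k := erw_kernel d (Some m) beta01.

Definition drift_cst : R := beta0 / (2 * d.+1%:R).
(** For an increment normalized to [[-1, 1]] with mean at least [c], [expR_quadratic] bounds the
    exponential moment by [1 + 2 r ^ 2 - r c]. The choice [r = c / 4] minimizes this, and the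
    minimum is [exp_decay]. *)
Definition exp_rate : R := drift_cst / 4.
Definition exp_decay : R := 1 - drift_cst ^+ 2 / 8.
Local Notation w := (A * n ^ 6)%N.
Local Notation Phi := (fun u : history d => expR (- (exp_rate * (lev u)%:~R / w%:R))).

Lemma drift_cst_gt0 : 0 < drift_cst.
Proof. by rewrite divr_gt0// mulr_gt0// ltr0n. Qed.

Lemma drift_cst_le : drift_cst <= 8^-1.
Proof.
rewrite ler_pdivrMr ?mulr_gt0 ?ltr0n//.
have /andP[_ b1] := beta01; have : 4 <= d.+1%:R :> R by rewrite ler_nat.
move: (d.+1%:R : R) => D D4; move: (beta0_le); lra.
Qed.

Lemma exp_decay_itv : 0 < exp_decay < 1.
Proof.
have c0 := drift_cst_gt0; have c1 := drift_cst_le; rewrite /exp_decay.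
by apply/andP; split; nra.
Qed.

Lemma block_gt0 : (0 < w)%N.
Proof.
rewrite muln_gt0 expn_gt0 n_gt0 andbT -(ltr0n R); apply: lt_le_trans A_large.
have : 0 <= hk R d by rewrite sqrtr_ge0.
by lra.
Qed.

Lemma blockR_gt0 : 0 < w%:R :> R. Proof. by rewrite ltr0n block_gt0. Qed.

Lemma exp_rate_gt0 : 0 < exp_rate. Proof. by rewrite divr_gt0// drift_cst_gt0. Qed.

Lemma lev_diff u h : `|(lev (u ++ h))%:~R - (lev h)%:~R| <= (size u)%:R :> R.
Proof.
rewrite lev_cat intrD addrK -intr_norm.
by rewrite pmulrn ler_int lev_norm.
Qed.

Lemma exp_block h : (size h <= n.+1 ^ 9)%N ->
  kexp k w Phi h <= exp_decay * Phi h.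
Proof.
move=> sh; have c0 := drift_cst_gt0; have c1 := drift_cst_le.
pose X u : R := (lev u)%:~R - (lev h)%:~R.
rewrite (@eq_kexp _ _ _ _ _ (fun u => Phi h * expR (- (exp_rate * X u / w%:R)))) => [|u _]; last first.
  by rewrite -expRD; congr expR; rewrite /X; ring.
rewrite kexpZ mulrC ler_pM2r ?expR_gt0//.
apply: (@le_trans _ _ (kexp k w (fun u => (1 + 2 * exp_rate ^+ 2) + (- (exp_rate / w%:R)) * X u) h)).
  apply: le_kexp => // u su.
  have : `|X (u ++ h)| <= w%:R by rewrite -su; exact: lev_diff.
  rewrite ler_norml => /andP[X1 X2].
  have -> : exp_rate * X (u ++ h) / w%:R = exp_rate * (X (u ++ h) / w%:R) by rewrite mulrA.
  rewrite mulNr -[exp_rate / _ * _]mulrA [w%:R^-1 * _]mulrC.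
  move: (X _) X1 X2 => x X1 X2.
  have {}X1 : -1 <= x / w%:R.
    by move: blockR_gt0 X1; move: (w%:R : R) => W W0 X1; rewrite ler_pdivlMr//; lra.
  have {}X2 : x / w%:R <= 1.
    by move: blockR_gt0 X2; move: (w%:R : R) => W W0 X2; rewrite ler_pdivrMr//; lra.
  have r1 : exp_rate <= 32^-1 by rewrite /exp_rate; lra.
  move: (x / _) X1 X2 => y X1 X2.
  exact: expR_quadratic exp_rate_gt0 r1 X1 X2.
rewrite kexp_add kexp_cst// kexpZ kexp_sub kexp_cst//.
have db := drift_block d3 beta01 beta0_gt0 beta0_le n_gt0 m_large A_large sh.
have w0 := blockR_gt0; have -> : exp_decay = 1 + 2 * exp_rate ^+ 2 + - (exp_rate / w%:R) * (drift_cst * w%:R).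
  by move: (w%:R : R) w0 => W w0; rewrite /exp_decay /exp_rate; field; rewrite gt_eqF.
have r0 : 0 <= exp_rate / w%:R := divr_ge0 (ltW exp_rate_gt0) (ltW w0).
by rewrite lerD2l !mulNr lerN2 ler_wpM2l// lerBrDl.
Qed.

Lemma exp_blocks K h : (size h + K * w <= n.+1 ^ 9)%N ->
  kexp k (K * w) Phi h <= exp_decay ^+ K * Phi h.
Proof.
have /andP[r0 r1] := exp_decay_itv.
elim: K h => [|K IH] h sh; first by rewrite mul0n kexp0 expr0 mul1r.
rewrite mulSn kexpD; apply: (@le_trans _ _ (kexp k w (fun u => exp_decay ^+ K * Phi u) h)).
  by apply: le_kexp => // u su; apply: IH; rewrite size_cat su; move: sh; rewrite mulSn; lia.
rewrite kexpZ exprSr -mulrA ler_wpM2l ?exprn_ge0 ?(ltW r0)// exp_block//.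
by move: sh; lia.
Qed.

(** Exponential Markov inequality. The [l %% w] steps that do not fill a block are taken first; they
    change the level by less than [w], which costs at most the factor [expR exp_rate]. *)
Lemma no_advance l (y : R) h : (size h + l <= n.+1 ^ 9)%N ->
  kexp k l (fun u => ((lev u)%:~R <= (lev h)%:~R + y :> R)%:R) h <=
  expR (exp_rate * (1 + y / w%:R)) * exp_decay ^+ (l %/ w).
Proof.
move=> sh; have /andP[r0 r1] := exp_decay_itv.
apply: (@le_trans _ _ (kexp k l (fun u => expR (exp_rate * ((lev h)%:~R + y) / w%:R) * Phi u) h)).
  apply: le_kexp => // u _; rewrite -expRD.
  have [lu|_] := boolP ((lev (u ++ h))%:~R <= _); last exact/ltW/expR_gt0.
  rewrite -[leLHS]expR0 ler_expR -mulrBl -mulrBr divr_ge0 ?ler0n// mulr_ge0 ?(ltW exp_rate_gt0)//.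
  by rewrite subr_ge0.
rewrite kexpZ {1}(divn_eq l w) addnC kexpD.
have lb : (size h + l %% w + l %/ w * w <= n.+1 ^ 9)%N by move: sh; rewrite {1}(divn_eq l w); lia.
apply: (@le_trans _ _ (expR (exp_rate * ((lev h)%:~R + y) / w%:R) *
    (kexp k (l %% w) (fun=> exp_decay ^+ (l %/ w) * (expR exp_rate * Phi h)) h))).
  rewrite ler_wpM2l ?(ltW (expR_gt0 _))//; apply: le_kexp => // u su.
  apply: le_trans (exp_blocks _) _; first by rewrite size_cat su; lia.
  rewrite ler_wpM2l ?exprn_ge0 ?(ltW r0)// -expRD ler_expR.
  have := lev_diff u h; rewrite ler_norml => /andP[lu _].
  have : (size u)%:R <= w%:R :> R by rewrite su ler_nat ltnW// ltn_pmod// block_gt0.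
  have w0 := blockR_gt0; have rate0 := exp_rate_gt0.
  move=> sw; rewrite -lerBlDr opprK -mulNr -mulrDl.
  rewrite ler_pdivrMr// -mulrN -mulrDr ler_pM2l//; lra.
rewrite kexp_cst// mulrCA -mulrA mulrC ler_wpM2r ?exprn_ge0 ?(ltW r0)//.
rewrite -!expRD ler_expR le_eqVlt; apply/orP; left; apply/eqP; ring.
Qed.

End ExponentialBound.

(** * Renewal times and their tail *)

Section HasSuffix.
Context (S : Type).
Implicit Types (A : pred (seq S)) (h u : seq S).

Definition hassuf A h := ~~ allsuf (predC A) h.

Lemma hassufP A h :
  reflect (exists2 i, (i <= size h)%N & A (drop i h)) (hassuf A h).
Proof.
apply: (iffP negP) => [H|[i ih Ai] /allsufP /(_ i ih)]; last by rewrite /= Ai.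
have [//|N] := pselect (exists2 i, (i <= size h)%N & A (drop i h)).
by case: H; apply/allsufP => i ih; apply/negP => Ai; apply: N; exists i.
Qed.

Lemma hassuf_cat A u h : hassuf A h -> hassuf A (u ++ h).
Proof.
move=> /hassufP[i ih Ai]; apply/hassufP; exists (size u + i)%N.
  by rewrite size_cat leq_add2l.
by rewrite addnC -drop_drop drop_size_cat.
Qed.

End HasSuffix.

Section FirstPassage.
Context (R : realType) (S : finType) (k : seq S -> S -> R).
Hypothesis kK : is_kernel k.

(** Markov property at the first history in [A]: from there on the price is at most [c] on [E] and
    [0] elsewhere, and nothing is paid if [A] never occurs. Later occurrences of [predI A E] only
    enlarge the right side. *)
Lemma first_passage (A E : pred (seq S)) (f : seq S -> R) (c : R) :
  0 <= c ->
  (forall a i, A a -> kexp k i f a <= c * (E a)%:R) ->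
  (forall h, ~~ hassuf A h -> f h <= 0) ->
  forall n h, allpast (predC A) h ->
  kexp k n f h <= c * kexp k n (fun u => (hassuf (predI A E) u)%:R) h.
Proof.
move=> c0 fA f0; elim=> [|n IH] h past.
  have [Ah|nAh] := boolP (A h); last first.
    rewrite !kexp0; apply: le_trans (f0 _ _) _; last by rewrite mulr_ge0.
    by rewrite negbK allsufE past andbT /= nAh.
  apply: le_trans (fA h 0%N Ah) _; rewrite kexp0 ler_wpM2l// ler_nat.
  case Eh : (E h) => //; rewrite lt0b; apply/hassufP; exists 0%N => //.
  by rewrite drop0 /= Ah.
have [Ah|nAh] := boolP (A h); last first.
  rewrite !kexpS mulr_sumr; apply: ler_sum => s _; rewrite mulrCA.
  by apply: ler_wpM2l; [exact: kK.1|apply: IH; rewrite /= allsufE /= nAh].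
apply: le_trans (fA h n.+1 Ah) _; rewrite ler_wpM2l//.
apply: kexp_ge_cst => // u _; rewrite ler_nat.
case Eh : (E h) => //; rewrite hassuf_cat//.
by apply/hassufP; exists 0%N => //; rewrite drop0 /= Ah.
Qed.

End FirstPassage.

Section Dips.
Context (R : realType) (d : nat).
Implicit Types (h u a : history d) (r : int).

Lemma lev_step_le h i : lev (drop i h) <= lev (drop i.+1 h) + 1.
Proof.
case: (ltnP i (size h)) => ih; last by rewrite !drop_oversize ?lev_nil; lia.
case: h ih => // s h ih.
rewrite (drop_nth s ih) lev_cons.
have := dlev_norm (nth s (s :: h) i); rewrite ler_norml => /andP[_ H].
by rewrite addrC lerD2l.
Qed.

(** A step changes the level by at most one, so the first passage above [r] takes place at [r]
    exactly. As [drop] counts back in time, the earliest moment is the largest index. *)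
Lemma first_hit r h : 0 < r -> hassuf (fun e => r <= lev e) h ->
  exists i, [/\ (i < size h)%N, newmax (drop i h) & lev (drop i h) = r].
Proof.
move=> r0 /hassufP[i0 i0h ri0].
have ex : exists i, (i <= size h)%N && (r <= lev (drop i h)) by exists i0; rewrite i0h.
have bd i : (i <= size h)%N && (r <= lev (drop i h)) -> (i <= size h)%N by case/andP.
have [i /andP[ih ri] imax] := ex_maxnP ex bd.
have ilt : (i < size h)%N.
  rewrite ltn_neqAle ih andbT; apply: contraTneq ri => ->.
  by rewrite drop_size lev_nil -ltNge.
have after j : (i < j <= size h)%N -> lev (drop j h) < r.
  move=> /andP[ij jh]; rewrite ltNge; apply/negP => rj.
  by have := imax j; rewrite jh rj => /(_ isT); rewrite leqNgt ij.
have levi : lev (drop i h) = r.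
  by have := lev_step_le h i; have := after i.+1; rewrite leqnn ilt => /(_ isT); lia.
exists i; split=> //; apply/allpastP => j /andP[j0]; rewrite size_drop => jh.
by rewrite drop_drop levi; apply: after; lia.
Qed.

(** The walk goes below level [r] after having reached it and before reaching
    level [r']. *)
Definition dip r r' h := hassuf (fun t =>
  [&& lev t < r, hassuf (fun e => r <= lev e) t & allsuf (fun e => lev e < r') t]) h.

Variable l : nat.
Hypothesis l_gt0 : (0 < l)%N.
Local Notation lvl := (fun j : nat => (j * l)%:Z).

Fixpoint alldips J h := if J is J'.+1 then alldips J' h && dip (lvl J) (lvl J.+1) h else true.

Lemma dip_cat r r' u h : dip r r' h -> dip r r' (u ++ h).
Proof. exact: hassuf_cat. Qed.

Lemma alldips_cat J u h : alldips J h -> alldips J (u ++ h).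
Proof. by elim: J => //= J IH /andP[/IH -> /(@dip_cat _ _ u) ->]. Qed.

(** A dip below one level has to occur before the next level is reached. Hence all dips up to [J]
    are decided by the time the walk is at [lvl J.+1], which makes them independent of the restart
    there. *)
Lemma alldips_before J u a : newmax a -> (lvl J.+1) <= lev a ->
  alldips J (u ++ a) -> alldips J a.
Proof.
move=> na; elim: J => //= J IH la /andP[dJ]; rewrite IH//; last by move: la; nia.
move=> /hassufP[i ih /and3P[lt hs al]] /=.
have [iu|ui] := leqP i (size u); last first.
  apply/hassufP; exists (i - size u)%N; first by move: ih; rewrite size_cat; lia.
  by move: lt hs al; rewrite drop_cat ltnNge (ltnW ui)/= => -> -> ->.
have /allsufP/(_ (size u - i)%N) := al; rewrite size_drop size_cat drop_drop subnK// drop_size_cat//.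
by move=> /(_ _)/wrap[]; [lia|move: la; lia].
Qed.

(** The level [r] is reached for the first time at the end of [a], so a dip below [r] can only
    happen later, that is, within [u]. *)
Lemma dip_not_stay r r' u a : newmax a -> lev a = r -> dip r r' (u ++ a) -> ~~ stay u.
Proof.
move=> /allpastP na la /hassufP[i ih /and3P[lt /hassufP[j jh rj] _]].
have [iu|ui] := leqP i (size u).
  apply/negP => /allsufP /(_ i iu); move: lt.
  rewrite drop_cat; case: ltnP => ui; first by rewrite lev_cat la; lia.
  by rewrite (_ : i = size u) ?subnn ?drop0 ?la ?ltxx//; lia.
have := na (i - size u + j)%N; move: rj jh; rewrite size_drop drop_drop drop_cat.
rewrite ltnNge (leq_trans (ltnW ui) (leq_addl _ _))/= => rj jh.
have -> : (i - size u + j = j + i - size u)%N by lia.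
have jb : (0 < j + i - size u <= size a)%N by move: ih jh; rewrite size_cat; lia.
by move=> /(_ jb); rewrite la ltNge rj.
Qed.

Section Probability.
Variables (m : option nat) (beta q : R).
Hypothesis beta01 : 0 <= beta <= 1.
Local Notation k := (erw (d := d) m beta).
Let kK : is_kernel k := erw_kernel d m beta01.
Hypothesis q_ge0 : 0 <= q.
Hypothesis stay_q : forall n, q <= kexp k n (fun u => (stay u)%:R) [::].

Lemma q_le1 : q <= 1.
Proof. exact: le_trans (stay_q 0) (kexp_prob kK 0 _ _). Qed.

Lemma kexp_stay_fresh n a : newmax a ->
  kexp k n (fun h => (stay (take (size h - size a) h))%:R) a =
  kexp k n (fun u => (stay u)%:R) [::].
Proof.
move=> na; apply: kexp_fresh => // [u _|u /negbTE ->//].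
by rewrite size_cat addnK take_size_cat.
Qed.

(** At the first passage at [lvl J.+1] the previous dips are decided and the walk restarts in a
    fresh environment, where a further dip has probability at most [1 - q]. *)
Lemma alldips_prob J n : kexp k n (fun h => (alldips J h)%:R) [::] <= (1 - q) ^+ J.
Proof.
have q1 := q_le1.
elim: J n => [|J IH] n; first by rewrite kexp_cst.
pose A h := newmax h && (lev h == lvl J.+1).
apply: (@le_trans _ _ ((1 - q) * kexp k n (fun u => (hassuf (predI A (alldips J)) u)%:R) [::])).
  apply: first_passage => // [|a i /andP[na /eqP la]|h nA].
  - by rewrite subr_ge0.
  - apply: (@le_trans _ _ (kexp k i (fun h => (alldips J a)%:R *
        (1 - (stay (take (size h - size a) h))%:R)) a)).
      apply: le_kexp => // u _; rewrite size_cat addnK take_size_cat//.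
      have [/= /andP[aJ dJ]|_] := boolP (alldips J.+1 (u ++ a)); last first.
        by rewrite mulr_ge0// subr_ge0; case: stay.
      rewrite (alldips_before na _ aJ); last by rewrite la.
      by rewrite (negbTE (dip_not_stay na la dJ)) subr0 mulr1.
    rewrite kexpZ mulrC kexp_sub kexp_cst// kexp_stay_fresh//.
    by rewrite ler_wpM2r ?ler0n// lerB.
  - have [/= /andP[_ /hassufP[i ih /and3P[_ hs _]]]|//] := boolP (alldips J.+1 h).
    have hs' : hassuf (fun e => lvl J.+1 <= lev e) h.
      by rewrite -(cat_take_drop i h); apply: hassuf_cat.
    have [|j [jh nj lj]] := first_hit _ hs'; first by rewrite ltz_nat muln_gt0.
    case/negP: nA; apply/hassufP; exists j; first exact: ltnW.
    by rewrite /A nj lj eqxx.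
rewrite exprS ler_wpM2l ?subr_ge0//; apply: le_trans (IH n).
apply: le_kexp => // u _; rewrite ler_nat.
case: hassufP => // -[i ih /andP[_ aJ]].
by rewrite -(cat_take_drop i (u ++ _)) alldips_cat.
Qed.

End Probability.

(** [i] counts back from the end of [h]: time [size h - i] reaches a new record
    level, below which the walk does not return. *)
Definition renewal i h := newmax (drop i h) && stay (take i h).
(** The current time and time [0], of indices [0] and [size h], are left out: a block is delimited
    by renewals there. *)
Definition norenewal h := all (fun i => ~~ renewal i h) (iota 1 (size h).-1).

Lemma norenewalP h : reflect (forall i, (0 < i < size h)%N -> ~~ renewal i h) (norenewal h).
Proof.
apply: (iffP allP) => H i ih; apply: H; move: ih; rewrite mem_iota; case: (size h) => //=; lia.
Qed.

Definition backtrack h := has (fun j => has (fun i =>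
   lev (drop i h) <= lev (drop j h) - l%:Z) (iota 0 j.+1)) (iota 0 (size h).+1).

Lemma lev_drop_take h i j : (j <= i <= size h)%N ->
  lev (drop j h) = lev (drop j (take i h)) + lev (drop i h).
Proof.
move=> /andP[ji ih]; rewrite -lev_cat -{1}(cat_take_drop i h) drop_cat.
rewrite size_takel//; case: ltnP => // ij.
by rewrite (_ : j = i) ?subnn ?drop0 ?[drop i (take _ _)]drop_oversize ?size_takel//; lia.
Qed.

(** The first passage at [lvl j] is not a renewal, so the walk later goes below that level. Had it
    reached [lvl j.+1] in between, it would have descended by more than [l], which is a backtrack;
    hence it makes a dip at every level up to [J]. *)
Lemma norenewal_cases J h : norenewal h ->
  [|| lev h < lvl J.+1, backtrack h | alldips J h].
Proof.
move=> nc; have [//|lh] := ltP (lev h) _ => /=.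
have [//|nb] := boolP (backtrack h) => /=.
have {}nb i j : (i <= j <= size h)%N -> lev (drop j h) - l%:Z < lev (drop i h).
  move=> /andP[ij jh]; rewrite ltNge; apply: contra nb => b; apply/hasP.
  exists j; first by rewrite mem_iota.
  by apply/hasP; exists i => //; rewrite mem_iota.
have dips j : (0 < j)%N -> (lvl j.+1 <= lev h) -> dip (lvl j) (lvl j.+1) h.
  move=> j0 lj; case: (boolP (dip (lvl j) (lvl j.+1) h)) => // /negP nd; exfalso.
  have [||i [ih ni li]] := @first_hit (lvl j) h.
  - by rewrite ltz_nat muln_gt0 j0.
  - by apply/hassufP; exists 0%N => //; rewrite drop0; move: lj; nia.
  have i0 : (0 < i)%N by case: (posnP i) li => // ->; rewrite drop0; move: lj; nia.
  have := norenewalP _ nc i; rewrite i0 ih => /(_ isT) /negP; apply.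
  rewrite /renewal ni /=; apply/allsufP => t; rewrite size_takel ?(ltnW ih)// => ti.
  have := @lev_drop_take h i t; rewrite ti (ltnW ih) => /(_ isT); rewrite li => lt.
  rewrite leNgt; apply/negP => neg.
  apply: nd; apply/hassufP; exists t; first by lia.
  apply/and3P; split; first by rewrite lt gtrDr.
    apply/hassufP; exists (i - t)%N; first by rewrite size_drop; lia.
    by rewrite drop_drop subnK// li.
  apply/allsufP => e; rewrite size_drop drop_drop => et.
  have etb : (t <= e + t <= size h)%N by lia.
  have := nb _ _ etb; rewrite ltrBlDr => /lt_trans; apply.
  by rewrite lt mulSn PoszD [X in _ < X]addrC ltrD2r gtrDr.
elim: J lh => //= J IH lh; rewrite IH ?dips//; move: lh; nia.
Qed.

End Dips.

Section GeometricDecay.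
Context (R : realType).
Implicit Types (rho C : R).

Lemma geo_lin rho n : 0 < rho < 1 -> rho ^+ n * n.+1%:R <= (1 - rho)^-1.
Proof.
move=> /andP[r0 r1]; rewrite -[leRHS]mul1r ler_pdivlMr ?subr_gt0//.
suff : rho ^+ n * n.+1%:R * (1 - rho) <= 1 - rho ^+ n.+1.
  by move=> /le_trans; apply; rewrite gerBl exprn_ge0// ltW.
elim: n => [|n IH]; first by rewrite expr0 expr1 !mul1r.
have rn : 0 <= rho ^+ n by rewrite exprn_ge0// ltW.
have rn1 : rho ^+ n <= 1 by rewrite exprn_ile1// ltW.
have := ler_wpM2l (ltW r0) IH; rewrite -[n.+2%:R]natr1 !exprS.
move: (rho ^+ n) (n.+1%:R) rn rn1 => b x b0 b1 {}IH.
have : 0 <= (1 - rho) * (1 - rho * b) by rewrite mulr_ge0 ?subr_ge0 ?mulr_ile1// ltW.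
by nra.
Qed.

(** Half of the decay, [sqrt rho ^ n], pays for one factor [n + 1], and the other half is left to
    the induction. *)
Lemma geo_poly (N : nat) rho : 0 < rho < 1 ->
  exists2 C : R, 0 < C & forall n, rho ^+ n * n.+1%:R ^+ N <= C.
Proof.
elim: N rho => [|N IH] rho /andP[r0 r1].
  by exists 1 => // n; rewrite expr0 mulr1 exprn_ile1// ltW.
have s0 : 0 < Num.sqrt rho by rewrite sqrtr_gt0.
have s1 : Num.sqrt rho < 1 by rewrite -[ltRHS]sqrtr1 ltr_sqrt.
have [|C C0 HC] := IH (Num.sqrt rho); first by rewrite s0.
exists (C * (1 - Num.sqrt rho)^-1) => [|n].
  by rewrite mulr_gt0// invr_gt0 subr_gt0.
rewrite -{1}(sqr_sqrtr (ltW r0)) -exprM mulnC exprM expr2 exprSr mulrACA.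
apply: ler_pM => //.
by apply: geo_lin; rewrite s0.
Qed.

Lemma geo_poly_div (N A : nat) rho : 0 < rho < 1 -> (0 < A)%N ->
  exists2 C : R, 0 < C & forall n, rho ^+ (n %/ A) <= C / n.+1%:R ^+ N.
Proof.
move=> r01 A0; have [C C0 HC] := geo_poly N r01.
exists (C * A%:R ^+ N) => [|n]; first by rewrite mulr_gt0// exprn_gt0// ltr0n.
rewrite ler_pdivlMr ?exprn_gt0 ?ltr0n//.
apply: (@le_trans _ _ (rho ^+ (n %/ A) * (n %/ A).+1%:R ^+ N * A%:R ^+ N)).
  rewrite -mulrA ler_wpM2l ?exprn_ge0//; first by case/andP: r01 => /ltW.
  rewrite -exprMn -natrM lerXn2r ?nnegrE ?ler0n// ler_nat.
  rewrite {1}(divn_eq n A) mulSn; have := ltn_pmod n A0; lia.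
by rewrite ler_wpM2r ?exprn_ge0.
Qed.

(** Up to time [t ~ n ^ 9], the drift is felt over [A * n ^ 6] steps, and renewals
    are looked for at [n] levels spaced by [n ^ 7]. *)
Lemma ninth_root (t : nat) : (0 < t)%N ->
  exists2 n, (0 < n)%N & (n ^ 9 <= t < n.+1 ^ 9)%N.
Proof.
move=> t0; have ex : exists n, (n ^ 9 <= t)%N by exists 0%N.
have bd n : (n ^ 9 <= t)%N -> (n <= t)%N.
  by move=> /(leq_trans _) -> //; case: n => // n; rewrite -{1}[n.+1]expn1 leq_pexp2l.
have [n nt nmax] := ex_maxnP ex bd.
exists n; first by apply: nmax; rewrite exp1n.
by rewrite nt ltnNge; apply/negP => /nmax; rewrite ltnn.
Qed.

Lemma sum_inv_sqr (a b : nat) : (0 < a)%N -> (a <= b)%N ->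
  \sum_(a <= j < b) (j.+1%:R ^+ 2)^-1 <= a%:R^-1 :> R.
Proof.
move=> a0 ab; apply: (@le_trans _ _ (\sum_(a <= j < b) (- j.+1%:R^-1 - - (j%:R : R)^-1))).
  apply: ler_sum_nat => j /andP[aj _].
  have j0 : 0 < j%:R :> R by rewrite ltr0n; lia.
  rewrite opprK addrC -natr1; move: (j%:R : R) j0 => x x0.
  rewrite (_ : x^-1 - _ = (x * (x + 1))^-1); last by field; lra.
  by rewrite lef_pV2 ?posrE ?exprn_gt0 ?mulr_gt0//; nra.
by rewrite telescope_sumr// opprK addrC gerBl invr_ge0 ler0n.
Qed.

Lemma has_le_sum (T : Type) (A : pred T) (s : seq T) :
  (has A s)%:R <= \sum_(x <- s) (A x)%:R :> R.
Proof.
elim: s => [|x s IH] /=; first by rewrite big_nil.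
rewrite big_cons; case: (A x) => /=; last by rewrite add0r.
by rewrite lerDl sumr_ge0.
Qed.

End GeometricDecay.

(** * Estimates uniform in the number of excitations and in the bias *)

Section UniformTails.
Context (R : realType) (d : nat).
Hypothesis d3 : (3 <= d)%N.
Variable beta0 : R.
Hypotheses (beta0_gt0 : 0 < beta0) (beta0_le1 : beta0 <= 1).
Implicit Types (h u : history d).

Definition admissible (m : nat) (beta : R) :=
  [/\ 12 * hk R d <= m.+1%:R, beta0 <= beta & beta <= 1].

Lemma admissible01 m beta : admissible m beta -> 0 <= beta <= 1.
Proof. by case=> _ b0 ->; rewrite (le_trans (ltW beta0_gt0)). Qed.

Local Notation rho := (exp_decay d beta0).
Local Notation theta := (exp_rate d beta0).

Let rho01 : 0 < rho < 1.
Proof. by apply: (exp_decay_itv d3 (beta := 1)) => //; rewrite ler01 lexx. Qed.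

Lemma block_scale : exists2 A, (0 < A)%N & 4 * (1 + 1024 * hk R d) <= A%:R.
Proof.
exists (Num.bound (4 * (1 + 1024 * hk R d))).+1 => //.
have hk0 : 0 <= hk R d by rewrite sqrtr_ge0.
apply: ltW; apply: lt_le_trans (archi_boundP _) _; first by lra.
by rewrite ler_nat.
Qed.

Lemma return_tail : exists2 C : R, 0 < C & forall m beta h l,
  admissible m beta -> (size h <= l)%N ->
  kexp (erw (Some m) beta) l (fun u => (lev u <= lev h)%R%:R) h <= C / l.+1%:R ^+ 2.
Proof.
have [A A0 A_large] := block_scale.
(* The scale [n] will be that of [2 * l.+1], which bounds the age of the history plus the [l.+1] new
   steps. These fill at least [n %/ (2 * A)] blocks, and [(n + 1) ^ 18] dominates the square of
   [l + 2]. *)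
have [|C C0 HC] := @geo_poly_div R 18 (2 * A) rho rho01; first by lia.
exists (1 + expR theta * C) => [|m beta h [|l] adm hl].
- by rewrite addr_gt0// mulr_gt0// expR_gt0.
- rewrite expr1n divr1 kexp0 lexx.
  by rewrite lerDl ltW// mulr_gt0// expR_gt0.
have [m_large b0 b1] := adm.
have [|n n0 /andP[n1 n2]] := @ninth_root (2 * l.+1); first by [].
have := @no_advance R d d3 m beta beta0 (admissible01 adm) beta0_gt0 b0 A m_large A_large n n0 l.+1 0 h.
move=> /(_ _)/le_trans; rewrite (_ : kexp _ _ (fun u => (_ <= _ :> R)%:R) _ =
  kexp (erw (Some m) beta) l.+1 (fun u => (lev u <= lev h)%R%:R) h); last first.
  by apply: eq_kexp => u _; rewrite addr0 ler_int.
apply; first by lia.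
rewrite mul0r addr0 mulr1 [leRHS]mulrDl -[leLHS]add0r lerD ?divr_ge0 ?exprn_ge0//.
rewrite -mulrA ler_pM2l ?expR_gt0//.
apply: (@le_trans _ _ (rho ^+ (n %/ (2 * A)))).
  case/andP: rho01 => r0 r1; rewrite ler_wiXn2l ?(ltW r0) ?(ltW r1)//.
  rewrite leq_divRL; last by rewrite muln_gt0 A0 expn_gt0 n0.
  have := leq_divM n (2 * A); set e := (n %/ _)%N => en.
  have e6 : (e * (2 * A) * n ^ 6 <= n * n ^ 6)%N by rewrite leq_mul2r en orbT.
  have n69 : (n * n ^ 6 <= n ^ 9)%N by rewrite -expnS leq_pexp2l.
  have := leq_trans e6 (leq_trans n69 n1).
  rewrite (_ : e * (2 * A) * n ^ 6 = 2 * (e * (A * n ^ 6)))%N; last by ring.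
  by rewrite leq_pmul2l.
apply: le_trans (HC n) _; rewrite ler_pM2l// lef_pV2 ?posrE ?exprn_gt0 ?ltr0n//.
rewrite -!natrX ler_nat -[18%N]/(9 * 2)%N expnM leq_exp2r//; lia.
Qed.

Lemma kexp_straight (k : seq (step d) -> step d -> R) (c : R) (s : step d) K f h :
  0 <= c -> is_kernel k -> (forall u, c <= k u s) -> (forall u, 0 <= f u) ->
  c ^+ K * f (nseq K s ++ h) <= kexp k K f h.
Proof.
move=> c0 kK cs f0; elim: K h => [|K IH] h; first by rewrite expr0 mul1r kexp0.
rewrite kexpS (bigD1 s)//= -[leLHS]addr0 lerD//; last first.
  apply: sumr_ge0 => i _; apply: mulr_ge0; first exact: kK.1.
  by apply: kexp_ge0.
rewrite exprS -mulrA; apply: ler_pM => //; first by rewrite mulr_ge0// exprn_ge0.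
apply: le_trans (IH (s :: h)); rewrite le_eqVlt; apply/orP; left; apply/eqP.
congr (_ * f _); rewrite -cat_cons; elim: K {IH} => //= K ->.
by [].
Qed.

Lemma lev_nseq K : lev (nseq K (ord0, false) : history d) = K%:Z.
Proof.
elim: K => [|K IH]; first by rewrite lev_nil.
by rewrite /= lev_cons IH /dlev eqxx expr0; lia.
Qed.

Lemma stay_nseq K : stay (nseq K (ord0, false) : history d).
Proof. by elim: K => [|K IH] /=; rewrite /stay /= ?lev_nil// -/(stay _) IH andbT (lev_nseq K.+1). Qed.

(** The first [K] steps are [+e_1] with probability at least [c ^ K]. From level [K], the walk
    cannot be negative within [K] steps; at a time [l >= K] the initial history is no longer than
    [l], so [return_tail] applies, and its bounds sum to at most [C / K <= 1 / 2]. *)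
Lemma stay_prob : exists q : R, [/\ 0 < q, q <= 1 & forall m beta n,
  admissible m beta -> q <= kexp (erw (Some m) beta) n (fun u => (stay u)%:R) ([::] : history d)].
Proof.
have [C C0 HC] := return_tail.
have [K K0 KC] : exists2 K, (0 < K)%N & 2 * C <= K%:R.
  exists (Num.bound (2 * C)).+1 => //.
  apply: ltW; apply: lt_le_trans (archi_boundP _) _; first by lra.
  by rewrite ler_nat.
pose c : R := (2 * d.+1%:R)^-1.
have c0 : 0 < c by rewrite invr_gt0 mulr_gt0// ltr0n.
have c1 : c <= 1.
  by rewrite invf_le1 ?mulr_gt0 ?ltr0n// -natrM ler1n.
exists (c ^+ K / 2); split.
- by rewrite divr_gt0// exprn_gt0.
- have : c ^+ K <= 1 by rewrite exprn_ile1// ltW.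
  lra.
move=> m beta n adm; have b01 := admissible01 adm.
have kK := erw_kernel d (Some m) b01.
(* Staying over a longer horizon is a smaller event, so the [K] initial steps may be added to the
   other [n]. *)
apply: (@le_trans _ _ (kexp (erw (Some m) beta) (n + K) (fun u => (stay u)%:R) [::])); last first.
  rewrite -(kexp_ancestor kK n K); apply: le_kexp => // u _.
  rewrite ler_nat; case su : (stay _) => //.
  by rewrite /stay allsuf_drop.
pose s0 : step d := (ord0, false).
rewrite addnC kexpD.
apply: le_trans (@kexp_straight (erw (Some m) beta) c s0 K _ [::] (ltW c0) kK _ _); first last.
- by move=> u; apply: kexp_ge0.
- move=> u; rewrite erwE /= /c natrM ler_peMl ?invr_ge0 ?mulr_ge0//.
  by rewrite expr0 mul1r lerDl mulr_ge0//; case/andP: b01.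
rewrite ler_pM2l ?exprn_gt0// cats0.
set h0 := nseq K s0.
apply: (@le_trans _ _ (kexp (erw (Some m) beta) n (fun u =>
    1 - \sum_(K <= l < n.+1) (lev (drop (n - l) u) <= lev h0)%R%:R) h0)); last first.
  apply: le_kexp => // u su.
  have [_|/allsufP ns] := boolP (stay (u ++ h0)).
    by rewrite gerBl sumr_ge0.
  rewrite lerBlDr add0r.
  have [i ih neg] : exists2 i, (i <= size (u ++ h0))%N & lev (drop i (u ++ h0)) < 0.
    apply: contrapT => H; apply: ns => i ih; rewrite leNgt; apply/negP => neg.
    by apply: H; exists i.
  have iu : (i + K <= n)%N.
    rewrite leqNgt; apply/negP => ni.
    have [iu|ui] := leqP i n.
      move: neg; rewrite drop_cat su; case: ltnP => [_|ni']; last first.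
        by rewrite (_ : i = n) ?subnn ?drop0 ?lev_nseq//; lia.
      rewrite lev_cat lev_nseq; have := lev_norm (drop i u); rewrite ler_norml size_drop su.
      lia.
    have /allsufP/(_ (i - n)%N) := stay_nseq K; rewrite size_nseq.
    move: neg ih; rewrite drop_cat size_cat su ltnNge (ltnW ui)/= size_nseq => neg ih.
    by rewrite leNgt neg; lia.
  rewrite (bigD1_seq (n - i)%N)/= ?iota_uniq ?mem_index_iota//; last by lia.
  rewrite subKn; last by lia.
  rewrite (le_trans (ltW neg)) ?lev_nseq//.
  by rewrite lerDl sumr_ge0.
rewrite kexp_sub kexp_cst// kexp_sum.
suff : \sum_(K <= l < n.+1) kexp (erw (Some m) beta) n (fun u => (lev (drop (n - l) u) <= lev h0)%R%:R) h0
  <= 2^-1 by lra.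
apply: (@le_trans _ _ (\sum_(K <= l < n.+1) C * (l.+1%:R ^+ 2)^-1)).
  apply: ler_sum_nat => l /andP[Kl ln].
  rewrite -{1}(@subnKC l n)// (kexp_ancestor kK l (n - l) (fun u => (lev u <= lev h0)%R%:R)).
  by apply: HC => //; rewrite size_nseq.
rewrite -mulr_sumr; have [Kn|nK] := leqP K n.+1; last first.
  by rewrite big_geq ?(ltnW nK)// mulr0 invr_ge0.
apply: (@le_trans _ _ (C * K%:R^-1)); first by rewrite ler_pM2l// sum_inv_sqr.
by rewrite ler_pdivrMr ?ltr0n//; lra.
Qed.

End UniformTails.

Section RenewalTail.
Context (R : realType) (d : nat).
Hypothesis d3 : (3 <= d)%N.
Variable beta0 : R.
Hypotheses (beta0_gt0 : 0 < beta0) (beta0_le1 : beta0 <= 1).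
Implicit Types (h u : history d).

Local Notation rho := (exp_decay d beta0).
Local Notation theta := (exp_rate d beta0).
Local Notation adm := (admissible d beta0).

Let rho01 : 0 < rho < 1.
Proof. by apply: (exp_decay_itv d3 (beta := 1)) => //; rewrite ler01 lexx. Qed.

(** Union bound over pairs of times. A descent of [n ^ 7] levels lasts at least [n ^ 7] steps, hence
    at least [n %/ A] blocks over which the level does not advance. *)
Lemma backtrack_prob A n t m beta : adm m beta -> 4 * (1 + 1024 * hk R d) <= A%:R ->
  (0 < A)%N -> (0 < n)%N -> (t < n.+1 ^ 9)%N ->
  kexp (erw (Some m) beta) t (fun h => (backtrack (n ^ 7) h)%:R) ([::] : history d) <=
  t.+1%:R ^+ 2 * (expR theta * rho ^+ (n %/ A)).
Proof.
move=> ad A_large A0 n0 tn; have b01 := admissible01 beta0_gt0 ad.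
have kK := erw_kernel d (Some m) b01; have [m_large b0 _] := ad.
have /andP[r0 r1] := rho01.
set k := erw _ _; set l := (n ^ 7)%N; set b := expR _ * _.
have bge0 : 0 <= b by rewrite mulr_ge0 ?expR_ge0// exprn_ge0// ltW.
apply: (@le_trans _ _ (kexp k t (fun u => \sum_(0 <= j < t.+1) \sum_(0 <= i < j.+1)
   (lev (drop i u) <= lev (drop j u) - l%:Z)%R%:R) [::])).
  apply: le_kexp => // u su; rewrite cats0.
  rewrite /backtrack su; apply: le_trans (has_le_sum _ _ _) _.
  by rewrite /index_iota subn0; apply: ler_sum => j _; rewrite /index_iota subn0; exact: has_le_sum.
rewrite kexp_sum; apply: (@le_trans _ _ (\sum_(0 <= j < t.+1) t.+1%:R * b)); last first.
  by rewrite sumr_const_nat subn0 -[leLHS]mulr_natl mulrA expr2.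
apply: ler_sum_nat => j /andP[_ jt]; rewrite kexp_sum.
apply: (@le_trans _ _ (\sum_(0 <= i < j.+1) b)); last first.
  by rewrite sumr_const_nat subn0 -[leLHS]mulr_natl ler_wpM2r// ler_nat.
apply: ler_sum_nat => i /andP[_ ij].
have -> : t = (t - j + (j - i) + i)%N by move: ij jt; rewrite !ltnS => ij jt; lia.
rewrite (_ : (fun u => _) = (fun u =>
    (fun w => (lev w <= lev (drop (j - i) w) - l%:Z)%R%:R) (drop i u))); last first.
  by apply: funext => u; rewrite drop_drop subnK.
rewrite (kexp_ancestor kK _ i (fun w => (lev w <= lev (drop (j - i) w) - l%:Z)%R%:R)).
rewrite kexpD; apply: kexp_le_cst => // u su; rewrite cats0.
have [jil|lji] := ltnP (j - i) l.
  rewrite (_ : kexp _ _ _ _ = 0)// -[RHS](kexp_0 k (j - i) u).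
  apply: eq_kexp => w sw; rewrite drop_size_cat// lev_cat.
  rewrite (_ : _ <= _ = false)//; apply/negbTE; rewrite -ltNge.
  rewrite addrC ltrD2r.
  have := lev_norm w; rewrite ler_norml sw => /andP[+ _].
  by apply: lt_le_trans; rewrite ltrN2 ltz_nat.
apply: (@le_trans _ _ (kexp k (j - i) (fun w => ((lev w)%:~R <= (lev u)%:~R + 0 :> R)%:R) u)).
  apply: le_kexp => // w sw; rewrite drop_size_cat// addr0 ler_int ler_nat.
  case: (leP (lev _) (lev u - _)) => // le1; rewrite (le_trans le1)//.
  by rewrite gerBl.
apply: le_trans (@no_advance R d d3 m beta beta0 b01 beta0_gt0 b0 A m_large A_large n n0 _ 0 u _) _.
  by rewrite su; apply: leq_trans (ltnW tn); clear -ij jt; lia.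
rewrite mul0r addr0 mulr1 ler_wpM2l ?expR_ge0// ler_wiXn2l ?(ltW r0) ?(ltW r1)//.
apply: leq_trans (leq_div2r _ lji).
by rewrite /l (expnS n 6) divnMr// expn_gt0 n0.
Qed.

(** The level [(n + 1) n ^ 7] is at most [2 n ^ 2] block lengths, which costs [expR (theta * 2)] to
    the power [n ^ 2], while each of the [n ^ 3 / A] blocks gains a factor [rho]. For
    [n >= A (s + 1)] there are at least [s n ^ 2 + n] blocks, and [s] is such that [rho ^ s] absorbs
    [expR (theta * 2)]. *)
Lemma low_level_prob A : (0 < A)%N -> 4 * (1 + 1024 * hk R d) <= A%:R ->
  exists n1 : nat, forall n t m beta, adm m beta -> (n1 <= n)%N -> (0 < n)%N ->
  (n ^ 9 <= t < n.+1 ^ 9)%N ->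
  kexp (erw (Some m) beta) t (fun h => (lev h < (n.+1 * n ^ 7)%:Z)%R%:R) ([::] : history d) <=
  expR theta * rho ^+ n.
Proof.
move=> A0 A_large; have /andP[r0 r1] := rho01.
have [s hs] : exists s : nat, expR (theta * 2) <= rho ^- s.
  exists (Num.bound (expR (theta * 2) / (1 - rho))); set s := Num.bound _.
  have rs : 0 < rho ^+ s by rewrite exprn_gt0.
  rewrite -[leRHS]mul1r ler_pdivlMr//.
  have := geo_lin s rho01; rewrite -[leRHS]mul1r ler_pdivlMr ?subr_gt0//.
  rewrite -[rho ^+ s * _ * _]mulrA => le1; apply: le_trans le1; rewrite mulrC ler_pM2l//.
  rewrite -ler_pdivrMr ?subr_gt0//; apply: ltW.
  by apply: lt_le_trans (archi_boundP _) _; rewrite ?ler_nat// divr_ge0 ?expR_ge0 ?subr_ge0// ltW.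
exists (A * s.+1)%N => n t m beta ad n1 n0 /andP[nt tn].
have b01 := admissible01 beta0_gt0 ad.
have kK := erw_kernel d (Some m) b01; have [m_large b0 _] := ad.
set y : R := (n.+1 * n ^ 7)%:R.
apply: (@le_trans _ _ (kexp (erw (Some m) beta) t (fun w : history d =>
  ((lev w)%:~R <= (lev ([::] : history d))%:~R + y :> R)%:R) [::])).
  apply: le_kexp => // w _; rewrite lev_nil add0r (_ : y = (n.+1 * n ^ 7)%:Z%:~R)// ler_int ler_nat.
  by case: ltP => // /ltW ->.
apply: le_trans (@no_advance R d d3 m beta beta0 b01 beta0_gt0 b0 A m_large A_large n n0 t y [::] _) _.
  by rewrite add0n ltnW.
have theta0 : 0 <= theta := ltW (exp_rate_gt0 d beta0_gt0).
have yle : y / (A * n ^ 6)%:R <= (2 * n ^ 2)%:R.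
  rewrite ler_pdivrMr ?ltr0n ?muln_gt0 ?A0 ?expn_gt0 ?n0// -natrM ler_nat.
  rewrite -[7%N]/(1 + 6)%N expnD mulnA [leqRHS]mulnA leq_mul2r; apply/orP; right.
  by rewrite expn1 -mulnn; clear -n0 A0; nia.
have k1 : (s * n ^ 2 + n <= t %/ (A * n ^ 6))%N.
  rewrite leq_divRL; last by rewrite muln_gt0 A0 expn_gt0 n0.
  apply: leq_trans nt; rewrite mulnA -[9%N]/(3 + 6)%N expnD leq_mul2r; apply/orP; right.
  apply: (@leq_trans (A * s.+1 * n ^ 2)); last by rewrite expnS leq_mul2r n1 orbT.
  by rewrite -!mulnn; clear -n0 A0; nia.
rewrite mulrDr mulr1 expRD -mulrA ler_pM2l ?expR_gt0//.
apply: (@le_trans _ _ (expR (theta * 2) ^+ (n ^ 2) * rho ^+ (s * n ^ 2 + n))).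
  apply: ler_pM; rewrite ?expR_ge0 ?exprn_ge0 ?(ltW r0)//.
    rewrite -expRM_natl ler_expR; apply: le_trans (ler_wpM2l theta0 yle) _.
    by rewrite natrM le_eqVlt; apply/orP; left; apply/eqP; ring.
  by rewrite ler_wiXn2l ?(ltW r0) ?(ltW r1).
rewrite exprD mulrA ler_piMl ?exprn_ge0 ?(ltW r0)//.
rewrite exprM -exprMn exprn_ile1 ?mulr_ge0 ?expR_ge0 ?exprn_ge0 ?(ltW r0)//.
by rewrite -ler_pdivlMr ?exprn_gt0// mul1r.
Qed.

(** The power [4] leaves a summable [t ^ -2] after two factors [t]: the length of a block and its
    logarithmic derivative. The three cases of [norenewal_cases] have probabilities exponentially
    small in [n], up to powers of [t]. *)
Lemma norenewal_tail : exists2 C : R, 0 < C & forall m beta t, adm m beta ->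
  kexp (erw (Some m) beta) t (fun h => (norenewal h)%:R) ([::] : history d) <= C / t.+1%:R ^+ 4.
Proof.
have [A A0 A_large] := block_scale R d.
have /andP[r0 r1] := rho01.
have [q [q0 q1 hq]] := stay_prob d3 beta0_gt0 beta0_le1.
have [n1 hlow] := low_level_prob A0 A_large.
(* With [t < (n + 1) ^ 9], the power [54 = 9 * 6] pays for [t ^ 4] and for the [t ^ 2] pairs of
   times of a backtrack; the other two terms only have [t ^ 4] to pay, whence [36 = 9 * 4]. *)
have [C1 C10 H1] := geo_poly_div 54 rho01 A0.
have [C2 C20 H2] := @geo_poly_div R 36 1 rho rho01 isT.
(* [1 - q] may be [0], whereas [geo_poly_div] takes a positive ratio. *)
have q01 : 0 < 1 - q / 2 < 1 by apply/andP; split; lra.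
have [C3 C30 H3] := @geo_poly_div R 36 1 (1 - q / 2) q01 isT.
have et : 0 < expR theta by rewrite expR_gt0.
exists (n1.+1%:R ^+ 36 + (expR theta * C1 + expR theta * C2 + C3)) => [|m beta t ad].
  by rewrite !addr_gt0 ?mulr_gt0 ?exprn_gt0// ltr0n.
have b01 := admissible01 beta0_gt0 ad.
have kK := erw_kernel d (Some m) b01; have [m_large b0 _] := ad.
rewrite ler_pdivlMr ?exprn_gt0 ?ltr0n//.
set p := kexp _ _ _ _.
have p1 : p <= 1 by exact: kexp_prob.
have p0 : 0 <= p by apply: kexp_ge0.
have C0 : 0 <= expR theta * C1 + expR theta * C2 + C3.
  by rewrite !addr_ge0 ?mulr_ge0 ?(ltW et) ?(ltW C10) ?(ltW C20) ?(ltW C30).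
have n1pos : 0 <= n1.+1%:R ^+ 36 :> R by rewrite exprn_ge0.
have [->|t0] := posnP t; first by rewrite expr1n mulr1 (le_trans p1)// -[leLHS]addr0 lerD// exprn_ege1// ler1n.
have [n n0 /andP[nt tn]] := ninth_root t0.
have t4 : t.+1%:R ^+ 4 <= n.+1%:R ^+ 36 :> R.
  by rewrite -[36%N]/(9 * 4)%N exprM lerXn2r ?nnegrE ?exprn_ge0// -natrX ler_nat.
have [nn1|n1n] := ltnP n n1.
  apply: (@le_trans _ _ (n1.+1%:R ^+ 36)); last by rewrite lerDl.
  rewrite -[leRHS]mul1r; apply: ler_pM => //; rewrite ?exprn_ge0//.
  by apply: le_trans t4 _; rewrite lerXn2r ?nnegrE// ler_nat ltnS ltnW.
have l0 : (0 < n ^ 7)%N by rewrite expn_gt0 n0.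
have pn : p <= t.+1%:R ^+ 2 * (expR theta * rho ^+ (n %/ A)) + expR theta * rho ^+ n + (1 - q) ^+ n.
  apply: le_trans (_ : _ <= kexp (erw (Some m) beta) t (fun h => (backtrack (n ^ 7) h)%:R
     + (lev h < (n.+1 * n ^ 7)%:Z)%R%:R + (alldips (n ^ 7) n h)%:R) ([::] : history d)) _.
    apply: le_kexp => // u _; rewrite cats0.
    have [nr|_] := boolP (norenewal u); last by rewrite !addr_ge0.
    have := norenewal_cases l0 n nr.
    by move: (backtrack _ _) (lev _ < _)%R (alldips _ _ _) => [] [] [] //= _; rewrite -!natrD ler1n.
  rewrite !kexp_add; apply: lerD; first apply: lerD.
  - exact: backtrack_prob.
  - by apply: hlow => //; rewrite nt.
  - by apply: alldips_prob => // i; exact: hq.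
apply: (@le_trans _ _ (expR theta * C1 + expR theta * C2 + C3)); last by rewrite lerDr.
apply: le_trans (ler_wpM2r _ pn) _; first by rewrite exprn_ge0.
have tt0 : 0 < t.+1%:R :> R by rewrite ltr0n.
rewrite !mulrDl; apply: lerD; first apply: lerD.
- rewrite [leLHS](_ : _ = expR theta * (t.+1%:R ^+ 6 * rho ^+ (n %/ A))); last by ring.
  rewrite ler_pM2l//.
  apply: (@le_trans _ _ (n.+1%:R ^+ 54 * rho ^+ (n %/ A))).
    rewrite ler_wpM2r ?exprn_ge0 ?(ltW r0)//.
    by rewrite -[54%N]/(9 * 6)%N exprM lerXn2r ?nnegrE ?exprn_ge0// -natrX ler_nat.
  by rewrite mulrC -ler_pdivlMr ?exprn_gt0 ?ltr0n.
- rewrite -mulrA ler_pM2l//; apply: le_trans (ler_wpM2l _ t4) _.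
    by rewrite exprn_ge0 ?(ltW r0).
  by rewrite -ler_pdivlMr ?exprn_gt0 ?ltr0n//; have := H2 n; rewrite divn1.
apply: le_trans (ler_wpM2l _ t4) _; first by rewrite exprn_ge0 ?subr_ge0.
rewrite -ler_pdivlMr ?exprn_gt0 ?ltr0n//; apply: le_trans (H3 n); rewrite divn1.
by rewrite lerXn2r ?nnegrE; lra.
Qed.

End RenewalTail.

(** * Renewal equations *)

Section Convolution.
Context (R : comNzRingType).
Implicit Types (a b c : nat -> R) (n : nat).

Definition sconv a b n : R := \sum_(i < n.+1) a i * b (n - i)%N.

(** Commutativity and associativity of the convolution are inherited from polynomials, once the
    sequences are truncated beyond the index considered. *)
Lemma conv_coef a b N n : (n < N)%N ->
  sconv a b n = ((\poly_(i < N) a i) * (\poly_(i < N) b i))`_n.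
Proof.
move=> nN; rewrite coefM; apply: eq_bigr => i _.
rewrite !coef_poly (leq_ltn_trans _ nN) ?leq_ord//.
by rewrite (leq_ltn_trans (leq_subr _ _) nN).
Qed.

Lemma convC a b : sconv a b = sconv b a.
Proof. by apply: funext => n; rewrite !(@conv_coef _ _ n.+1)// mulrC. Qed.

Lemma convA a b c : sconv a (sconv b c) = sconv (sconv a b) c.
Proof.
apply: funext => n.
have E x y z : sconv x (sconv y z) n = ((\poly_(i < n.+1) x i) *
    ((\poly_(i < n.+1) y i) * (\poly_(i < n.+1) z i)))`_n.
  rewrite coefM; apply: eq_bigr => i _; rewrite coef_poly ltn_ord -conv_coef//.
  by rewrite ltnS leq_subr.
by rewrite [RHS](congr1 (fun s => s n) (convC _ _)) !E mulrA mulrC.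
Qed.

Lemma convDl a b c n : sconv (fun i => a i + b i) c n = sconv a c n + sconv b c n.
Proof. by rewrite /sconv -big_split; apply: eq_bigr => i _; rewrite mulrDl. Qed.

Lemma conv1l a n : sconv (fun i => (i == 0%N)%:R) a n = a n.
Proof.
rewrite /sconv big_ord_recl /= mul1r subn0 big1 ?addr0// => i _.
by rewrite /bump /= mul0r.
Qed.

Lemma conv_psum a n : sconv (fun=> 1) a n = \sum_(i < n.+1) a i.
Proof.
rewrite convC /sconv; apply: eq_bigr => i _; exact: mulr1.
Qed.

(** In generating functions, [r = 1 / (1 - p)] and [e = delta r / (1 - p) = delta r ^ 2]. The
    division is avoided by expanding the convolution of [r] and [e] in two ways and cancelling its
    convolution with [p]. *)
Lemma renewal_solution (r p delta e : nat -> R) :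
  (forall n, r n = (n == 0%N)%:R + sconv p r n) ->
  (forall n, e n = sconv delta r n + sconv p e n) ->
  e = sconv delta (sconv r r).
Proof.
move=> hr he; apply: funext => n.
have re : sconv r e n = e n + sconv p (sconv r e) n.
  by rewrite {1}(funext hr) convDl conv1l -convA.
have re' : sconv r e n = sconv delta (sconv r r) n + sconv p (sconv r e) n.
  rewrite {1}(funext he) convC convDl -convA -[sconv (sconv p e) r]convA.
  by rewrite [sconv e r]convC.
by apply: (addIr (sconv p (sconv r e) n)); rewrite -re re'.
Qed.

End Convolution.

Section RenewalSequences.
Context (R : realType).
Variables (r z delta e : nat -> R) (q Z C : R).
Hypothesis r01 : forall n, 0 <= r n <= 1.
Hypothesis z0 : forall n, 0 <= z n.
Hypothesis Z_gt0 : 0 < Z.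
Hypothesis sum_z : forall n, \sum_(i < n.+1) z i <= Z.
Hypothesis q_gt0 : 0 < q.
Hypothesis rz : forall n, q <= sconv z r n.
Hypothesis C_gt0 : 0 < C.
Hypothesis delta_le : forall n, `|delta n| <= C / n.+1%:R ^+ 3.
Hypothesis e_sol : e = sconv delta (sconv r r).
Hypothesis e_small : forall eps : R, 0 < eps ->
  exists n0, forall n, (n0 <= n)%N -> `|e n| <= eps * n%:R.

Lemma psum_le (a : nat -> R) m n : (forall i, 0 <= a i) -> (m <= n)%N ->
  \sum_(i < m.+1) a i <= \sum_(i < n.+1) a i.
Proof.
move=> a0 mn; rewrite -!(big_mkord xpredT a) [leRHS](@big_cat_nat _ _ _ m.+1)//= lerDl.
by apply: sumr_ge0.
Qed.

(** Summing [q <= sconv z r] up to [n] gives at most [Z] times the partial sum of [r]: renewals have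
    positive density. *)
Lemma psum_r_ge n : n.+1%:R * (q / Z) <= \sum_(i < n.+1) r i.
Proof.
rewrite mulrA ler_pdivrMr//.
apply: (@le_trans _ _ (\sum_(i < n.+1) sconv z r i)).
  by rewrite -[n.+1 in leLHS]card_ord mulr_natl -sumr_const; apply: ler_sum => i _.
rewrite -conv_psum convA [sconv _ z]convC -convA.
rewrite mulrC; apply: le_trans (ler_wpM2r _ (sum_z n)); last first.
  by apply: sumr_ge0 => i _; case/andP: (r01 i).
rewrite mulr_suml; apply: ler_sum => i _; apply: ler_wpM2l => //.
by rewrite conv_psum psum_le ?leq_subr// => j; case/andP: (r01 j).
Qed.

Lemma conv_rr_itv n : 0 <= sconv r r n <= n.+1%:R.
Proof.
have r0 i : 0 <= r i by case/andP: (r01 i).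
have r1 i : r i <= 1 by case/andP: (r01 i).
apply/andP; split; first by apply: sumr_ge0 => i _; rewrite mulr_ge0.
rewrite -[n.+1 in leRHS]card_ord -sumr_const; apply: ler_sum => i _.
by rewrite mulr_ile1.
Qed.

(** Two indices that are both at most [n / 2] have a sum of at most [n]. *)
Lemma psum_rr_ge n : (n./2.+1%:R * (q / Z)) ^+ 2 <= \sum_(i < n.+1) sconv r r i.
Proof.
have r0 i : 0 <= r i by case/andP: (r01 i).
apply: (@le_trans _ _ ((\sum_(i < n./2.+1) r i) ^+ 2)).
  rewrite lerXn2r ?nnegrE ?psum_r_ge ?sumr_ge0// mulr_ge0// divr_ge0 ?(ltW q_gt0) ?(ltW Z_gt0)//.
rewrite -conv_psum convA -[sconv (fun=> 1) r]/(sconv _ r) [sconv (sconv _ r) r]convC.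
rewrite expr2 mulr_suml.
rewrite /(sconv r) -(big_mkord xpredT (fun i => r i * sconv (fun=> 1) r (n - i)%N)).
rewrite (@big_cat_nat _ _ _ n./2.+1)//=; last by lia.
rewrite big_mkord -[leLHS]addr0 lerD//; last first.
  apply: sumr_ge0 => i _; rewrite mulr_ge0// conv_psum sumr_ge0//.
apply: ler_sum => i _; rewrite ler_wpM2l// conv_psum psum_le//.
by have := ltn_ord i; lia.
Qed.

(** With [Sf] the partial sums of [sconv r r], the sum of the [e i] is that of
    [delta i * Sf (n - i)]. Replacing [Sf (n - i)] by [Sf n] costs at most the sum of
    [|delta i| * i * n.+1], which is linear in [n], whereas [Sf n] is quadratic. *)
Lemma sum_delta_bound n : `|\sum_(i < n.+1) delta i| * (n./2.+1%:R * (q / Z)) ^+ 2 <=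
  \sum_(i < n.+1) `|e i| + n.+1%:R * (2 * C).
Proof.
have f0 i : 0 <= sconv r r i by case/andP: (conv_rr_itv i).
pose Sf n := \sum_(i < n.+1) sconv r r i.
have Sf0 k : 0 <= Sf k by apply: sumr_ge0.
apply: (@le_trans _ _ (`|\sum_(i < n.+1) delta i| * Sf n)).
  by rewrite ler_wpM2l// psum_rr_ge.
rewrite -[Sf n]ger0_norm// -normrM.
have -> : (\sum_(i < n.+1) delta i) * Sf n = \sum_(i < n.+1) e i
    + \sum_(i < n.+1) delta i * (Sf n - Sf (n - i)%N).
  rewrite -[\sum_(i < n.+1) e i]conv_psum e_sol convA [sconv _ delta]convC -convA.
  rewrite /(sconv delta) mulr_suml -big_split /=; apply: eq_bigr => i _.
  by rewrite conv_psum -mulrDr addrC subrK.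
apply: le_trans (ler_normD _ _) _; apply: lerD; first exact: ler_norm_sum.
apply: le_trans (ler_norm_sum _ _ _) _.
apply: (@le_trans _ _ (\sum_(i < n.+1) n.+1%:R * (C * (i.+1%:R ^+ 2)^-1))).
  apply: ler_sum => i _; rewrite normrM.
  have Sd : `|Sf n - Sf (n - i)%N| <= i%:R * n.+1%:R.
    have Sle : Sf (n - i)%N <= Sf n by rewrite psum_le// leq_subr.
    rewrite ger0_norm ?subr_ge0// lerBlDr /Sf.
    rewrite -!(big_mkord xpredT (sconv r r)) (@big_cat_nat _ _ _ (n - i).+1)//=; last first.
      by rewrite ltnS leq_subr.
    rewrite addrC lerD2r; apply: (@le_trans _ _ (\sum_((n - i).+1 <= j < n.+1) n.+1%:R)).
      apply: ler_sum_nat => j /andP[_ jn]; case/andP: (conv_rr_itv j) => _.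
      by move=> /le_trans; apply; rewrite ler_nat.
    by rewrite sumr_const_nat subSS (subKn (leq_ord i)) -[leLHS]mulr_natl.
  apply: le_trans (ler_pM _ _ (delta_le i) Sd) _ => //.
  rewrite [leLHS](_ : _ = n.+1%:R * (C * (i%:R / i.+1%:R ^+ 3))); last by ring.
  rewrite ler_wpM2l// ler_pM2l// ler_pdivrMr ?exprn_gt0 ?ltr0n//.
  by rewrite [_ ^+ 3]exprS mulrCA mulVf ?mulr1 ?ler_nat// expf_neq0// pnatr_eq0.
rewrite -mulr_sumr ler_wpM2l// -mulr_sumr mulrC ler_pM2r//.
rewrite -(big_mkord xpredT (fun i : nat => (i.+1%:R ^+ 2)^-1 : R)) big_nat_recl// expr1n invr1.
rewrite -(big_add1 _ _ 0 n.+1 xpredT (fun j => (j.+1%:R ^+ 2)^-1)).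
have [->|n0] := posnP n; first by rewrite big_geq//; lra.
by have := @sum_inv_sqr R 1 n.+1 isT isT; rewrite invr1; lra.
Qed.

Lemma sum_delta_to0 eps : 0 < eps -> exists n0, forall n, (n0 <= n)%N ->
  `|\sum_(i < n.+1) delta i| <= eps.
Proof.
move=> eps0; have [c c0 cE] : exists2 c, 0 < c & c = q / Z by exists (q / Z); rewrite ?divr_gt0.
(* Passing from [n./2.+1] to [n.+1] costs a factor [4] on squares, so the [8] leaves half of [eps]
   to this term and half to the one of order [K / n]. *)
have eta0 : 0 < eps * c ^+ 2 / 8 by rewrite divr_gt0// mulr_gt0// exprn_gt0.
have [n1 hn1] := e_small eta0.
pose K : R := \sum_(i < n1) `|e i| + 2 * C.
have K0 : 0 <= K by rewrite addr_ge0 ?sumr_ge0// mulr_ge0// ltW.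
exists (n1 + Num.bound (8 * K / (eps * c ^+ 2)))%N => n nn.
have hd := sum_delta_bound n; rewrite -cE in hd.
have e1 : \sum_(i < n.+1) `|e i| <= \sum_(i < n1) `|e i| + n.+1%:R * (eps * c ^+ 2 / 8 * n.+1%:R).
  rewrite -!(big_mkord xpredT (fun i => `|e i|)) (@big_cat_nat _ _ _ n1)//=; last by lia.
  rewrite lerD2l; apply: (@le_trans _ _ (\sum_(n1 <= i < n.+1) eps * c ^+ 2 / 8 * n.+1%:R)).
    apply: ler_sum_nat => i /andP[n1i ilt]; apply: le_trans (hn1 _ n1i) _.
    by rewrite ler_pM2l// ler_nat ltnW.
  rewrite sumr_const_nat -[leLHS]mulr_natl; apply: ler_wpM2r.
    by rewrite mulr_ge0 ?(ltW eta0).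
  by rewrite ler_nat leq_subr.
have n1R : n.+1%:R <= 2 * n./2.+1%:R :> R by rewrite -natrM ler_nat; lia.
have hK : 8 * K / (eps * c ^+ 2) <= n.+1%:R.
  apply: ltW; apply: lt_le_trans (archi_boundP _) _.
    apply: divr_ge0; apply: mulr_ge0 => //; first exact: ltW.
    by rewrite exprn_ge0 ?(ltW c0).
  by rewrite ler_nat; lia.
rewrite ler_pdivrMr ?mulr_gt0 ?exprn_gt0// in hK.
have x1 : 1 <= n.+1%:R :> R by rewrite ler1n.
have main : `|\sum_(i < n.+1) delta i| * (n.+1%:R * c) ^+ 2 <= eps * (n.+1%:R * c) ^+ 2.
  apply: (@le_trans _ _ (4 * (`|\sum_(i < n.+1) delta i| * (n./2.+1%:R * c) ^+ 2))).
    rewrite [leRHS]mulrCA ler_wpM2l// (_ : 4 = 2 ^+ 2 :> R); last by ring.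
    rewrite -exprMn lerXn2r ?nnegrE ?mulr_ge0 ?(ltW c0)//.
    by rewrite mulrA ler_pM2r.
  apply: le_trans (ler_wpM2l _ hd) _ => //.
  apply: le_trans (ler_wpM2l _ (lerD e1 (lexx _))) _ => //.
  rewrite exprMn; move: hK x1; rewrite /K.
  have : 0 <= \sum_(i < n1) `|e i| by apply: sumr_ge0.
  move: (\sum_(i < n1) `|e i|) => s s0.
  move: (n.+1%:R : R) (c ^+ 2) => x c2; move: C_gt0; move: C => C' C'0 hK x1.
  have : s <= s * x by nra.
  have : 8 * (s + 2 * C') * x <= x * (eps * c2) * x by nra.
  nra.
by rewrite ler_pM2r ?exprn_gt0 ?mulr_gt0 ?ltr0n// in main.
Qed.

End RenewalSequences.

Section RenewalDecomposition.
Context (R : realType) (d : nat).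
Implicit Types (u h : history d).

Lemma eq_allsuf (S : Type) (A A' : pred (seq S)) (h : seq S) :
  A =1 A' -> allsuf A h = allsuf A' h.
Proof. by move=> AA; elim: h => //= [|s h ->]; rewrite AA. Qed.

Lemma newmax_cat u h : newmax h -> stay u -> newmax (u ++ h) = newmax u.
Proof.
case: u => [|s u] nh su; first by rewrite nh.
rewrite /newmax /= allsuf_cat -cat_cons lev_cat.
rewrite (@eq_allsuf _ _ (fun t => lev t < lev (s :: u))) => [|t]; last by rewrite lev_cat ltrD2r.
rewrite [X in _ && X](_ : _ = true) ?andbT//.
apply/allpastP => i ih; move/allpastP/(_ i ih): nh => /lt_le_trans; apply.
by rewrite lerDr stay_lev.
Qed.

Lemma stay_cat u h : stay h -> stay u -> stay (u ++ h).
Proof.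
rewrite /stay allsuf_cat allsufE => /andP[lh ->]; rewrite andbT.
by apply: allsuf_impl => i _ li; rewrite lev_cat addr_ge0.
Qed.

Lemma renewal_cat i u h : newmax h -> stay u -> (i <= size u)%N ->
  renewal i (u ++ h) = renewal i u.
Proof.
move=> nh su iu; rewrite /renewal takel_cat// drop_cat.
case: ltnP => ui; first by rewrite newmax_cat// /stay allsuf_drop.
by rewrite (_ : i = size u) ?subnn ?drop0 ?drop_size ?nh//; lia.
Qed.

Definition free j u := all (fun i => ~~ renewal i u) (iota j (size u - j)).

Lemma norenewalE u : norenewal u = free 1 u.
Proof. by rewrite /norenewal /free subn1. Qed.

(** Indices count back in time, so this singles out the latest renewal that is at least [j] steps
    old. *)
Definition first_renewal j i h :=
  renewal i h && all (fun i' => ~~ renewal i' h) (iota j (i - j)).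

Lemma sum_first_renewal j h : stay h -> (j <= size h)%N ->
  \sum_(j <= i < (size h).+1) (first_renewal j i h)%:R = 1 :> R.
Proof.
move=> sh jh.
(* Time [0], of index [size h], is a renewal because [h] stays at nonnegative levels. *)
have ex : exists i, (j <= i <= size h)%N && renewal i h.
  by exists (size h); rewrite jh leqnn /renewal drop_size take_size sh.
have [i /andP[/andP[ji ih] ri] imin] := ex_minnP ex.
rewrite (bigD1_seq i) ?iota_uniq ?mem_index_iota ?ji ?ltnS//=.
have -> : first_renewal j i h.
  rewrite /first_renewal ri; apply/allP => i'; rewrite mem_iota => ii'.
  apply/negP => ri'; have := imin i'; rewrite ri' andbT => /(_ _); lia.
rewrite big1_seq ?addr0// => i' /andP[i'i]; rewrite mem_index_iota => /andP[ji' i'h].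
case: (boolP (first_renewal j i' h)) => // /andP[ri' /allP no].
have ii' : (i <= i')%N by apply: imin; rewrite ji' ri' -ltnS i'h.
have : i \in iota j (i' - j).
  by rewrite mem_iota ji subnKC ?(leq_trans ji ii')// ltn_neqAle eq_sym i'i.
by move/no; rewrite ri.
Qed.

Variables (m : option nat) (beta : R).
Hypothesis beta01 : 0 <= beta <= 1.
Local Notation k := (erw (d := d) m beta).
Let kK : is_kernel k := erw_kernel d m beta01.

(** The trajectory is cut at its latest renewal that is at least [j] steps old. The past [h] ends
    there at a strict record, so by [kexp_fresh] the part [u] after it has the law of a walk started
    afresh. *)
Lemma renewal_decomposition j n (F : history d -> R) (G : history d -> history d -> R) :
  (j <= n)%N -> (forall h, ~~ stay h -> F h = 0) ->
  (forall u h, (j <= size u)%N -> stay u -> stay h -> newmax h -> F (u ++ h) = G u h) ->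
  kexp k n F [::] = \sum_(j <= i < n.+1) kexp k (n - i) (fun h =>
    (stay h && newmax h)%:R * kexp k i (fun u => (stay u && free j u)%:R * G u h) [::]) [::].
Proof.
move=> jn F0 FG.
rewrite (@eq_kexp _ _ _ _ _ (fun h => \sum_(j <= i < n.+1) F h * (first_renewal j i h)%:R)); last first.
  move=> h sh; rewrite cats0; have [st|nst] := boolP (stay h).
    by rewrite -mulr_sumr -sh sum_first_renewal ?mulr1// sh.
  by rewrite F0// big1// => i _; rewrite mul0r.
rewrite kexp_sum; apply: eq_big_nat => i /andP[ji ilt].
rewrite -{1}(@subnK i n)// kexpD; apply: eq_kexp => h sh; rewrite cats0.
have [/andP[st nm]|/negbTE nsn] := boolP (stay h && newmax h).
  rewrite mul1r; apply: kexp_fresh => // [u su|u /negbTE ->]; last by rewrite mul0r.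
  rewrite /first_renewal {1}/renewal -su drop_size_cat// take_size_cat// nm /=.
  have [stu|nstu] := boolP (stay u); last by rewrite mulr0 mul0r.
  rewrite FG ?su//= mulrC; congr ((nat_of_bool _)%:R * _).
  rewrite /free su; apply: eq_in_all => i'; rewrite mem_iota => ii'.
  by rewrite renewal_cat//; lia.
rewrite mul0r -(kexp_0 k i h); apply: eq_kexp => u su.
have [st|nst] := boolP (stay h); last first.
  rewrite F0 ?mul0r//; apply: contra nst => /(@allsuf_drop _ _ _ (size u)).
  by rewrite drop_size_cat.
move: nsn; rewrite st /= => nm.
by rewrite /first_renewal /renewal -su drop_size_cat// nm /= mulr0.
Qed.

Definition rseq n : R := kexp k n (fun h => (stay h && newmax h)%:R) [::].
Definition zseq n : R := kexp k n (fun u => (stay u && free 0 u)%:R) [::].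
Definition block u := [&& stay u, free 1 u & newmax u].
(** The empty history satisfies [block]; the first factor excludes it. *)
Definition blockseq (f : history d -> R) n : R :=
  (0 < n)%:R * kexp k n (fun u => (block u)%:R * f u) [::].

Lemma stay_conv n : kexp k n (fun u => (stay u)%:R) [::] = sconv zseq rseq n.
Proof.
rewrite (@renewal_decomposition 0 n _ (fun _ _ => 1))//; last 2 first.
- by move=> h /negbTE ->.
- by move=> u h _ su sh _; rewrite stay_cat.
rewrite big_mkord; apply: eq_bigr => i _; rewrite /rseq -kexpZ.
apply: eq_kexp => h _; rewrite mulrC; congr (_ * _).
by apply: eq_kexp => u _; rewrite mulr1.
Qed.

Lemma conv_pos (a b : nat -> R) n : a 0%N = 0 ->
  sconv a b n = \sum_(1 <= i < n.+1) a i * b (n - i)%N.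
Proof.
move=> a0; rewrite /sconv -(big_mkord xpredT (fun i => a i * b (n - i)%N)).
by rewrite big_ltn// a0 mul0r add0r.
Qed.

Lemma blockseq0 f : blockseq f 0 = 0. Proof. by rewrite /blockseq mul0r. Qed.

Lemma rseq_conv n : rseq n = (n == 0%N)%:R + sconv (blockseq (fun=> 1)) rseq n.
Proof.
rewrite conv_pos ?blockseq0//; case: n => [|n].
  by rewrite big_geq// addr0 /rseq kexp0 /stay /= lev_nil.
rewrite add0r /rseq (@renewal_decomposition 1 n.+1 _ (fun u _ => (newmax u)%:R))//; last 2 first.
- by move=> h /negbTE ->.
- by move=> u h _ su sh nh; rewrite stay_cat// newmax_cat.
apply: eq_big_nat => i /andP[i1 _]; rewrite /blockseq i1 mul1r -kexpZ.
apply: eq_kexp => h _; rewrite mulrC; congr (_ * _).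
by apply: eq_kexp => u _; rewrite mulr1 -natrM mulnb -andbA.
Qed.

Section Additive.
Variable f : history d -> R.
Hypothesis f_nil : f [::] = 0.
Hypothesis f_cat : forall u h, newmax h -> stay u -> f (u ++ h) = f u + f h.

Definition eseq n : R := kexp k n (fun h => (stay h && newmax h)%:R * f h) [::].

(** At the cut, [f] splits as [f u + f h]: the first term charges the last block, after any past
    that ends at a renewal, and the second reproduces [eseq]. *)
Lemma eseq_conv n : eseq n = sconv (blockseq f) rseq n + sconv (blockseq (fun=> 1)) eseq n.
Proof.
rewrite !conv_pos ?blockseq0//; case: n => [|n].
  by rewrite !big_geq// addr0 /eseq kexp0 f_nil mulr0.
rewrite /eseq (@renewal_decomposition 1 n.+1 _ (fun u h => (newmax u)%:R * (f u + f h)))//; last 2 first.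
- by move=> h /negbTE ->; rewrite mul0r.
- by move=> u h _ su sh nh; rewrite stay_cat// newmax_cat// f_cat.
rewrite -big_split /=; apply: eq_big_nat => i /andP[i1 _].
rewrite /rseq -2!kexpZ -kexp_add; apply: eq_kexp => h _; rewrite /blockseq i1 !mul1r.
have -> : kexp k i (fun u => (stay u && free 1 u)%:R * ((newmax u)%:R * (f u + f (h ++ [::])))) [::] =
    kexp k i (fun u => (block u)%:R * f u) [::] + f (h ++ [::]) * kexp k i (fun u => (block u)%:R * 1) [::].
  rewrite -kexpZ -kexp_add; apply: eq_kexp => u _.
  by rewrite mulrA -natrM mulnb -andbA -/(block _); ring.
by ring.
Qed.

End Additive.

Lemma rseq01 n : 0 <= rseq n <= 1.
Proof. by rewrite kexp_ge0//= kexp_prob. Qed.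

End RenewalDecomposition.

Section BlockMean.
Context (R : realType) (d : nat).
Hypothesis d3 : (3 <= d)%N.
Variable beta0 : R.
Hypotheses (beta0_gt0 : 0 < beta0) (beta0_le1 : beta0 <= 1).
Local Notation adm := (admissible d beta0).

Lemma blockseq_bound (C : R) (m : nat) (beta : R) (f : history d -> R) t :
  adm m beta -> 0 <= C ->
  (forall n, kexp (erw (Some m) beta) n (fun h => (norenewal h)%:R) ([::] : history d) <= C / n.+1%:R ^+ 4) ->
  forall c, (forall u, size u = t -> `|f u| <= c) ->
  `|blockseq (Some m) beta f t| <= c * (C / t.+1%:R ^+ 4).
Proof.
move=> ad C0 hC c fc; have b01 := admissible01 beta0_gt0 ad.
have kK := erw_kernel d (Some m) b01.
have c0 : 0 <= c.
  by apply: le_trans (fc (nseq t (ord0, false)) _); rewrite ?size_nseq.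
apply: (@le_trans _ _ (c * kexp (erw (Some m) beta) t (fun h => (norenewal h)%:R) ([::] : history d))); last first.
  by rewrite ler_wpM2l.
rewrite /blockseq normrM; apply: (@le_trans _ _ (1 *
  `|kexp (erw (Some m) beta) t (fun u => (block u)%:R * f u) ([::] : history d)|)).
  by rewrite ler_wpM2r// ger0_norm//; case: (0 < t)%N.
rewrite mul1r; apply: le_trans (ler_norm_kexp kK _ _ _) _.
rewrite -kexpZ; apply: le_kexp => // u su; rewrite cats0 normrM.
rewrite norenewalE /block; case: stay; case: free; case: newmax => /=; rewrite ?normr0 ?mul0r ?mulr_ge0//.
by rewrite normr1 mul1r mulr1 fc.
Qed.

(** This functional is additive over blocks and of order [o(n)] in mean, so its block mean vanishes:
    [hs] is the ratio of the block means of [nunexc] and [size]. *)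
Lemma block_mean m beta (hs : R) : adm m beta ->
  (forall eps : R, 0 < eps -> exists n0, forall n, (n0 <= n)%N ->
    kexp (erw (Some m) beta) n (fun h => `|(nunexc (Some m) h)%:R - hs * (size h)%:R|) ([::] : history d)
      <= eps * n%:R) ->
  forall eps : R, 0 < eps -> exists n0, forall n, (n0 <= n)%N ->
  `|\sum_(i < n.+1) blockseq (Some m) beta (fun h : history d => (nunexc (Some m) h)%:R
    - hs * (size h)%:R) i| <= eps.
Proof.
move=> ad small; have b01 := admissible01 beta0_gt0 ad.
have kK := erw_kernel d (Some m) b01.
have [q [q0 q1 hq]] := stay_prob d3 beta0_gt0 beta0_le1.
have [C C0 hC] := norenewal_tail d3 beta0_gt0 beta0_le1.
set f := fun h : history d => _.
have inv4 (t j : nat) : (j <= 4)%N -> C / t.+1%:R ^+ 4 <= C / t.+1%:R ^+ j.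
  move=> j4; rewrite ler_pM2l// lef_pV2 ?posrE ?exprn_gt0 ?ltr0n// ler_weXn2l// ler1n//.
have f_nil : f [::] = 0 by rewrite /f /= mulr0 subrr.
have f_cat u h : newmax h -> stay u -> f (u ++ h) = f u + f h.
  by move=> nh su; rewrite /f nunexc_fresh// size_cat !natrD; ring.
apply: (@sum_delta_to0 R (rseq d (Some m) beta) (zseq d (Some m) beta) _
   (eseq (Some m) beta f) q (2 * C) ((1 + `|hs|) * C)) => //.
- exact: rseq01.
- by move=> n; apply: kexp_ge0.
- by rewrite mulr_gt0.
- move=> n; apply: (@le_trans _ _ (\sum_(i < n.+1) C * (i.+1%:R ^+ 2)^-1)).
    apply: ler_sum => i _; apply: le_trans (inv4 i 2%N isT); apply: le_trans (hC m beta i ad).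
    apply: le_kexp => // u _; rewrite norenewalE ler_nat; case: stay => //=.
    case fr: (free 0 _) => //; rewrite lt0b; apply/allP => j; rewrite mem_iota => ji.
    by move/allP/(_ j): fr; rewrite mem_iota; apply; lia.
  rewrite -mulr_sumr mulrC ler_pM2r//.
  rewrite -(big_mkord xpredT (fun i : nat => (i.+1%:R ^+ 2)^-1 : R)) big_nat_recl// expr1n invr1.
  rewrite -(big_add1 _ _ 0 n.+1 xpredT (fun j => (j.+1%:R ^+ 2)^-1)).
  have [->|n0] := posnP n; first by rewrite big_geq//; lra.
  by have := @sum_inv_sqr R 1 n.+1 isT isT; rewrite invr1; lra.
- by move=> n; rewrite -stay_conv//; exact: hq.
- by rewrite mulr_gt0// ltr_pwDl.
- move=> n; apply: le_trans (@blockseq_bound C m beta f n ad (ltW C0)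
    (fun t => hC m beta t ad) ((1 + `|hs|) * n%:R) _) _.
    move=> u su; rewrite /f; apply: le_trans (ler_normB _ _) _; rewrite mulrDl mul1r su.
    by rewrite normrM ![`|_%:R|]ger0_norm// lerD2r ler_nat -su nunexc_le.
  rewrite -!mulrA ler_wpM2l ?addr_ge0// mulrCA ler_pM2l//.
  rewrite ler_pdivrMr ?exprn_gt0 ?ltr0n// [_ ^+ 4]exprS mulrCA mulVf ?mulr1 ?ler_nat//.
- apply: (@renewal_solution R _ (blockseq (Some m) beta (fun=> 1))) => n.
    exact: rseq_conv.
  exact: eseq_conv.
move=> eps /small[n0 hn0]; exists n0 => n /hn0; apply: le_trans.
apply: le_trans (ler_norm_kexp kK _ _ _) _.
apply: le_kexp => // u _; rewrite normrM ler_piMl// ger0_norm//.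
by case: (_ && _).
Qed.

End BlockMean.

(** * From the speed to the fraction of unexcited steps *)

Section SpeedToExcitation.
Context (R : realType) (d : nat).
Variables (m : option nat) (beta : R).
Hypothesis beta01 : 0 <= beta <= 1.
Local Notation k := (erw (d := d) m beta).
Let kK : is_kernel k := erw_kernel d m beta01.
Let D : R := d.+1%:R.

(** A martingale, with bounded increments. *)
Definition fluct (h : history d) : R :=
  (lev h)%:~R - beta / D * ((size h)%:R - (nunexc m h)%:R).

Lemma fluct_sqr n : kexp k n (fun h => fluct h ^+ 2) [::] <= 4 * n%:R.
Proof.
elim: n => [|n IH]; first by rewrite kexp0 /fluct lev_nil /= subrr !mulr0 subr0 expr0n.
rewrite kexpSr; apply: (@le_trans _ _ (kexp k n (fun h => fluct h ^+ 2 + 4) [::])); last first.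
  by rewrite kexp_add kexp_cst// -[n.+1%:R]natr1 mulrDr mulr1 lerD2r.
apply: le_kexp => // u _; set h := u ++ _.
pose c := beta / D * (~~ unexcited m h)%:R.
have fS s : fluct (s :: h) = fluct h + ((dlev s)%:~R - c).
  rewrite /fluct lev_cons /= intrD natrD -natr1 /c; case: unexcited => /=; ring.
under eq_bigr => s _ do rewrite fS sqrrD 2!mulrDr.
rewrite 2!big_split /= -mulr_suml kK.2 mul1r.
have -> : \sum_s k h s * (fluct h * ((dlev s)%:~R - c) *+ 2) = 0.
  transitivity (\sum_s (fluct h *+ 2 * (k h s * (dlev s)%:~R) - fluct h *+ 2 * c * k h s)).
    by apply: eq_bigr => s _; ring.
  by rewrite sumrB -!mulr_sumr mean_dlev kK.2 mulr1 subrr.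
rewrite addr0 lerD2l; apply: (@le_trans _ _ (\sum_s k h s * 4)); last by rewrite -mulr_suml kK.2 mul1r.
apply: ler_sum => s _; apply: ler_wpM2l; first exact: kK.1.
have dl : `|(dlev s)%:~R| <= 1 :> R by rewrite -intr_norm lerz1 dlev_norm.
have D1 : 1 <= D by rewrite /D ler1n.
have cb : 0 <= c <= 1.
  case/andP: beta01 => b0 b1; rewrite /c; case: unexcited => /=; rewrite ?mulr0 ?mulr1 ?lexx ?ler01//.
  have D0 : 0 < D := lt_le_trans ltr01 D1.
  by rewrite (divr_ge0 b0 (ltW D0))/= ler_pdivrMr// mul1r (le_trans b1).
move: dl; rewrite ler_norml => /andP[d1 d2]; case/andP: cb => c0 c1.
have a1 : -2 <= (dlev s)%:~R - c :> R by lra.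
have a2 : (dlev s)%:~R - c <= 2 :> R by lra.
by move: (_ - c) a1 a2 => x a1 a2; nra.
Qed.

Lemma fluct_small (eps : R) : 0 < eps -> exists n0, forall n, (n0 <= n)%N ->
  kexp k n (fun h => `|fluct h|) [::] <= eps * n%:R.
Proof.
move=> e0; exists (Num.bound (4 / eps ^+ 2)).+1 => n nn.
have n0 : 0 < n%:R :> R by rewrite ltr0n; lia.
have hb : 4 <= n%:R * eps ^+ 2.
  rewrite -ler_pdivrMr ?exprn_gt0//; apply: ltW; apply: lt_le_trans (archi_boundP _) _.
    by rewrite divr_ge0// exprn_ge0// ltW.
  by rewrite ler_nat ltnW.
(* With [E = eps * n], the inequality [|x| <= x ^ 2 / (2 E) + E / 2] controls the first moment by
   the second. *)
apply: (@le_trans _ _ (kexp k n (fun h => (2 * (eps * n%:R))^-1 * fluct h ^+ 2 + eps * n%:R / 2) [::])).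
  apply: le_kexp => // u _; have en0 : 0 < eps * n%:R by rewrite mulr_gt0.
  move: (eps * n%:R) en0 => E E0; rewrite -[fluct _ ^+ 2]real_normK ?num_real//.
  move: `|_| => x; rewrite -(ler_pM2l (x := 2 * E)) ?mulr_gt0// mulrDr mulrA divff ?mul1r; last by lra.
  by have := sqr_ge0 (x - E); nra.
rewrite kexp_lin kexp_cst//.
apply: (@le_trans _ _ ((2 * (eps * n%:R))^-1 * (4 * n%:R) + eps * n%:R / 2)).
  by rewrite lerD2r ler_wpM2l ?fluct_sqr// invr_ge0 ?mulr_ge0 ?(ltW e0).
rewrite (_ : (2 * (eps * n%:R))^-1 * (4 * n%:R) = 2 / eps); last by field; rewrite !gt_eqF.
suff : 2 / eps <= eps * n%:R / 2 by lra.
by rewrite ler_pdivrMr//; nra.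
Qed.

(** The number of unexcited steps differs from its candidate value by a multiple of the difference
    between the martingale [fluct] and [lev h - v * size h], both negligible in mean. *)
Lemma excitation_small (v : R) : 0 < beta ->
  (forall eps : R, 0 < eps -> exists n0, forall n, (n0 <= n)%N ->
     kexp k n (fun h => `|(lev h)%:~R - v * (size h)%:R|) [::] <= eps * n%:R) ->
  forall eps : R, 0 < eps -> exists n0, forall n, (n0 <= n)%N ->
  kexp k n (fun h => `|(nunexc m h)%:R - (1 - D * v / beta) * (size h)%:R|) [::] <= eps * n%:R.
Proof.
move=> b0 hv eps e0; have D0 : 0 < D by rewrite ltr0n.
have e' : 0 < eps * beta / D / 2 by rewrite !divr_gt0// mulr_gt0.
have [n1 h1] := hv _ e'; have [n2 h2] := fluct_small e'.
exists (maxn n1 n2) => n; rewrite geq_max => /andP[/h1 {}h1 /h2 {}h2].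
apply: (@le_trans _ _ (D / beta * (eps * beta / D / 2 * n%:R + eps * beta / D / 2 * n%:R))); last first.
  by rewrite le_eqVlt; apply/orP; left; apply/eqP; field; rewrite !gt_eqF.
apply: le_trans (ler_wpM2l _ (lerD h2 h1)); last by rewrite divr_ge0 ?ltW.
rewrite -kexp_add -kexpZ; apply: le_kexp => // u _.
have -> : (nunexc m (u ++ [::]))%:R - (1 - D * v / beta) * (size (u ++ [::]))%:R =
   D / beta * (fluct (u ++ [::]) - ((lev (u ++ [::]))%:~R - v * (size (u ++ [::]))%:R)).
  by rewrite /fluct; field; rewrite !gt_eqF.
rewrite normrM ger0_norm ?divr_ge0 ?(ltW D0) ?(ltW b0)// ler_wpM2l ?divr_ge0 ?(ltW D0) ?(ltW b0)//.
exact: ler_normB.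
Qed.

End SpeedToExcitation.

(** * Dependence on the bias and monotonicity of the speed *)

Section Derivative.
Context (R : realType) (d : nat).
Variable m : option nat.
Implicit Types (h : history d) (f : history d -> R) (s : step d).

(** For a fixed number of steps, expectations are polynomials in the bias, so
    that the mean value theorem applies to them. *)
Definition erw_poly h s : {poly R} :=
  (if s.1 == ord0 then 1 + ((-1) ^+ s.2 * (excited m (nvis h))%:R) *: 'X else 1)
   * ((2 * d.+1)%:R^-1)%:P.

Definition pexp n f h : {poly R} :=
  iter n (fun (f0 : history d -> {poly R}) h0 => \sum_s erw_poly h0 s * f0 (s :: h0))
    (fun h0 => (f h0)%:P) h.

Lemma pexpS n f h : pexp n.+1 f h = \sum_s erw_poly h s * pexp n f (s :: h).
Proof. by []. Qed.

Lemma deriv_bigsum (I : Type) (r : seq I) (P : pred I) (F : I -> {poly R}) :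
  (\sum_(i <- r | P i) F i)^`() = \sum_(i <- r | P i) (F i)^`().
Proof. exact: raddf_sum. Qed.

Lemma erw_polyE beta h s : (erw_poly h s).[beta] = erw m beta h s.
Proof.
rewrite /erw_poly erwE hornerM hornerC; congr (_ / _).
by case: ifP => _; rewrite !hornerE//=; ring.
Qed.

Lemma pexpE beta n f h : (pexp n f h).[beta] = kexp (erw m beta) n f h.
Proof.
elim: n h => [|n IH] h; first by rewrite hornerC.
rewrite pexpS horner_sum kexpS; apply: eq_bigr => s _.
by rewrite hornerM erw_polyE IH.
Qed.

Variables (beta beta1 : R).
Hypotheses (beta_ge0 : 0 <= beta) (beta_le : beta <= beta1) (beta1_lt1 : beta1 < 1).

Let beta01 : 0 <= beta <= 1.
Proof. by rewrite beta_ge0 (le_trans beta_le) ?ltW. Qed.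

(** The derivative of [1 + beta] or [1 - beta] has absolute value one, and both factors are at least
    [1 - beta1]. *)
Lemma deriv_erw_poly h s : `|(erw_poly h s)^`().[beta]| <= (1 - beta1)^-1 * erw m beta h s.
Proof.
have q0 : 0 < 1 - beta1 by rewrite subr_gt0.
have k0 : 0 <= erw m beta h s by apply: (erw_kernel d m beta01).1.
rewrite /erw_poly; move: k0; rewrite erwE; set D := (2 * d.+1)%:R : R.
have D0 : 0 < D by rewrite ltr0n.
case: ifP => _; last first.
  move=> k0; rewrite derivM !derivC mulr0 mul0r addr0 horner0 normr0.
  by apply: mulr_ge0 => //; rewrite invr_ge0 ltW.
move=> k0; rewrite derivM derivC mulr0 addr0 derivD derivC add0r derivZ derivX.
rewrite hornerM hornerC hornerZ hornerC mulr1 normrM [`|D^-1|]ger0_norm ?invr_ge0 ?(ltW D0)// mulrA.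
rewrite ler_pM2r ?invr_gt0// -ler_pdivrMl ?invr_gt0// invrK.
case: excited; rewrite ?mulr0 ?normr0 ?mulr0 ?mulr1.
  rewrite normrX normrN1 expr1n mulr1 lerD2l; case: (s.2) => /=.
    by rewrite mulN1r lerN2.
  by rewrite mul1r (@le_trans _ _ 0)// oppr_le0 (le_trans beta_ge0).
by rewrite addr0.
Qed.

Lemma deriv_pexp n f h : (forall u, 0 <= f u) ->
  `|(pexp n f h)^`().[beta]| <= n%:R / (1 - beta1) * kexp (erw m beta) n f h.
Proof.
move=> f0; have q0 : 0 < 1 - beta1 by rewrite subr_gt0.
have kK := erw_kernel d m beta01.
elim: n h => [|n IH] h; first by rewrite derivC horner0 normr0 !mul0r.
rewrite pexpS deriv_bigsum horner_sum kexpS mulr_sumr.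
apply: le_trans (ler_norm_sum _ _ _) _; apply: ler_sum => s _.
rewrite derivM hornerD [(_^`() * _).[_]]hornerM [(_ * _^`()).[_]]hornerM erw_polyE pexpE.
apply: le_trans (ler_normD _ _) _.
rewrite [`|erw _ _ _ _ * _|]normrM [`|_ * kexp _ _ _ _|]normrM.
have E0 : 0 <= kexp (erw m beta) n f (s :: h) by apply: kexp_ge0.
have k0 : 0 <= erw m beta h s by apply: kK.1.
rewrite -[n.+1%:R]natr1 !mulrDl addrC; apply: lerD.
  rewrite [leRHS]mulrCA (ger0_norm k0); exact: ler_wpM2l.
rewrite (ger0_norm E0) div1r mulrA; apply: ler_wpM2r => //.
exact: deriv_erw_poly.
Qed.

End Derivative.

Section BlockLipschitz.
Context (R : realType) (d : nat).
Variable m : option nat.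

Lemma blockseq_lipschitz (f : history d -> R) K (beta0 beta1 beta beta' L : R) :
  (forall u, 0 <= f u) -> 0 <= beta0 -> beta0 <= beta -> beta <= beta' -> beta' <= beta1 -> beta1 < 1 ->
  (forall xi, beta0 <= xi <= beta1 -> \sum_(i < K) i%:R * blockseq m xi f i <= L) ->
  `|\sum_(i < K) blockseq m beta' f i - \sum_(i < K) blockseq m beta f i| <=
  L / (1 - beta1) * (beta' - beta).
Proof.
move=> f0 b00 b0 bb b1 b11 HL.
pose bf u := (block u)%:R * f u.
have bf0 u : 0 <= bf u by rewrite mulr_ge0.
pose F : {poly R} := \sum_(i < K) ((0 < i)%:R)%:P * pexp m i bf [::].
have FE xi : F.[xi] = \sum_(i < K) blockseq m xi f i.
  by rewrite horner_sum; apply: eq_bigr => i _; rewrite hornerM hornerC pexpE.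
rewrite -!FE; have [->|nb] := eqVneq beta beta'; first by rewrite !subrr normr0 mulr0.
have lt_bb : beta < beta' by rewrite lt_neqAle nb.
have [c cb ->] := poly_mvt F lt_bb.
rewrite normrM [`|beta' - _|]ger0_norm ?subr_ge0// ler_wpM2r ?subr_ge0//.
move: cb; rewrite in_itv /= => /andP[c1 c2].
have cc : beta0 <= c <= beta1 by rewrite (le_trans b0 (ltW c1)) (le_trans (ltW c2) b1).
rewrite deriv_bigsum horner_sum; apply: le_trans (ler_norm_sum _ _ _) _.
rewrite ler_pdivlMr ?subr_gt0// mulr_suml; apply: le_trans (HL c cc).
apply: ler_sum => i _; rewrite derivM derivC mul0r add0r hornerM hornerC /blockseq.
rewrite normrM ger0_norm//; case: (0 < i)%N; last by rewrite !mul0r mulr0.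
rewrite !mul1r -ler_pdivlMr ?subr_gt0// mulrAC.
by apply: deriv_pexp => //; [rewrite (le_trans b00)//|]; case/andP: cc.
Qed.

End BlockLipschitz.

Section SpeedMonotone.
Context (R : realType) (d : nat).
Hypothesis d3 : (3 <= d)%N.
Variables beta0 beta1 : R.
Hypotheses (beta0_gt0 : 0 < beta0) (beta01 : beta0 < beta1) (beta1_lt1 : beta1 < 1).
Let D : R := d.+1%:R.
Local Notation adm := (admissible d beta0).
Local Notation len := (fun h : history d => (size h)%:R : R).
Local Notation exc m := (fun h : history d => (nunexc (Some m) h)%:R : R).

Let beta0_le1 : beta0 <= 1. Proof. by rewrite ltW// (lt_trans beta01). Qed.

Lemma blockseq_ge0 m beta (f : history d -> R) i : adm m beta -> (forall u, 0 <= f u) ->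
  0 <= blockseq (Some m) beta f i.
Proof.
move=> ad f0; apply: mulr_ge0 => //; apply: kexp_ge0 => [|u _]; last by rewrite mulr_ge0.
exact: erw_kernel (admissible01 beta0_gt0 ad).
Qed.

Lemma blockseq_lin m beta (hs : R) i :
  blockseq (Some m) beta (fun h => exc m h - hs * len h) i =
  blockseq (Some m) beta (exc m) i - hs * blockseq (Some m) beta len i.
Proof.
rewrite /blockseq [X in _ = _ - X]mulrCA -mulrBr -(kexpZ _ _ hs) -kexp_sub; congr (_ * _).
by apply: eq_kexp => u _; ring.
Qed.

(** A single step [+e_1] is a block. This bounds the mean block length from below, uniformly in [m]
    and in the bias. *)
Lemma blockseq_len1 m beta : adm m beta ->
  (2 * D)^-1 <= blockseq (Some m) beta len 1.
Proof.
move=> ad; have b01 := admissible01 beta0_gt0 ad; have kK := erw_kernel d (Some m) b01.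
rewrite /blockseq mul1r kexpS.
apply: le_trans (_ : _ <= erw (Some m) beta ([::] : history d) (ord0, false) * 1) _.
  rewrite mulr1 erwE natrM -/D /=.
  rewrite ler_peMl ?invr_ge0 ?mulr_ge0//.
  by rewrite expr0 mul1r lerDl mulr_ge0//; case/andP: b01.
rewrite (bigD1 (ord0, false))//= -[leLHS]addr0 lerD//; last first.
  by apply: sumr_ge0 => s _; apply: mulr_ge0; [exact: kK.1|rewrite kexp0 mulr_ge0].
apply: ler_wpM2l; first exact: kK.1.
rewrite kexp0 /= mulr1.
rewrite (_ : block _ = true)// /block /stay /free /newmax /=.
by rewrite !lev_cons lev_nil /dlev eqxx.
Qed.

Lemma sum_len_le : exists2 C, 0 < C & forall m beta K, adm m beta ->
  \sum_(i < K) i%:R * blockseq (Some m) beta len i <= C.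
Proof.
have [C C0 hC] := norenewal_tail d3 beta0_gt0 beta0_le1.
exists (2 * C) => [|m beta K ad]; first by rewrite mulr_gt0.
apply: (@le_trans _ _ (\sum_(i < K) C * (i.+1%:R ^+ 2)^-1)).
  apply: ler_sum => i _.
  apply: le_trans (ler_wpM2l _ (le_trans (ler_norm _)
    (blockseq_bound beta0_gt0 ad (ltW C0) (fun t => hC m beta t ad) (c := i%:R) _))) _ => //.
    by move=> u su; rewrite su ger0_norm.
  rewrite mulrCA mulrA mulrC -!mulrA ler_pM2l//.
  rewrite mulrC ler_pdivrMr ?exprn_gt0 ?ltr0n// -expr2.
  rewrite -[4%N]/(2 + 2)%N exprD mulKf ?expf_neq0 ?pnatr_eq0//.
  by rewrite lerXn2r ?nnegrE// ler_nat.
rewrite -mulr_sumr mulrC ler_pM2r//.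
case: K => [|K]; first by rewrite big_ord0.
rewrite -(big_mkord xpredT (fun i : nat => (i.+1%:R ^+ 2)^-1 : R)) big_nat_recl// expr1n invr1.
rewrite -(big_add1 _ _ 0 K.+1 xpredT (fun j => (j.+1%:R ^+ 2)^-1)).
have [->|n0] := posnP K; first by rewrite big_geq//; lra.
by have := @sum_inv_sqr R 1 K.+1 isT isT; rewrite invr1; lra.
Qed.

(** Blocks of length at least [L] contribute at most [C / L], by a tail bound uniform in [m]. In a
    block of length [i < L], each step is unexcited with probability at most [3 hk / (m + 1)], so
    the shorter blocks contribute at most [L ^ 3] times this, which a large [m] makes small. *)
Lemma sum_exc_small (eta : R) : 0 < eta -> exists m0 : nat, forall m beta K,
  (m0 <= m)%N -> adm m beta ->
  \sum_(i < K) i%:R * blockseq (Some m) beta (exc m) i <= eta.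
Proof.
move=> eta0; have [C C0 hC] := norenewal_tail d3 beta0_gt0 beta0_le1.
have hk0 : 0 <= hk R d by rewrite sqrtr_ge0.
pose L := (Num.bound (2 * C / eta)).+1.
have LC : C / L%:R <= eta / 2.
  rewrite ler_pdivrMr ?ltr0n//.
  have : 2 * C / eta <= L%:R.
    apply: ltW; apply: lt_le_trans (archi_boundP _) _; last by rewrite ler_nat.
    by rewrite divr_ge0 ?mulr_ge0// ltW.
  by rewrite ler_pdivrMr//; lra.
pose m0 := Num.bound (L%:R ^+ 3 * (3 * hk R d) * 2 / eta).
exists m0 => m beta K mm ad.
have b01 := admissible01 beta0_gt0 ad; have kK := erw_kernel d (Some m) b01.
have term i : i%:R * blockseq (Some m) beta (exc m) i <=
    (if (i < L)%N then L%:R ^+ 2 * (3 * hk R d / m.+1%:R) else 0)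
    + (if (L <= i)%N then C * (i.+1%:R ^+ 2)^-1 else 0).
  case: ltnP => iL; rewrite ?addr0 ?add0r.
    have : blockseq (Some m) beta (exc m) i <= i%:R * (3 * hk R d / m.+1%:R).
      apply: (@le_trans _ _ (kexp (erw (Some m) beta) i (exc m) [::])).
        rewrite /blockseq; apply: (@le_trans _ _ (1 *
          kexp (erw (Some m) beta) i (fun u : history d => (block u)%:R * exc m u) [::])).
          apply: ler_wpM2r; last by case: (0 < i)%N.
          by apply: kexp_ge0 => // u _; rewrite mulr_ge0.
        rewrite mul1r; apply: le_kexp => // u _; rewrite ler_piMl//.
        by case: block.
      rewrite kexp_nunexc// add0r; apply: (@le_trans _ _ (\sum_(0 <= j < i) 3 * hk R d / m.+1%:R)).
        apply: ler_sum => j _; apply: le_trans (unexc_prob d3 m b01 j [::]) _.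
        by rewrite mul0r addr0.
      by rewrite sumr_const_nat subn0 -[leLHS]mulr_natl.
    move=> /(ler_wpM2l (ler0n _ i)) /le_trans; apply; rewrite [leLHS]mulrA -expr2.
    apply: ler_wpM2r; first by rewrite divr_ge0// mulr_ge0.
    by rewrite lerXn2r ?nnegrE// ler_nat ltnW.
  apply: le_trans (ler_wpM2l _ (le_trans (ler_norm _)
    (blockseq_bound beta0_gt0 ad (ltW C0) (fun t => hC m beta t ad) (c := i%:R) _))) _ => //.
    by move=> u su; rewrite ger0_norm// ler_nat -su nunexc_le.
  rewrite mulrCA mulrA mulrC -!mulrA ler_pM2l//.
  rewrite mulrC ler_pdivrMr ?exprn_gt0 ?ltr0n// -expr2.
  rewrite -[4%N]/(2 + 2)%N exprD mulKf ?expf_neq0 ?pnatr_eq0//.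
  by rewrite lerXn2r ?nnegrE// ler_nat.
(* The range is enlarged so that the cut at [L] falls inside it. *)
apply: (@le_trans _ _ (\sum_(i < L + K) i%:R * blockseq (Some m) beta (exc m) i)).
  rewrite -!(big_mkord xpredT (fun i => i%:R * blockseq (Some m) beta (exc m) i)).
  rewrite [leRHS](@big_cat_nat _ _ _ K)//= ?leq_addl// lerDl.
  by apply: sumr_ge0 => i _; rewrite mulr_ge0// blockseq_ge0.
apply: (@le_trans _ _ (\sum_(i < L + K) ((if (i < L)%N then L%:R ^+ 2 * (3 * hk R d / m.+1%:R) else 0)
    + (if (L <= i)%N then C * (i.+1%:R ^+ 2)^-1 else 0)))).
  by apply: ler_sum => i _; exact: term.
rewrite big_split /= [eta]splitr; apply: lerD.
  rewrite -(big_mkord xpredT (fun i : nat => if (i < L)%N then L%:R ^+ 2 * (3 * hk R d / m.+1%:R) else 0)).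
  rewrite (@big_cat_nat _ _ _ L)//= ?leq_addr//.
  rewrite [X in _ + X]big_nat_cond [X in _ + X]big1 ?addr0 => [|i /andP[/andP[Li _] _]]; last first.
    by rewrite ltnNge Li.
  rewrite big_nat_cond; under eq_bigr => i /andP[/andP[_ iL] _] do rewrite iL.
  rewrite -big_nat_cond sumr_const_nat subn0 -[leLHS]mulr_natl mulrA -exprS mulrA.
  rewrite ler_pdivrMr ?ltr0n//.
  have : L%:R ^+ 3 * (3 * hk R d) * 2 / eta <= m.+1%:R.
    apply: ltW; apply: lt_le_trans (archi_boundP _) _; last by rewrite ler_nat leqW.
    apply: divr_ge0 (ltW eta0); apply: mulr_ge0 => //; apply: mulr_ge0; first by rewrite exprn_ge0.
    by rewrite mulr_ge0.
  by rewrite ler_pdivrMr//; lra.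
rewrite -(big_mkord xpredT (fun i : nat => if (L <= i)%N then C * (i.+1%:R ^+ 2)^-1 else 0)).
rewrite (@big_cat_nat _ _ _ L)//= ?leq_addr//.
rewrite [X in X + _]big_nat_cond [X in X + _]big1 ?add0r => [|i /andP[/andP[_ iL] _]]; last first.
  by rewrite leqNgt iL.
rewrite big_nat_cond; under eq_bigr => i /andP[/andP[Li _] _] do rewrite Li.
rewrite -big_nat_cond -mulr_sumr; apply: le_trans LC; rewrite ler_pM2l//.
by apply: sum_inv_sqr => //; rewrite leq_addr.
Qed.

Lemma sum_le_weighted m beta (f : history d -> R) K : adm m beta -> (forall u, 0 <= f u) ->
  \sum_(i < K) blockseq (Some m) beta f i <= \sum_(i < K) i%:R * blockseq (Some m) beta f i.
Proof.
move=> ad f0; apply: ler_sum => -[[|i] ik] _ /=; first by rewrite blockseq0 mulr0.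
by rewrite ler_peMl ?ler1n// blockseq_ge0.
Qed.

Lemma speed_monotone : exists m0 : nat, forall m : nat, (m0 <= m)%N ->
  forall v : R -> R,
  (forall beta, beta0 <= beta <= beta1 -> forall eps : R, 0 < eps ->
     exists n0, forall n, (n0 <= n)%N ->
     kexp (erw (Some m) beta) n (fun h : history d => `|(lev h)%:~R - v beta * (size h)%:R|) [::]
       <= eps * n%:R) ->
  forall beta beta', beta0 <= beta -> beta <= beta' -> beta' <= beta1 -> v beta <= v beta'.
Proof.
have [C C0 hC] := sum_len_le.
have D0 : 0 < D by rewrite ltr0n.
pose kap : R := (2 * D)^-1; have kap0 : 0 < kap by rewrite invr_gt0 mulr_gt0.
pose c : R := (1 - beta1)^-1; have c0 : 0 < c by rewrite invr_gt0 subr_gt0.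
(* [D * (v beta' - v beta)] equals [Del * (1 - hs beta') - beta * (hs beta' - hs beta)]. If the
   weighted sums of unexcited steps are at most [eta], then [hs] is at most [eta / kap] and
   increases by at most [eta * c / kap * (1 + C / kap) * Del]: the difference is nonnegative as soon
   as [eta * W <= 1]. *)
pose W : R := kap^-1 + c / kap * (1 + C / kap).
have W0 : 0 < W.
  by rewrite addr_gt0 ?invr_gt0// mulr_gt0 ?divr_gt0// addr_gt0// divr_gt0.
have Winv : 0 < W^-1 by rewrite invr_gt0.
have [m1 hm1] := sum_exc_small Winv.
pose m2 := Num.bound (12 * hk R d).
have hk0 : 0 <= hk R d by rewrite sqrtr_ge0.
exists (maxn m1 m2) => m; rewrite geq_max => /andP[mm1 mm2] v hv beta beta' b0 bb b1.
have ad xi : beta0 <= xi <= beta1 -> adm m xi.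
  move=> /andP[x0 x1]; split=> //; last by rewrite ltW// (le_lt_trans x1).
  apply: ltW; apply: lt_le_trans (archi_boundP _) _; first by rewrite mulr_ge0.
  by rewrite ler_nat leqW.
have bI : beta0 <= beta <= beta1 by rewrite b0 (le_trans bb).
have bI' : beta0 <= beta' <= beta1 by rewrite b1 (le_trans b0).
pose hs xi : R := 1 - D * v xi / xi.
pose eta : R := W^-1; have eta0 : 0 < eta by rewrite invr_gt0.
pose N xi K : R := \sum_(i < K) blockseq (Some m) xi (exc m) i.
pose mu xi K : R := \sum_(i < K) blockseq (Some m) xi len i.
have near xi eps : beta0 <= xi <= beta1 -> 0 < eps -> exists n0, forall n, (n0 <= n)%N ->
    `|N xi n.+1 - hs xi * mu xi n.+1| <= eps.
  move=> xI eps0; have xi0 : 0 < xi by case/andP: xI => /(lt_le_trans beta0_gt0).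
  have ax := ad xi xI; have x01 := admissible01 beta0_gt0 ax.
  have sm := excitation_small x01 xi0 (hv xi xI).
  have [n0 hn0] := block_mean d3 beta0_gt0 beta0_le1 ax sm eps0.
  exists n0 => n /hn0; rewrite /N /mu mulr_sumr -sumrB.
  by under eq_bigr => i _ do rewrite blockseq_lin.
have Nle xi K : beta0 <= xi <= beta1 -> 0 <= N xi K <= eta.
  move=> xI; rewrite sumr_ge0/= => [|i _]; last by rewrite blockseq_ge0//; exact: ad.
  by apply: le_trans (sum_le_weighted _ (ad xi xI) _) (hm1 _ _ K mm1 (ad xi xI)).
have muge xi K : beta0 <= xi <= beta1 -> kap <= mu xi K.+2.
  move=> xI; rewrite /mu big_ord_recl blockseq0 add0r big_ord_recl.
  apply: le_trans (blockseq_len1 (ad xi xI)) _; rewrite lerDl sumr_ge0// => i _.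
  by rewrite blockseq_ge0//; exact: ad.
have Nlip K : `|N beta' K - N beta K| <= eta * c * (beta' - beta).
  apply: (@blockseq_lipschitz R d (Some m) (exc m) K beta0 beta1 beta beta' eta) => // [|xi xI].
    exact: ltW.
  exact: hm1 _ _ K mm1 (ad xi xI).
have mulip K : `|mu beta' K - mu beta K| <= C * c * (beta' - beta).
  apply: (@blockseq_lipschitz R d (Some m) len K beta0 beta1 beta beta' C) => // [|xi xI].
    exact: ltW.
  exact: hC (ad xi xI).
have hsle eps xi : beta0 <= xi <= beta1 -> 0 < eps -> `|hs xi| * kap <= eta + eps.
  move=> xI e0; have [n0 /(_ n0.+1)] := near xi eps xI e0; rewrite leqnSn => /(_ isT) hn.
  apply: (@le_trans _ _ (`|hs xi| * mu xi n0.+2)); first by rewrite ler_wpM2l// muge.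
  have mu0 : 0 <= mu xi n0.+2 by rewrite (le_trans (ltW kap0))// muge.
  rewrite -[mu _ _]ger0_norm// -normrM.
  case/andP: (Nle xi n0.+2 xI) => N0 N1.
  move: hn; rewrite ler_norml => /andP[a1 a2]; rewrite ler_norml; apply/andP; split; lra.
have hsle' xi : beta0 <= xi <= beta1 -> `|hs xi| <= eta / kap.
  move=> xI; rewrite ler_pdivlMr//; apply/ler_addgt0Pr => eps e0; exact: hsle.
set Del := beta' - beta; have Del0 : 0 <= Del by rewrite subr_ge0.
have hdiff : hs beta' - hs beta <= eta * c / kap * (1 + C / kap) * Del.
  have X0 : 0 <= eta * c * (1 + C / kap) * Del.
    by rewrite !mulr_ge0 ?(ltW eta0) ?(ltW c0)// addr_ge0// divr_ge0 ?(ltW C0) ?(ltW kap0).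
  rewrite [leRHS](_ : _ = eta * c * (1 + C / kap) * Del / kap); last by ring.
  (* A positive increment may be multiplied by the mean length at [beta'], which is at least [kap];
     this replaces quotients by block sums. *)
  have [neg|pos] := leP (hs beta' - hs beta) 0.
    by apply: le_trans neg _; rewrite divr_ge0// ltW.
  rewrite ler_pdivlMr//; apply/ler_addgt0Pr => eps e0.
  have e2 : 0 < eps / 2 by rewrite divr_gt0.
  have [n1 h1] := near beta (eps / 2) bI e2; have [n2 h2] := near beta' (eps / 2) bI' e2.
  pose K := maxn n1 n2; have {}h1 := h1 K.+1 (leqW (leq_maxl _ _)).
  have {}h2 := h2 K.+1 (leqW (leq_maxr _ _)).
  have lN := Nlip K.+2; have lm := mulip K.+2; have hb := hsle' beta bI.
  apply: le_trans (_ : _ <= (hs beta' - hs beta) * mu beta' K.+2) _.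
    by rewrite ler_pM2l// muge.
  move: h1 h2 lN lm; set N1 := N beta _; set N2 := N beta' _; set u1 := mu beta _; set u2 := mu beta' _.
  move=> h1 h2 lN lm.
  (* Both remainders [N - hs * mu] are below [eps / 2]. The rest is the increment of [N] and that of
     [mu] weighted by the small factor [hs beta]. *)
  rewrite (_ : (hs beta' - hs beta) * u2 = - (N2 - hs beta' * u2) + (N2 - N1) + (N1 - hs beta * u1)
     - hs beta * (u2 - u1)); last by ring.
  have t4 : - (hs beta * (u2 - u1)) <= eta / kap * (C * c * Del).
    by apply: le_trans (ler_norm _) _; rewrite normrN normrM; apply: ler_pM.
  have t1 : - (N2 - hs beta' * u2) <= eps / 2 by apply: le_trans (ler_norm _) _; rewrite normrN.
  have t2 : N1 - hs beta * u1 <= eps / 2 by apply: le_trans (ler_norm _) _.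
  have t3 : N2 - N1 <= eta * c * Del by apply: le_trans (ler_norm _) _.
  have -> : eta * c * (1 + C / kap) * Del = eta * c * Del + eta / kap * (C * c * Del) by ring.
  lra.
have b_gt0 : 0 < beta := lt_le_trans beta0_gt0 b0.
have b'_gt0 : 0 < beta' := lt_le_trans b_gt0 bb.
have vE xi : 0 < xi -> v xi = xi / D * (1 - hs xi).
  by move=> x0; rewrite /hs; field; rewrite !gt_eqF.
rewrite (vE _ b_gt0) (vE _ b'_gt0) -subr_ge0.
rewrite (_ : _ - _ = D^-1 * (Del * (1 - hs beta') - beta * (hs beta' - hs beta))); last by rewrite /Del; ring.
apply: mulr_ge0; first by rewrite invr_ge0 ltW.
have h1 : hs beta' <= eta / kap by apply: le_trans (ler_norm _) (hsle' _ bI').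
have bl1 : beta <= 1 by rewrite (le_trans bb)// (le_trans b1)// ltW.
have X0 : 0 <= eta * c / kap * (1 + C / kap) * Del.
  apply: mulr_ge0 => //; apply: mulr_ge0.
    by rewrite divr_ge0 ?mulr_ge0 ?(ltW eta0) ?(ltW c0) ?(ltW kap0).
  by rewrite addr_ge0// divr_ge0 ?(ltW C0) ?(ltW kap0).
have h2 : beta * (hs beta' - hs beta) <= eta * c / kap * (1 + C / kap) * Del.
  apply: le_trans (ler_wpM2l (ltW b_gt0) hdiff) _; exact: ler_piMl.
have h3 : Del * (hs beta') <= Del * (eta / kap) by rewrite ler_wpM2l.
have : eta * W = 1 by rewrite mulVf// gt_eqF.
rewrite /W => hW.
have -> : Del * (1 - hs beta') = Del * (eta * (kap^-1 + c / kap * (1 + C / kap))) - Del * hs beta'.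
  by rewrite hW; ring.
rewrite subr_ge0; apply: le_trans h2 _; rewrite lerBrDr.
apply: le_trans (lerD (lexx _) h3) _; rewrite le_eqVlt; apply/orP; left; apply/eqP; ring.
Qed.

End SpeedMonotone.

(** * Expectations of trajectories under the law of the walk *)

Section Cylinders.
Context (disp : measure_display) (T : measurableType disp) (d : nat).
Variable Y : nat -> T -> 'rV[int]_d.+1.
Implicit Types (h u : history d).

Fixpoint cyl h : set T :=
  (if h is _ :: h' then cyl h' else setT) `&` (Y (size h) @^-1` [set pos h]).

Lemma cylP h w : cyl h w -> forall j, (j <= size h)%N -> Y (size h - j)%N w = pos (drop j h).
Proof.
elim: h => [|s h IH] /=; first by move=> [_ yw] [|j].
by move=> [/IH ch yw] [|j] //= jh; rewrite subSS ch.
Qed.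

Lemma cyl_last h w : cyl h w -> Y (size h) w = pos h.
Proof. by move=> /cylP/(_ 0%N isT); rewrite subn0 drop0. Qed.

Lemma cyl_filtration h : natural_filtration Y (size h) (cyl h).
Proof.
elim: h => [|s h IH] /=.
  by rewrite setTI; apply: sub_sigma_algebra; exists 0%N, [set pos [::]].
apply: (@measurableI _ (g_sigma_algebraType _)).
  apply: sub_sigma_algebra2 IH => A [i [B [ih ->]]].
  by exists i, B; split=> //; apply: leqW.
by apply: sub_sigma_algebra; exists (size h).+1, [set pos (s :: h)].
Qed.

Lemma visits_cyl h w : cyl h w -> visits Y (size h) w = nvis h.
Proof.
move=> ch; rewrite /visits /nvis hitsE -sum1_count big_mkcond.
rewrite -[iota 0 _]/(index_iota 0 (size h).+1) big_nat_rev /= add0n.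
apply: eq_big_nat => j /andP[_ jh].
have cj : Y (size h - j)%N w = pos (drop j h) by apply: (cylP ch); rewrite -ltnS.
by rewrite subSS cj (cyl_last ch); case: eqP.
Qed.

Lemma cyl_cons s h : cyl (s :: h) =
  [set w | Y (size h).+1 w - Y (size h) w = unit_step s.1 s.2] `&` cyl h.
Proof.
apply/seteqP; split=> w /=.
  by move=> [ch ->]; split=> //; rewrite (cyl_last ch) pos_cons addrK.
by move=> [ys ch]; split=> //; rewrite pos_cons -ys (cyl_last ch) subrK.
Qed.

Lemma cyl_cons_sub s h : cyl (s :: h) `<=` cyl h.
Proof. by move=> w /= []. Qed.

Lemma pos_cons_inj s s' h : pos (s :: h) = pos (s' :: h) -> s = s'.
Proof.
rewrite !pos_cons => /addIr e; case: s e => i b; case: s' => i' b' /= e.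
have ei j : unit_step i b 0 j = unit_step i' b' 0 j by rewrite e.
have ii' : i = i'.
  have := ei i; rewrite !unit_stepE eqxx; case: eqP => // _.
  by move/eqP; rewrite expf_eq0 oppr_eq0 oner_eq0 andbF.
rewrite -ii' in e ei *; have := ei i; rewrite !unit_stepE eqxx.
by case: b {e ei}; case: b'.
Qed.

Lemma trivIset_cyl_cons h (A : set (step d)) : trivIset A (fun s => cyl (s :: h)).
Proof.
move=> s s' _ _ [w [[_ ys] [_ ys']]]; apply: (@pos_cons_inj _ _ h).
by rewrite -ys -ys'.
Qed.

Definition traj n (w : T) : seq 'rV[int]_d.+1 := [seq Y i w | i <- iota 0 n].

Lemma trajS n w : traj n.+1 w = rcons (traj n w) (Y n w).
Proof. by rewrite /traj -[n.+1]addn1 iotaD map_cat cats1. Qed.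

Lemma traj_cyl h w : cyl h w -> 
  traj (size h).+1 w = rev [seq pos (drop j h) | j <- iota 0 (size h).+1].
Proof.
move=> ch; apply: (@eq_from_nth _ 0) => [|i]; rewrite size_map size_iota.
  by rewrite size_rev size_map size_iota.
move=> ih; rewrite (nth_map 0%N) ?size_iota// nth_iota// add0n.
rewrite nth_rev ?size_map ?size_iota// (nth_map 0%N) ?size_iota; last by lia.
rewrite nth_iota; last by lia.
rewrite add0n subSS -(cylP ch); last by lia.
by congr (Y _ w); lia.
Qed.

End Cylinders.

Section Trajectories.
Context (disp : measure_display) (T : measurableType disp) (R : realType) (d : nat).
Variables (P : probability T R) (Y : nat -> T -> 'rV[int]_d.+1) (m : option nat) (beta : R).
Hypothesis hY : excited_random_walk P Y m beta.
Hypothesis beta01 : 0 <= beta <= 1.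
Implicit Types (h u : history d).
Local Notation k := (erw (d := d) m beta).
Local Notation cyl := (cyl Y).
Local Notation traj := (traj Y).
Let kK : is_kernel k := erw_kernel d m beta01.

Lemma measurable_Y n B : measurable (Y n @^-1` B).
Proof. by case: hY => mY _ _; apply: mY. Qed.

Lemma measurable_cyl h : measurable (cyl h).
Proof.
elim: h => [|s h IH] /=; first by rewrite setTI; exact: measurable_Y.
by apply: measurableI => //; exact: measurable_Y.
Qed.

Lemma prob_cyl_cons s h : P (cyl (s :: h)) = ((k h s)%:E * P (cyl h))%E.
Proof.
have [_ _ /(_ (size h) s.1 s.2) [_ _ /(_ _ (@cyl_filtration _ _ _ Y h))]] := hY.
rewrite -cyl_cons => ->; rewrite -integral_cst; last exact: measurable_cyl.
by apply: eq_integral => w; rewrite inE => ch; rewrite visits_cyl.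
Qed.

(** That the next step is a unit vector holds only almost surely: it follows from the conditional
    probabilities of the unit steps adding up to one. *)
Lemma cyl_split_null h :
  P (cyl h `\` \big[setU/set0]_(s <- index_enum (step d)) cyl (s :: h)) = 0%E.
Proof.
set U := \big[setU/set0]_(s <- _) _.
have mU : measurable U by apply: bigsetU_measurable => s _; exact: measurable_cyl.
have Usub : U `<=` cyl h.
  rewrite /U; elim/big_ind: _ => [w []|A B hA hB w [/hA|/hB]//|s _].
  exact: cyl_cons_sub.
have PU : P U = P (cyl h).
  rewrite -[P U]mul1e -integral_cst//.
  rewrite ge0_integral_bigsetU//; first last.
  - exact: trivIset_cyl_cons.
  - exact: index_enum_uniq.
  - by move=> s; exact: measurable_cyl.
  transitivity (\sum_s ((k h s)%:E * P (cyl h)))%E.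
    apply: eq_bigr => s _; rewrite integral_cst; last exact: measurable_cyl.
    by rewrite mul1e; exact: prob_cyl_cons.
  rewrite -[P (cyl h)]fineK ?fin_num_measure//; last exact: measurable_cyl.
  under eq_bigr => s _ do rewrite -EFinM.
  by rewrite sumEFin -mulr_suml kK.2 mul1r.
rewrite measureD//; last 2 first.
- exact: measurable_cyl.
- by rewrite ltey_eq fin_num_measure//; exact: measurable_cyl.
rewrite setIidr//; transitivity (P (cyl h) - P (cyl h))%E.
  by congr (_ - _)%E; exact: PU.
by rewrite subee// fin_num_measure//; exact: measurable_cyl.
Qed.

Lemma integral_cyl n (f : history d -> R) (g : T -> R) h :
  measurable_fun setT g -> (forall w, 0 <= g w) ->
  (forall u w, size u = n -> cyl (u ++ h) w -> g w = f (u ++ h)) ->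
  (\int[P]_(w in cyl h) (g w)%:E)%E = ((kexp k n f h)%:E * P (cyl h))%E.
Proof.
move=> mg g0; elim: n h => [|n IH] h gf.
  rewrite kexp0 -integral_cst; last exact: measurable_cyl.
  by apply: eq_integral => w; rewrite inE => ch; rewrite (gf [::]).
have mgE A : measurable A -> measurable_fun A (fun w => (g w)%:E).
  by move=> mA; apply/measurable_EFinP; apply: measurable_funTS.
set U := \big[setU/set0]_(s <- index_enum (step d)) cyl (s :: h).
have mU : measurable U by apply: bigsetU_measurable => s _; exact: measurable_cyl.
have Usub : U `<=` cyl h.
  rewrite /U; elim/big_ind: _ => [w []|A B hA hB w [/hA|/hB]//|s _].
  exact: cyl_cons_sub.
have mC := measurable_cyl h; have mD : measurable (cyl h `\` U) by exact: measurableD.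
have gE0 w : cyl h w -> (0 <= (g w)%:E)%E by rewrite lee_fin.
rewrite (ge0_negligible_integral mD mC (mgE _ mC) gE0 (cyl_split_null h)).
rewrite setDD setIidr// /U ge0_integral_bigsetU//; first last.
- by move=> w _; rewrite lee_fin.
- exact: mgE.
- exact: trivIset_cyl_cons.
- exact: index_enum_uniq.
- by move=> s; exact: measurable_cyl.
rewrite -[P (cyl h)]fineK ?fin_num_measure//.
rewrite kexpS -EFinM mulr_suml -sumEFin; apply: eq_bigr => s _.
rewrite IH => [|u w su cu]; last first.
  by rewrite -cat_rcons; apply: gf; rewrite ?size_rcons ?su// cat_rcons.
rewrite prob_cyl_cons -[P (cyl h)]fineK ?fin_num_measure//.
by rewrite -!EFinM; congr (_%:E); rewrite /=; ring.
Qed.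

Lemma expectation_kexp n (f : history d -> R) (g : T -> R) :
  measurable_fun setT g -> (forall w, 0 <= g w) ->
  (forall h w, size h = n -> cyl h w -> g w = f h) ->
  (\int[P]_w (g w)%:E)%E = (kexp k n f [::])%:E.
Proof.
move=> mg g0 gf.
have mgE A : measurable A -> measurable_fun A (fun w => (g w)%:E).
  by move=> mA; apply/measurable_EFinP; apply: measurable_funTS.
have m0 := measurable_cyl [::].
have P0 : P (~` cyl [::]) = 0%E.
  have [_ Y0 _] := hY; apply/negligibleP; first exact: measurableC.
  have -> : ~` cyl [::] = ~` [set w | Y 0%N w = 0] by rewrite /= setTI pos_nil.
  exact: Y0.
have P1 : P (cyl [::]) = 1%E.
  have := probability_setC P (measurableC m0); rewrite setCK P0 sube0 => <-.
  by [].
rewrite (@ge0_negligible_integral _ _ _ P _ (~` cyl [::]))//; last 3 first.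
- exact: measurableC.
- exact: mgE.
- by move=> w _; rewrite lee_fin.
rewrite setDE setCK setTI (@integral_cyl n f g [::] mg g0) ?P1 ?mule1// => u w su.
by rewrite cats0 => cu; apply: gf.
Qed.

Lemma measurable_traj n (B : set (seq 'rV[int]_d.+1)) : measurable (traj n @^-1` B).
Proof.
have single t : measurable (traj n @^-1` [set t]).
  elim: n t => [|n IH] t.
    have [->|t0] := eqVneq t [::].
      by rewrite (_ : _ @^-1` _ = setT)//; apply/seteqP; split.
    by rewrite (_ : _ @^-1` _ = set0)//; apply/seteqP; split => w //= e; rewrite -e in t0.
  case/lastP: t => [|t x].
    by rewrite (_ : _ @^-1` _ = set0)//; apply/seteqP; split => w //=; rewrite trajS; case: (traj _ _).
  rewrite (_ : _ @^-1` _ = traj n @^-1` [set t] `&` Y n @^-1` [set x]).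
    by apply: measurableI => //; exact: measurable_Y.
  apply/seteqP; split=> w /=; rewrite trajS; first by move/rcons_inj => [-> ->].
  by move=> [-> ->].
rewrite (_ : _ @^-1` B = \bigcup_t (traj n @^-1` [set t] `&` [set w | B t])).
  apply: countable_bigcupT_measurable => // t; apply: measurableI => //.
  have [Bt|nBt] := pselect (B t).
    by rewrite (_ : [set _ | _] = setT)//; apply/seteqP; split.
  by rewrite (_ : [set _ | _] = set0)//; apply/seteqP; split.
apply/seteqP; split=> w /=; first by move=> Bw; exists (traj n w).
by move=> [t _ /= [-> ]].
Qed.

Lemma measurable_traj_fun n (G : seq 'rV[int]_d.+1 -> R) :
  measurable_fun setT (fun w => G (traj n w)).
Proof. by move=> _ B mB; rewrite setTI; exact: (@measurable_traj n (G @^-1` B)). Qed.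

Lemma measurable_Y_fun n (G : 'rV[int]_d.+1 -> R) :
  measurable_fun setT (fun w => G (Y n w)).
Proof. by move=> _ B mB; rewrite setTI; exact: (@measurable_Y n (G @^-1` B)). Qed.

(** Dominated convergence. Since [|Y n| <= n] may fail on a null set, the deviation is truncated at
    [1 + |v|]; on trajectories made of unit steps the truncation changes nothing. *)
Lemma speed_L1 (v : R) : is_speed P Y v ->
  forall eps : R, 0 < eps -> exists n0, forall n, (n0 <= n)%N ->
  kexp k n (fun h => `|(lev h)%:~R - v * (size h)%:R|) [::] <= eps * n%:R.
Proof.
move=> hv eps eps0.
pose c : R := 1 + `|v|; pose G (x : R) := Num.min `|x - v| c.
have c0 : 0 < c by rewrite ltr_pwDl.
have G0 x : 0 <= G x by rewrite le_min normr_ge0 ltW.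
pose g n (w : T) : R := G ((Y n w 0 ord0)%:~R / n%:R).
have mg n : measurable_fun setT (g n).
  exact: (@measurable_Y_fun n (fun y => G ((y 0 ord0)%:~R / n%:R))).
have gE n : (0 < n)%N -> (\int[P]_w (g n w)%:E)%E =
    (kexp k n (fun h => `|(lev h)%:~R - v * (size h)%:R| / n%:R) [::])%:E.
  move=> n0; have nR : 0 < n%:R :> R by rewrite ltr0n.
  apply: expectation_kexp => [//|w|h w sh ch]; first exact: G0.
  rewrite /g /G -{1}sh (cyl_last ch) -/(lev h) sh.
  have -> : (lev h)%:~R / n%:R - v = ((lev h)%:~R - v * n%:R) / n%:R.
    by field; rewrite gt_eqF.
  rewrite normrM normfV [`|n%:R|]ger0_norm ?ler0n//; apply/min_idPl.
  rewrite ler_pdivrMr// /c mulrDl mul1r; apply: le_trans (ler_normB _ _) _.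
  rewrite normrM [`|n%:R|]ger0_norm ?ler0n// lerD2r -intr_norm pmulrn ler_int -sh.
  exact: lev_norm.
have lim0 : [sequence (\int[P]_w (g n w)%:E)%E]_n @ \oo --> (\int[P]_(w in setT) (cst 0 w))%E.
  have [] := @dominated_convergence _ _ _ P setT measurableT (fun n w => (g n w)%:E) (cst 0%E) (cst c%:E).
  - by move=> n; apply/measurable_EFinP.
  - exact: measurable_cst.
  - apply: filterS hv => w hw _; apply: cvg_EFin; first by near=> n.
    apply/cvgrPdist_le => e e0; move/cvgrPdist_le/(_ e e0): hw.
    apply: filterS => n hn; rewrite sub0r normrN /= ger0_norm; last exact: G0.
    by rewrite /g /G ge_min distrC hn.
  - exact: finite_measure_integrable_cst.
  - apply: aeW => w n _ /=; rewrite ger0_norm; last exact: G0.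
    by rewrite lee_fin /g /G ge_min lexx orbT.
  by [].
rewrite integral0 in lim0.
have := lim0 => /fine_cvgP[_ /cvgrPdist_le/(_ eps eps0)[n0 _ hn0]].
exists n0.+1 => n nn; have n1 : (0 < n)%N by lia.
have nR : 0 < n%:R :> R by rewrite ltr0n.
have := hn0 n; rewrite /= => /(_ _)/wrap[]; first by lia.
rewrite sub0r normrN gE//= ger0_norm; last by apply: kexp_ge0 => // u _; rewrite divr_ge0.
rewrite (@eq_kexp _ _ _ _ _ (fun h => n%:R^-1 * `|(lev h)%:~R - v * (size h)%:R|)) => [|u _]; last first.
  by rewrite mulrC.
by rewrite kexpZ ler_pdivrMl// mulrC.
Unshelve. all: by end_near.
Qed.

End Trajectories.

(** * The range of the walk with infinitely many excitations *)

Section Range.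
Context (R : realType) (d : nat).
Implicit Types (h u : history d) (s : step d) (beta : R).
Local Notation k beta := (erw (d := d) None beta).

Lemma erw_None beta h s : k beta h s = k beta [::] s.
Proof. by []. Qed.

Lemma kexp_shift beta n (f : history d -> R) h :
  kexp (k beta) n f h = kexp (k beta) n (fun u => f (u ++ h)) [::].
Proof.
elim: n f h => [//|n IH] f h; rewrite !kexpSr [LHS]IH.
apply: eq_kexp => u _; rewrite cats0; apply: eq_bigr => s _.
by rewrite erw_None [in RHS]erw_None.
Qed.

(** For [m] infinite the steps are independent with a common law, so a trajectory may also grow at
    its oldest end. There, [fresh] and [first_loop] are updated by a single condition on the
    endpoint. *)
Lemma kexp_oldest beta n (f : history d -> R) :
  kexp (k beta) n.+1 f [::] =
  kexp (k beta) n (fun u => \sum_s k beta [::] s * f (rcons u s)) [::].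
Proof.
rewrite kexpS kexp_sum; apply: eq_bigr => s _; rewrite kexp_shift -kexpZ.
by apply: eq_kexp => u _; rewrite !cats0 cats1.
Qed.

Definition poslist h := [seq pos (drop j h) | j <- iota 0 (size h).+1].
Definition rng h := size (undup (poslist h)).

Lemma poslist_cons s h : poslist (s :: h) = pos (s :: h) :: poslist h.
Proof.
rewrite /poslist -[(size (s :: h)).+1]/(1 + (size h).+1)%N iotaD map_cat /=; congr (_ :: _).
by rewrite -[LHS]/(map _ (iota 1 (size h).+1)) (iotaDl 1 0) -map_comp.
Qed.

(** By time reversal ([take j h] are the last [j] steps), the endpoint of [h] has
    not been visited before. *)
Definition fresh h := all (fun j => pos (take j h) != 0) (iota 1 (size h)).
Definition first_loop h := all (fun j => pos (take j h) != 0) (iota 1 (size h).-1) && (pos h == 0).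

Lemma fresh_cons s h : fresh (s :: h) = (pos (s :: h) \notin poslist h).
Proof.
apply/idP/idP.
  move=> /allP fr; apply/negP => /mapP[j]; rewrite mem_iota => jh e.
  have jin : j.+1 \in iota 1 (size (s :: h)) by rewrite mem_iota /= add1n ltnS; case/andP: jh.
  move/negP: (fr _ jin); apply; have : pos (s :: h) = pos (take j.+1 (s :: h)) + pos (drop j.+1 (s :: h)).
    by rewrite -pos_cat cat_take_drop.
  by rewrite /= e -{1}[pos (drop j h)]add0r => /addIr <-.
apply: contraR => /allPn[j]; rewrite mem_iota negbK => jh /eqP pj.
apply/mapP; exists j.-1; first by rewrite mem_iota; move: jh => /=; lia.
rewrite -{1}(cat_take_drop j (s :: h)) pos_cat pj add0r.
by case: j jh {pj} => // j _.
Qed.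

Lemma rng_cons s h : rng (s :: h) = (fresh (s :: h) + rng h)%N.
Proof. by rewrite /rng poslist_cons fresh_cons /=; case: (_ \in _). Qed.

Lemma kexp_rng beta n : 0 <= beta <= 1 ->
  kexp (k beta) n (fun h => (rng h)%:R) [::] =
  \sum_(i < n.+1) kexp (k beta) i (fun h => (fresh h)%:R) [::].
Proof.
move=> b01; have kK := erw_kernel d None b01.
elim: n => [|n IH]; first by rewrite big_ord1 !kexp0.
rewrite big_ord_recr /= -IH !kexpSr -kexp_add; apply: eq_kexp => u _.
have <- : \sum_s k beta (u ++ [::]) s * (rng (u ++ [::]))%:R = (rng (u ++ [::]))%:R.
  by rewrite -mulr_suml kK.2 mul1r.
rewrite -big_split /=.
by apply: eq_bigr => s _; rewrite rng_cons natrD; ring.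
Qed.

Lemma fresh_rcons u s : fresh (rcons u s) = fresh u && (pos (rcons u s) != 0).
Proof.
rewrite /fresh size_rcons -[(size u).+1]addn1 iotaD all_cat /= andbT; congr (_ && _).
  apply: eq_in_all => j; rewrite mem_iota => ju; rewrite -cats1 takel_cat//; lia.
by rewrite take_oversize// size_rcons add1n.
Qed.

Lemma first_loop_rcons u s : first_loop (rcons u s) = fresh u && (pos (rcons u s) == 0).
Proof.
rewrite /first_loop /fresh size_rcons /=; congr (_ && _).
apply: eq_in_all => j; rewrite mem_iota => ju; rewrite -cats1 takel_cat//; lia.
Qed.

Definition escape beta n := kexp (k beta) n (fun h => (fresh h)%:R) [::].
Definition loop_prob beta n := kexp (k beta) n (fun h => (first_loop h)%:R) [::].

Lemma escapeS beta n : 0 <= beta <= 1 -> escape beta n.+1 = escape beta n - loop_prob beta n.+1.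
Proof.
move=> b01; have kK := erw_kernel d None b01.
rewrite /escape /loop_prob !kexp_oldest -kexp_sub; apply: eq_kexp => u _; rewrite cats0.
have <- : \sum_s k beta [::] s * (fresh u)%:R = (fresh u)%:R.
  by rewrite -mulr_suml kK.2 mul1r.
rewrite -sumrB; apply: eq_bigr => s _.
rewrite fresh_rcons first_loop_rcons -mulrBr; congr (_ * _).
by case: fresh; case: (pos _ == 0) => /=; ring.
Qed.

(** The density of a biased step with respect to the step without bias; products of these are the
    densities of whole trajectories. *)
Definition tilt beta s : R := if s.1 == ord0 then 1 + (-1) ^+ s.2 * beta else 1.

Lemma erw_tilt beta h s : k beta h s = k 0 h s * tilt beta s.
Proof.
rewrite !erwE /tilt /= !mulr1; case: ifP => _; rewrite ?mulr0 ?addr0 ?mulr1//.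
by rewrite mul1r mulrC.
Qed.

Lemma kexp_tilt beta n (f : history d -> R) :
  kexp (k beta) n f [::] = kexp (k 0) n (fun h => f h * \prod_(s <- h) tilt beta s) [::].
Proof.
elim: n f => [|n IH] f; first by rewrite !kexp0 big_nil mulr1.
rewrite !kexpSr IH; apply: eq_kexp => u _; rewrite mulr_suml.
by apply: eq_bigr => s _; rewrite big_cons erw_tilt; ring.
Qed.

Lemma prod_tilt h : exists a b : nat, lev h = a%:Z - b%:Z /\
  forall beta, \prod_(s <- h) tilt beta s = (1 + beta) ^+ a * (1 - beta) ^+ b.
Proof.
elim: h => [|s h [a [b [lh ph]]]].
  by exists 0%N, 0%N; rewrite lev_nil; split=> // beta; rewrite big_nil !expr0 mulr1.
have [s0|s0] := eqVneq s.1 ord0; last first.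
  exists a, b; rewrite lev_cons /dlev (negbTE s0) add0r; split=> // beta.
  by rewrite big_cons {1}/tilt (negbTE s0) mul1r ph.
have [sb|sb] := boolP s.2.
  exists a, b.+1; rewrite lev_cons /dlev s0 eqxx sb expr1; split; first by lia.
  by move=> beta; rewrite big_cons {1}/tilt s0 eqxx sb expr1 ph exprS; ring.
exists a.+1, b; rewrite lev_cons /dlev s0 eqxx (negbTE sb) expr0; split; first by lia.
by move=> beta; rewrite big_cons {1}/tilt s0 eqxx (negbTE sb) expr0 ph exprS; ring.
Qed.

Lemma loop_prob_le beta beta' n : 0 <= beta -> beta <= beta' -> beta' <= 1 ->
  loop_prob beta' n <= loop_prob beta n.
Proof.
move=> b0 bb b1; rewrite /loop_prob (kexp_tilt beta') (kexp_tilt beta).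
have kK := erw_kernel d None (beta := (0 : R)).
apply: le_kexp => [|u _]; first by apply: kK; rewrite lexx ler01.
have [/andP[_ /eqP pu]|_] := boolP (first_loop _); last by rewrite !mul0r.
rewrite !mul1r; have [a [b [lu tu]]] := prod_tilt (u ++ [::]).
have ab : a = b by move: lu; rewrite /lev pu mxE; lia.
rewrite !tu ab -!exprMn lerXn2r ?nnegrE; nra.
Qed.

Lemma escape_le beta beta' n : 0 <= beta -> beta <= beta' -> beta' <= 1 ->
  escape beta n <= escape beta' n.
Proof.
move=> b0 bb b1; elim: n => [|n IH]; first by rewrite /escape !kexp0.
rewrite !escapeS ?b0 ?b1 ?(le_trans bb)// ?(le_trans b0)//.
by apply: lerB => //; apply: loop_prob_le.
Qed.

Lemma escape_cvg beta : 0 <= beta <= 1 -> cvgn (escape beta).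
Proof.
move=> b01; have kK := erw_kernel d None b01.
apply: nonincreasing_is_cvgn.
  apply/nonincreasing_seqP => n; rewrite escapeS// gerBl.
  by apply: kexp_ge0.
by exists 0 => _ [n _ <-]; apply: kexp_ge0.
Qed.

End Range.

Section AsymptoticRange.
Context (disp : measure_display) (T : measurableType disp) (R : realType) (d : nat).
Variables (P : probability T R) (Y : nat -> T -> 'rV[int]_d.+1) (beta : R).
Hypothesis hY : excited_random_walk P Y None beta.
Hypothesis beta01 : 0 <= beta <= 1.

Lemma mean_range n : fine 'E_P[fun w => (range_size Y n w)%:R] = \sum_(i < n) escape d beta i.
Proof.
rewrite unlock; case: n => [|n].
  by rewrite big_ord0 /range_size /= integral0.
rewrite -kexp_rng// (expectation_kexp hY beta01 (n := n) (f := fun h => (rng h)%:R))//.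
  exact: (measurable_traj_fun hY n.+1 (fun t => (size (undup t))%:R)).
move=> h w sh ch; congr (_%:R); rewrite /range_size /rng -/(traj Y n.+1 w) -sh (traj_cyl ch).
apply/perm_size/uniq_perm; rewrite ?undup_uniq// => x.
by rewrite !mem_undup mem_rev.
Qed.

Lemma asymptotic_range_cvg :
  (fun n => fine 'E_P[fun w => (range_size Y n w)%:R] / n%:R : R) @ \oo --> limn (escape d beta).
Proof.
(* The term of index [n.+1] is the arithmetic mean of the first [n.+1] escape probabilities, so the
   range has the limit of these as its Cesaro limit. *)
rewrite -cvg_shiftS; apply: cvg_trans (cesaro (escape_cvg (d := d) beta01)).
apply: near_eq_cvg.
by near=> n; rewrite /= mean_range /arithmetic_mean /series /= big_mkord mulrC.
Unshelve. all: by end_near.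
Qed.

Lemma asymptotic_rangeE : asymptotic_range P Y = limn (escape d beta).
Proof. exact/cvg_lim/asymptotic_range_cvg. Qed.

End AsymptoticRange.

Theorem theorem1p2 (R : realType) (d : nat)
    (disp : measure_display) (T : measurableType disp)
    (Y : nat -> T -> 'rV[int]_d.+1)
    (P : option nat -> R -> probability T R)
    (hP : forall (m : option nat) (beta : R),
        m <> Some 0%N -> 0 <= beta <= 1 ->
        excited_random_walk (P m beta) Y m beta) :
  (forall beta beta' : R, 0 <= beta -> beta <= beta' -> beta' <= 1 ->
     asymptotic_range (P None beta) Y <= asymptotic_range (P None beta') Y)
  /\
  ((4 <= d.+1)%N ->
   forall beta0 beta1 : R, 0 < beta0 -> beta0 < beta1 -> beta1 < 1 ->
   exists m0 : nat, forall m : nat, (0 < m)%N -> (m0 <= m)%N ->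
   forall v : R -> R,
     (forall beta : R, beta0 <= beta <= beta1 ->
        is_speed (P (Some m) beta) Y (v beta)) ->
     forall beta beta' : R, beta0 <= beta -> beta <= beta' -> beta' <= beta1 ->
       v beta <= v beta').
Proof.
split=> [beta beta' b0 bb b1|d3 beta0 beta1 b0 b01 b1].
  have bI : 0 <= beta <= 1 by rewrite b0 (le_trans bb).
  have bI' : 0 <= beta' <= 1 by rewrite b1 (le_trans b0).
  have noneN : (None : option nat) <> Some 0%N by [].
  rewrite (asymptotic_rangeE (hP None beta noneN bI) bI) (asymptotic_rangeE (hP None beta' noneN bI') bI').
  apply: ler_lim; [exact: escape_cvg|exact: escape_cvg|].
  by near=> n; apply: escape_le.
have [m0 hm0] := speed_monotone d3 b0 b01 b1.
exists m0 => m m_gt0 mm v hv; apply: (hm0 m mm) => beta bI.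
have bI1 : 0 <= beta <= 1.
  case/andP: bI => x0 x1; rewrite (le_trans (ltW b0) x0)/=.
  exact: le_trans x1 (ltW b1).
have mN : Some m <> Some 0%N by case: m m_gt0 {mm hv}.
exact: (speed_L1 (hP (Some m) beta mN bI1) bI1 (hv beta bI)).
Unshelve. all: by end_near.
Qed.
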